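(* Let $A$ be a finite-dimensional algebra over an algebraically closed field $K$. Then there is a bijection between the set of isomorphism classes of basic support $\tau$-tilting $A$-modules and the set of functorially finite torsion classes in $A\text{-mod}$, given by the mutually inverse maps $T \mapsto \operatorname{gen} T$ and $\mathcal{T} \mapsto \mathcal{P}(\mathcal{T})$.
   Context: $A\text{-mod}$ is the category of finite-dimensional left $A$-modules; ''$A$-module'' means an object of it. $\tau$ is the Auslander–Reiten translation. $\# A$ is the number of isomorphism classes of simple $A$-modules; for a module $X$, $\# X$ is the number of isomorphism classes of indecomposable direct summands of $X$. $X$ is basic if its indecomposable summands in a decomposition are pairwise non-isomorphic. $\operatorname{add} X$ is the class of direct summands of finite direct sums of copies of $X$. $T$ is $\tau$-rigid if $\operatorname{Hom}_A(T,\tau T)=0$; $T$ is $\tau$-tilting if it is $\tau$-rigid and $\# T = \# A$; $T$ is support $\tau$-tilting if it is $\tau$-rigid and there is an idempotent $e\in A$ such that $T$ is a $\tau$-tilting $(A/\langle e\rangle)$-module. A module class is a full subcategory closed under isomorphisms such that $X\oplus Y$ lies in it iff both $X$ and $Y$ do. A torsion theory is a pair of module classes $(\mathcal{T},\mathcal{F})$ with $\operatorname{Hom}_A(\mathcal{T},\mathcal{F})=0$ such that every $X\in A\text{-mod}$ fits into a short exact sequence $0\to tX\to X\to X/tX\to 0$ with $tX\in\mathcal{T}$, $X/tX\in\mathcal{F}$; then $\mathcal{T}$ is called a torsion class. A module class $\mathcal{C}$ is functorially finite if every module $X$ admits a $\mathcal{C}$-preenvelope (a map $X\to C$ with $C\in\mathcal{C}$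 through which every map from $X$ to a module in $\mathcal{C}$ factors) and a $\mathcal{C}$-precover (the dual notion); in $A\text{-mod}$ this is equivalent to the existence of minimal ones. $\operatorname{gen} T$ is the class of quotients of modules in $\operatorname{add} T$. $X\in\mathcal{T}$ is Ext-projective in $\mathcal{T}$ if $\operatorname{Ext}^1_A(X,\mathcal{T})=0$. $\mathcal{P}(\mathcal{T})$ is the direct sum of the indecomposable Ext-projective modules in $\mathcal{T}$, one for each isomorphism class. *)

(* Defs.v *)
From HB Require Import structures.
From mathcomp Require Import all_boot all_order all_algebra.

Set Implicit Arguments.
Unset Strict Implicit.
Unset Printing Implicit Defensive.
Import GRing.Theory.
Local Open Scope ring_scope.

(* Unital associative algebras of finite dimension over K.  Unlike [falgType K],
   this allows the zero algebra: a quotient A/<e> may well be zero (e.g. for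
   e = 1, whose only module is the zero module). *)
Record fdAlgType (K : fieldType) := FdAlg {
  fdalg_vect : vectType K;
  fdalg_mul : fdalg_vect -> fdalg_vect -> fdalg_vect;
  fdalg_one : fdalg_vect;
  fdalg_mulA : associative fdalg_mul;
  fdalg_mul1 : left_id fdalg_one fdalg_mul;
  fdalg_mulr1 : right_id fdalg_one fdalg_mul;
  fdalg_mulDl : left_distributive fdalg_mul +%R;
  fdalg_mulDr : right_distributive fdalg_mul +%R;
  fdalg_mulZl : forall k x y, k *: fdalg_mul x y = fdalg_mul (k *: x) y;
  fdalg_mulZr : forall k x y, k *: fdalg_mul x y = fdalg_mul x (k *: y)
}.

Definition fdalg_sort (K : fieldType) (A : fdAlgType K) : Type := fdalg_vect A.
Coercion fdalg_sort : fdAlgType >-> Sortclass.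

HB.instance Definition _ (K : fieldType) (A : fdAlgType K) :=
  Vector.copy (fdalg_sort A) (fdalg_vect A).
HB.instance Definition _ (K : fieldType) (A : fdAlgType K) :=
  GRing.Zmodule_isPzRing.Build (fdalg_sort A)
    (@fdalg_mulA K A) (@fdalg_mul1 K A) (@fdalg_mulr1 K A)
    (@fdalg_mulDl K A) (@fdalg_mulDr K A).

Section Algebras.
Variables (K : fieldType) (A : fdAlgType K).

Lemma fdalg_scalerAl (k : K) (x y : A) : k *: (x * y) = k *: x * y.
Proof. exact: fdalg_mulZl. Qed.

Lemma fdalg_scalerAr (k : K) (x y : A) : k *: (x * y) = x * (k *: y).
Proof. exact: fdalg_mulZr. Qed.

Definition opp_alg : fdAlgType K :=
  @FdAlg K (fdalg_vect A) (fun x y => (y : A) * (x : A)) (1 : A)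
    (fun x y z => esym (@mulrA A z y x)) (@mulr1 A) (@mul1r A)
    (fun x y z => @mulrDr A z x y) (fun x y z => @mulrDl A y z x)
    (fun k x y => fdalg_scalerAr k y x) (fun k x y => fdalg_scalerAl k y x).

End Algebras.

Notation "A ^opp" := (opp_alg A) (at level 2, format "A ^opp") : type_scope.

Section QuotientAlgebra.
Variables (K : fieldType) (A : fdAlgType K).

Record ideal := Ideal {
  ideal_vs :> {vspace A};
  idealP : forall a x b : A, x \in ideal_vs -> a * x * b \in ideal_vs
}.

Variable I : ideal.

(* A/I is carried by a linear complement of I; [quot_map] is the projection on
   the complement along I, which plays the role of A -> A/I. *)
Definition quot_vect : vectType K := subvs_of (I^C)%VS.

Definition quot_map (a : A) : quot_vect :=
  vsproj (I^C)%VS (daddv_pi (I^C)%VS I a).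
Definition quot_repr (u : quot_vect) : A := vsval u.

Fact quot_map_is_linear : linear quot_map.
Proof. by move=> k x y; rewrite /quot_map !linearP. Qed.
HB.instance Definition _ :=
  GRing.isLinear.Build K A quot_vect *:%R quot_map quot_map_is_linear.

Fact quot_repr_is_linear : linear quot_repr.
Proof. by move=> k x y; rewrite /quot_repr linearP. Qed.
HB.instance Definition _ :=
  GRing.isLinear.Build K quot_vect A *:%R quot_repr quot_repr_is_linear.

Let capCI : ((I^C) :&: I = 0)%VS.
Proof. by rewrite capvC capv_compl. Qed.

Lemma quot_reprK : cancel quot_repr quot_map.
Proof.
move=> u; rewrite /quot_map /quot_repr daddv_pi_id ?subvsP //.
by rewrite vsvalK.
Qed.

Lemma quot_map_eq0 a : (quot_map a == 0) = (a \in (I : {vspace A})).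
Proof.
have aE : daddv_pi (I^C)%VS I a + daddv_pi I (I^C)%VS a = a.
  by rewrite daddv_pi_add // addvC addv_complf memvf.
apply/eqP/idP => [a0|aI].
  rewrite -aE.
  have -> : daddv_pi (I^C)%VS I a = 0.
    have := congr1 quot_repr a0.
    by rewrite linear0 /quot_repr /quot_map vsprojK ?memv_pi.
  by rewrite add0r memv_pi.
rewrite /quot_map; suff -> : daddv_pi (I^C)%VS I a = 0 by rewrite linear0.
have E : daddv_pi I (I^C)%VS a = a by rewrite daddv_pi_id // capvC.
by move: aE; rewrite E => /(canRL (addrK _)); rewrite subrr.
Qed.

Lemma quot_mapP a b : a - b \in (I : {vspace A}) -> quot_map a = quot_map b.
Proof. by rewrite -quot_map_eq0 linearB subr_eq0 => /eqP. Qed.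

Lemma quot_mapK a : quot_repr (quot_map a) - a \in (I : {vspace A}).
Proof. by rewrite -quot_map_eq0 linearB /= quot_reprK subrr. Qed.

Definition quot_mul (u v : quot_vect) : quot_vect :=
  quot_map (quot_repr u * quot_repr v).

Lemma quot_mapM a b : quot_map (a * b) = quot_mul (quot_map a) (quot_map b).
Proof.
apply/esym/quot_mapP.
have -> : quot_repr (quot_map a) * quot_repr (quot_map b) - a * b =
  1 * (quot_repr (quot_map a) - a) * quot_repr (quot_map b)
  + a * (quot_repr (quot_map b) - b) * 1.
  by rewrite mul1r mulr1 mulrBl mulrBr addrA subrK.
by rewrite rpredD // idealP // quot_mapK.
Qed.

Fact quot_mulA : associative quot_mul.
Proof.
move=> u v w; rewrite -[u]quot_reprK -[v]quot_reprK -[w]quot_reprK.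
by rewrite -!quot_mapM mulrA.
Qed.
Fact quot_mul1 : left_id (quot_map 1) quot_mul.
Proof. by move=> u; rewrite -[u]quot_reprK -quot_mapM mul1r. Qed.
Fact quot_mulr1 : right_id (quot_map 1) quot_mul.
Proof. by move=> u; rewrite -[u]quot_reprK -quot_mapM mulr1. Qed.
Fact quot_mulDl : left_distributive quot_mul +%R.
Proof. by move=> u v w; rewrite /quot_mul linearD mulrDl linearD. Qed.
Fact quot_mulDr : right_distributive quot_mul +%R.
Proof. by move=> u v w; rewrite /quot_mul linearD mulrDr linearD. Qed.
Fact quot_mulZl k u v : k *: quot_mul u v = quot_mul (k *: u) v.
Proof. by rewrite /quot_mul linearZ_LR /= -fdalg_scalerAl linearZ_LR. Qed.
Fact quot_mulZr k u v : k *: quot_mul u v = quot_mul u (k *: v).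
Proof. by rewrite /quot_mul linearZ_LR /= -fdalg_scalerAr linearZ_LR. Qed.

Definition quot_alg : fdAlgType K :=
  FdAlg quot_mulA quot_mul1 quot_mulr1 quot_mulDl quot_mulDr
    quot_mulZl quot_mulZr.

Definition quot_pi (a : A) : quot_alg := quot_map a.

Fact quot_pi_linear : linear quot_pi.
Proof. exact: quot_map_is_linear. Qed.
HB.instance Definition _ :=
  GRing.isLinear.Build K A quot_alg *:%R quot_pi quot_pi_linear.

Lemma quot_pi1 : quot_pi 1 = 1. Proof. by []. Qed.
Lemma quot_piM a b : quot_pi (a * b) = quot_pi a * quot_pi b.
Proof. exact: quot_mapM. Qed.

End QuotientAlgebra.

Section PrincipalIdeal.
Variables (K : fieldType) (A : fdAlgType K) (e : A).

(* AeA, spanned by the products a e b of e with basis elements a, b of A *)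
Definition AeA : {vspace A} :=
  <<[seq a * e * b | a <- vbasis {:A}, b <- vbasis {:A}]>>%VS.

Lemma mem_AeA a b : a * e * b \in AeA.
Proof.
rewrite (coord_vbasis (memvf a)) (coord_vbasis (memvf b)).
rewrite !mulr_suml; apply: rpred_sum => i _.
rewrite mulr_sumr; apply: rpred_sum => j _.
rewrite -fdalg_scalerAr -!fdalg_scalerAl !rpredZ // memv_span //.
by apply/allpairsP; exists ((vbasis {:A})`_i, (vbasis {:A})`_j);
   rewrite !mem_nth ?size_tuple.
Qed.

Fact AeA_ideal (a x b : A) : x \in AeA -> a * x * b \in AeA.
Proof.
move=> /(@coord_span _ _ _ (in_tuple _)) ->.
rewrite mulr_sumr mulr_suml; apply: rpred_sum => i _.
rewrite -fdalg_scalerAr -fdalg_scalerAl rpredZ //=.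
have := mem_nth 0 (ltn_ord i); rewrite /=.
case/allpairsP => -[c d] /= [_ _ ->].
by rewrite !mulrA -mulrA; have := mem_AeA (a * c) (d * b); rewrite !mulrA.
Qed.

Definition principal_ideal : ideal A := Ideal AeA_ideal.

End PrincipalIdeal.

Section Modules.
Variables (K : fieldType).

Record fdmod (A : fdAlgType K) := FdMod {
  mod_carrier :> vectType K;
  act : A -> mod_carrier -> mod_carrier;
  act_linearl : forall x, linear (act^~ x);
  act_linearr : forall a, linear (act a);
  act1 : forall x, act 1 x = x;
  actM : forall a b x, act (a * b) x = act a (act b x)
}.

HB.instance Definition _ (A : fdAlgType K) (X : fdmod A) (a : A) :=
  GRing.isLinear.Build K X X *:%R (act a) (@act_linearr A X a).

Implicit Types A : fdAlgType K.

Definition modhom A (X Y : fdmod A) (f : 'Hom(X, Y)) : Prop :=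
  forall a x, f (act a x) = act a (f x).

Definition iso A (X Y : fdmod A) : Prop :=
  exists2 f : 'Hom(X, Y), modhom f & bijective f.

Definition hom_zero A (X Y : fdmod A) : Prop :=
  forall f : 'Hom(X, Y), modhom f -> f = 0.

Definition zero_module A (X : fdmod A) : Prop := \dim {:X} = 0%N.

Definition submodule A (X : fdmod A) (U : {vspace X}) : Prop :=
  forall a x, x \in U -> act a x \in U.

Definition simple A (X : fdmod A) : Prop :=
  ~ zero_module X /\
  forall U : {vspace X}, submodule U -> U = 0%VS \/ U = fullv.

Definition surj A (X Y : fdmod A) (f : 'Hom(X, Y)) : Prop := limg f = fullv.

Definition short_exact A (Y E X : fdmod A) (i : 'Hom(Y, E)) (p : 'Hom(E, X)) :=
  [/\ modhom i, modhom p, lker i = 0%VS, limg i = lker p & surj p].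

Section Constructions.
Variable A : fdAlgType K.

Definition zero_act (a : A) (x : 'rV[K]_0) : 'rV[K]_0 := x.
Fact zero_linearl x : linear (zero_act^~ x).
Proof. by move=> k a b; rewrite [LHS]thinmx0 [RHS]thinmx0. Qed.
Fact zero_linearr a : linear (zero_act a).
Proof. by []. Qed.
Fact zero_act1 x : zero_act 1 x = x. Proof. by []. Qed.
Fact zero_actM a b x : zero_act (a * b) x = zero_act a (zero_act b x).
Proof. by []. Qed.
Definition mzero : fdmod A := FdMod zero_linearl zero_linearr zero_act1 zero_actM.

Section DirectSum.
Variables X Y : fdmod A.
Definition sum_act (a : A) (u : X * Y) : X * Y := (act a u.1, act a u.2).
Fact sum_linearl u : linear (sum_act^~ u).
Proof. by move=> k a b; rewrite /sum_act !act_linearl. Qed.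
Fact sum_linearr a : linear (sum_act a).
Proof. by move=> k u v; rewrite /sum_act /= !act_linearr. Qed.
Fact sum_act1 u : sum_act 1 u = u.
Proof. by rewrite /sum_act !act1; case: u. Qed.
Fact sum_actM a b u : sum_act (a * b) u = sum_act a (sum_act b u).
Proof. by rewrite /sum_act !actM. Qed.
Definition msum : fdmod A := FdMod sum_linearl sum_linearr sum_act1 sum_actM.
End DirectSum.

Fact reg_linearl (x : A) : linear (fun a : A => a * x).
Proof. by move=> k a b; rewrite mulrDl fdalg_scalerAl. Qed.
Fact reg_linearr (a : A) : linear (fun x : A => a * x).
Proof. by move=> k x y; rewrite mulrDr fdalg_scalerAr. Qed.
Definition mreg : fdmod A :=
  @FdMod A A (fun a x => a * x) reg_linearl reg_linearr (@mul1r A)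
    (fun a b x => esym (mulrA a b x)).

End Constructions.

Definition msums A n (s : 'I_n -> fdmod A) : fdmod A :=
  \big[@msum A/mzero A]_(i < n) s i.

Definition indecomposable A (X : fdmod A) : Prop :=
  ~ zero_module X /\
  forall Y Z : fdmod A, iso X (msum Y Z) -> zero_module Y \/ zero_module Z.

Definition summand A (Y X : fdmod A) : Prop :=
  exists Z : fdmod A, iso X (msum Y Z).

Definition add A (X Y : fdmod A) : Prop :=
  exists n, summand Y (msums (fun _ : 'I_n => X)).

Definition gen A (T X : fdmod A) : Prop :=
  exists Y : fdmod A, add T Y /\ exists2 p : 'Hom(Y, X), modhom p & surj p.

(* [s] lists, up to isomorphism and without repetition, the modules in [C] *)
Definition representatives A (C : fdmod A -> Prop) n (s : 'I_n -> fdmod A) :=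
  [/\ forall i, C (s i),
      forall i j, iso (s i) (s j) -> i = j
    & forall X, C X -> exists i, iso X (s i)].

Definition num_classes A (C : fdmod A -> Prop) (n : nat) : Prop :=
  exists s : 'I_n -> fdmod A, representatives C s.

Definition num_simples A (n : nat) : Prop := num_classes (@simple A) n.

Definition num_summands A (X : fdmod A) (n : nat) : Prop :=
  num_classes (fun Y => indecomposable Y /\ summand Y X) n.

Definition basic A (X : fdmod A) : Prop :=
  exists n (s : 'I_n -> fdmod A),
    [/\ forall i, indecomposable (s i),
        forall i j, iso (s i) (s j) -> i = j
      & iso X (msums s)].

Section Dual.
Variables (A : fdAlgType K) (N : fdmod A^opp).

Definition dual_act (a : A) (psi : 'Hom(N, K^o)) : 'Hom(N, K^o) :=
  (psi \o linfun (act (a : A^opp)))%VF.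

Lemma dual_actE a psi x : dual_act a psi x = psi (act (a : A^opp) x).
Proof. by rewrite /dual_act comp_lfunE lfunE. Qed.

Fact dual_linearl psi : linear (dual_act^~ psi).
Proof.
move=> k a b; apply/lfunP => x; rewrite add_lfunE scale_lfunE !dual_actE.
by rewrite -linearP; congr (psi _); apply: (@act_linearl _ N x k a b).
Qed.
Fact dual_linearr a : linear (dual_act a).
Proof.
by move=> k f g; apply/lfunP => x; rewrite !(dual_actE, add_lfunE, scale_lfunE).
Qed.
Fact dual_act1 psi : dual_act 1 psi = psi.
Proof. by apply/lfunP => x; rewrite dual_actE (@act1 _ N). Qed.
Fact dual_actM a b psi : dual_act (a * b) psi = dual_act a (dual_act b psi).
Proof. by apply/lfunP => x; rewrite !dual_actE; rewrite -(@actM _ N b a). Qed.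

(* D N = Hom_K(N, K), with (a psi)(x) = psi(x a), for a right A-module N,
   i.e. a left module over the opposite algebra A^opp *)
Definition dual : fdmod A := FdMod dual_linearl dual_linearr dual_act1 dual_actM.
End Dual.

Section Multiplication.
Variables (A : fdAlgType K) (a : A).

Definition lmul_fun (x : A) : A := a * x.
HB.instance Definition _ := GRing.isLinear.Build K A A *:%R lmul_fun (reg_linearr a).
Definition lmul : 'End(A) := linfun lmul_fun.
Lemma lmulE x : lmul x = a * x. Proof. by rewrite lfunE. Qed.

Definition rmul_fun (x : A) : A := x * a.
HB.instance Definition _ := GRing.isLinear.Build K A A *:%R rmul_fun (reg_linearl a).
Definition rmul : 'End(A) := linfun rmul_fun.
Lemma rmulE x : rmul x = x * a. Proof. by rewrite lfunE. Qed.

End Multiplication.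

Section Star.
Variables (A : fdAlgType K) (P : fdmod A).

Definition hom_defect (a : A) (f : 'Hom(P, A)) : 'Hom(P, A) :=
  (f \o linfun (act a))%VF - (lmul a \o f)%VF.

Lemma hom_defectE a f x : hom_defect a f x = f (act a x) - a * f x.
Proof.
by rewrite /hom_defect add_lfunE opp_lfunE !comp_lfunE lmulE lfunE.
Qed.

Fact hom_defect_is_linear a : linear (hom_defect a).
Proof.
move=> k f g; apply/lfunP => x; rewrite hom_defectE [RHS]add_lfunE.
rewrite [X in _ = X + _]scale_lfunE !hom_defectE !add_lfunE !scale_lfunE mulrDr -fdalg_scalerAr scalerBr.
by rewrite opprD addrACA.
Qed.
HB.instance Definition _ a := GRing.isLinear.Build K 'Hom(P, A) 'Hom(P, A) *:%R
  (hom_defect a) (hom_defect_is_linear a).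

(* Hom_A(P, A) as a subspace of Hom_K(P, A); see [mem_homA] *)
Definition homA : {vspace 'Hom(P, A)} :=
  (\bigcap_(i < \dim {:A}) lker (linfun (hom_defect (vbasis {:A})`_i)))%VS.

Lemma mem_homA (f : 'Hom(P, A)) :
  f \in homA <-> @modhom A P (mreg A) f.
Proof.
split=> [fH a x|fh].
  have H (i : 'I_(\dim {:A})) :
      f (act (vbasis {:A})`_i x) = (vbasis {:A})`_i * f x.
    have : f \in lker (linfun (hom_defect (vbasis {:A})`_i)).
      by apply: subvP fH; rewrite /homA (bigD1 i) //= capvSl.
    rewrite memv_ker lfunE /= => /eqP/lfunP/(_ x).
    by rewrite hom_defectE zero_lfunE => /eqP; rewrite subr_eq0 => /eqP.
  have actD b c : act (b + c) x = act b x + act c x.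
    by have := act_linearl x 1 b c; rewrite !scale1r.
  have act0 : act (0 : A) x = 0.
    by apply: (addrI (act 0 x)); rewrite -actD !addr0.
  have actZ k b : act (k *: b) x = k *: act b x.
    by have := act_linearl x k b 0; rewrite act0 !addr0.
  rewrite [RHS](_ : _ = a * f x) // (coord_vbasis (memvf a)).
  elim/big_rec: _ => [|i b _ IH]; first by rewrite act0 linear0 mul0r.
  by rewrite mulrDl actD linearD actZ linearZ /= H fdalg_scalerAl IH.
rewrite /homA; elim/big_rec: _ => [|i U _ fU]; first exact: memvf.
rewrite memv_cap fU andbT memv_ker lfunE; apply/eqP/lfunP => x.
by rewrite /= hom_defectE fh subrr zero_lfunE.
Qed.

Lemma rmul_homA a f : f \in homA -> (rmul a \o f)%VF \in homA.
Proof.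
move/mem_homA => fh; apply/mem_homA => b x.
by rewrite !comp_lfunE fh !rmulE /= mulrA.
Qed.

Definition star_act (a : A^opp) (f : subvs_of homA) : subvs_of homA :=
  vsproj homA (rmul (a : A) \o vsval f)%VF.

Lemma star_actE a f x : vsval (star_act a f) x = vsval f x * (a : A).
Proof.
by rewrite /star_act vsprojK ?rmul_homA ?subvsP // comp_lfunE rmulE.
Qed.

Fact star_linearl f : linear (star_act^~ f).
Proof.
move=> k a b; apply/subvs_inj/lfunP => x.
rewrite star_actE linearP /= !lfunE /= lfunE /= !star_actE.
by rewrite mulrDr fdalg_scalerAr.
Qed.
Fact star_linearr a : linear (star_act a).
Proof.
move=> k f g; apply/subvs_inj/lfunP => x.
rewrite star_actE !linearP /= !lfunE /= !lfunE /= !star_actE.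
by rewrite mulrDl fdalg_scalerAl.
Qed.
Fact star_act1 f : star_act 1 f = f.
Proof. by apply/subvs_inj/lfunP => x; rewrite star_actE (@mulr1 A). Qed.
Fact star_actM a b f : star_act (a * b) f = star_act a (star_act b f).
Proof. by apply/subvs_inj/lfunP => x; rewrite !star_actE (@mulrA A). Qed.

(* the right A-module Hom_A(P, A), with (f a)(x) = f(x) a *)
Definition star : fdmod A^opp :=
  FdMod star_linearl star_linearr star_act1 star_actM.

End Star.

(* f^* : Hom_A(Q, A) -> Hom_A(P, A), g |-> g o f, for a homomorphism f *)
Definition star_map A (P Q : fdmod A) (f : 'Hom(P, Q)) :
    'Hom(star Q, star P) :=
  linfun (fun g : subvs_of (homA Q) => vsproj (homA P) (vsval g \o f)%VF).

Lemma star_mapE A (P Q : fdmod A) (f : 'Hom(P, Q)) (g : star Q) (x : P) :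
  modhom f -> vsval (star_map f g : subvs_of (homA P)) x =
              vsval (g : subvs_of (homA Q)) (f x).
Proof.
move=> fh; pose h (u : subvs_of (homA Q)) := vsproj (homA P) (vsval u \o f)%VF.
have hl : linear h.
  move=> k u v; rewrite /h linearP comp_lfunDl -comp_lfunZl.
  exact: (linearP (vsproj (homA P))).
pose L : {linear subvs_of (homA Q) -> subvs_of (homA P)} :=
  HB.pack h (GRing.isLinear.Build K _ _ *:%R h hl).
have -> : star_map f g = h g by exact: (lfunE L).
rewrite /h vsprojK ?comp_lfunE //; apply/mem_homA => a y.
by rewrite !comp_lfunE fh; apply: (proj1 (mem_homA _) (subvsP g)).
Qed.

Definition projective A (P : fdmod A) : Prop :=
  forall (Y Z : fdmod A) (g : 'Hom(Y, Z)) (h : 'Hom(P, Z)),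
    modhom g -> surj g -> modhom h ->
    exists2 l : 'Hom(P, Y), modhom l & (g \o l)%VF = h.

Definition superfluous A (X : fdmod A) (U : {vspace X}) : Prop :=
  forall V : {vspace X}, submodule V -> (V + U)%VS = fullv -> V = fullv.

(* P1 -f-> P0 -p-> X -> 0 exact, with P0 -> X and P1 -> ker p projective
   covers *)
Definition min_proj_presentation A (P1 P0 X : fdmod A)
    (f : 'Hom(P1, P0)) (p : 'Hom(P0, X)) : Prop :=
  [/\ [/\ projective P1, projective P0, modhom f & modhom p],
      surj p, limg f = lker p,
      superfluous (lker p) & superfluous (lker f)].

(* N is a transpose of X: P0^* -f^*-> P1^* -> N -> 0 is exact for some
   minimal projective presentation f of X *)
Definition is_transpose A (X : fdmod A) (N : fdmod A^opp) : Prop :=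
  exists (P1 P0 : fdmod A) (f : 'Hom(P1, P0)) (p : 'Hom(P0, X)),
    min_proj_presentation f p /\
    exists q : 'Hom(star P1, N),
      [/\ modhom q, surj q & lker q = limg (star_map f)].

(* Y is isomorphic to tau X = D (Tr X) *)
Definition is_tau A (X Y : fdmod A) : Prop :=
  exists2 N : fdmod A^opp, is_transpose X N & iso Y (dual N).

Definition tau_rigid A (T : fdmod A) : Prop :=
  exists2 Y : fdmod A, is_tau T Y & hom_zero T Y.

Definition tau_tilting A (T : fdmod A) : Prop :=
  tau_rigid T /\ exists n, num_summands T n /\ num_simples A n.

Section Inflation.
Variables (A : fdAlgType K) (I : ideal A) (N : fdmod (quot_alg I)).
Definition infl_act (a : A) (x : N) : N := act (quot_pi I a) x.
Fact infl_linearl x : linear (infl_act^~ x).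
Proof. by move=> k a b; rewrite /infl_act linearP (act_linearl x). Qed.
Fact infl_linearr a : linear (infl_act a).
Proof. exact: act_linearr. Qed.
Fact infl_act1 x : infl_act 1 x = x.
Proof. exact: act1. Qed.
Fact infl_actM a b x : infl_act (a * b) x = infl_act a (infl_act b x).
Proof. by rewrite /infl_act quot_piM actM. Qed.
Definition inflation : fdmod A :=
  FdMod infl_linearl infl_linearr infl_act1 infl_actM.
End Inflation.

Definition support_tau_tilting A (T : fdmod A) : Prop :=
  tau_rigid T /\
  exists2 e : A, e * e = e &
    exists2 N : fdmod (quot_alg (principal_ideal e)),
      tau_tilting N & iso T (inflation N).

Definition module_class A (C : fdmod A -> Prop) : Prop :=
  (forall X Y, iso X Y -> C X -> C Y) /\
  (forall X Y, C (msum X Y) <-> C X /\ C Y).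

Definition torsion_theory A (T F : fdmod A -> Prop) : Prop :=
  [/\ module_class T, module_class F,
      forall X Y, T X -> F Y -> hom_zero X Y
    & forall X : fdmod A, exists (tX Y : fdmod A)
        (i : 'Hom(tX, X)) (p : 'Hom(X, Y)), [/\ T tX, F Y & short_exact i p]].

Definition torsion_class A (T : fdmod A -> Prop) : Prop :=
  exists F, torsion_theory T F.

Definition preenvelope A (C : fdmod A -> Prop) (X D : fdmod A)
    (f : 'Hom(X, D)) : Prop :=
  [/\ C D, modhom f &
      forall (E : fdmod A) (g : 'Hom(X, E)), C E -> modhom g ->
        exists2 h : 'Hom(D, E), modhom h & g = (h \o f)%VF].

Definition precover A (C : fdmod A -> Prop) (X D : fdmod A)
    (f : 'Hom(D, X)) : Prop :=
  [/\ C D, modhom f &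
      forall (E : fdmod A) (g : 'Hom(E, X)), C E -> modhom g ->
        exists2 h : 'Hom(E, D), modhom h & g = (f \o h)%VF].

Definition functorially_finite A (C : fdmod A -> Prop) : Prop :=
  forall X : fdmod A,
    (exists (D : fdmod A) (f : 'Hom(X, D)), preenvelope C f) /\
    (exists (D : fdmod A) (f : 'Hom(D, X)), precover C f).

Record extension A (X Y : fdmod A) := Extension {
  ext_mid : fdmod A;
  ext_inj : 'Hom(Y, ext_mid);
  ext_proj : 'Hom(ext_mid, X);
  ext_exact : short_exact ext_inj ext_proj
}.

(* by the five lemma such an h is automatically an isomorphism *)
Definition ext_equiv A (X Y : fdmod A) (E E' : extension X Y) : Prop :=
  exists h : 'Hom(ext_mid E, ext_mid E'),
    [/\ modhom h, (h \o ext_inj E)%VF = ext_inj E'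
      & (ext_proj E' \o h)%VF = ext_proj E].

Section SplitExtension.
Variables (A : fdAlgType K) (X Y : fdmod A).
Definition split_inj_fun (y : Y) : msum Y X := (y, 0).
Fact split_inj_linear : linear split_inj_fun.
Proof. by move=> k y z; congr (_, _); rewrite /= scaler0 addr0. Qed.
HB.instance Definition _ := GRing.isLinear.Build K Y (msum Y X) *:%R
  split_inj_fun split_inj_linear.
Definition split_proj_fun (u : msum Y X) : X := u.2.
Fact split_proj_linear : linear split_proj_fun.
Proof. by []. Qed.
HB.instance Definition _ := GRing.isLinear.Build K (msum Y X) X *:%R
  split_proj_fun split_proj_linear.

Fact split_short_exact :
  short_exact (linfun split_inj_fun) (linfun split_proj_fun).
Proof.
split.
- by move=> a y; rewrite !lfunE /= /split_inj_fun /act /= /sum_act /= linear0.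
- by move=> a u; rewrite !lfunE.
- apply/eqP/lker0P => y z; rewrite !lfunE /= => -[] //.
- apply/vspaceP => u; rewrite memv_ker lfunE /=.
  apply/memv_imgP/eqP => [[y _ ->]|]; first by rewrite lfunE.
  case: u => y x; rewrite /split_proj_fun /= => ->.
  by exists y; rewrite ?memvf // lfunE.
- apply/vspaceP => x; rewrite memvf; apply/memv_imgP.
  by exists ((0, x) : msum Y X); rewrite ?memvf // lfunE.
Qed.
Definition split_extension : extension X Y := Extension split_short_exact.
End SplitExtension.

(* Ext^1(X, Y) is the set of Yoneda classes of extensions of X by Y, whose zero
   element is the class of the split extension *)
Definition ext1_zero A (X Y : fdmod A) : Prop :=
  forall E : extension X Y, ext_equiv E (split_extension X Y).

Definition ext_projective A (T : fdmod A -> Prop) (X : fdmod A) : Prop :=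
  T X /\ forall Y, T Y -> ext1_zero X Y.

(* X is isomorphic to P(T); such an X exists if and only if there are finitely
   many indecomposable Ext-projectives in T up to isomorphism *)
Definition is_P A (T : fdmod A -> Prop) (X : fdmod A) : Prop :=
  exists n (s : 'I_n -> fdmod A),
    representatives (fun Y => indecomposable Y /\ ext_projective T Y) s /\
    iso X (msums s).

Definition is_iso_class A (C : fdmod A -> Prop) (T : fdmod A) : Prop :=
  forall X, C X <-> iso T X.

(* an isomorphism class is encoded as the predicate of belonging to it *)
Definition basic_stt_classes A : Type :=
  {C : fdmod A -> Prop |
     exists T, [/\ basic T, support_tau_tilting T & is_iso_class C T]}.

Definition ff_torsion_classes A : Type :=
  {C : fdmod A -> Prop | torsion_class C /\ functorially_finite C}.

End Modules.

(* Main.v *)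
Require Import Defs.
From HB Require Import structures.
From mathcomp Require Import all_boot all_order all_algebra.
From mathcomp Require Import zify ring.
From Stdlib Require Import Classical ClassicalEpsilon.
From Stdlib Require Import FunctionalExtensionality PropExtensionality ProofIrrelevance.

Set Implicit Arguments.
Unset Strict Implicit.
Unset Printing Implicit Defensive.
Import GRing.Theory.
Local Open Scope ring_scope.

(** Throughout, let P1 -f-> P0 -> X -> 0 be a minimal projective presentation.

    Since tau X = D Coker f^*, a homomorphism Y -> tau X is a linear form on
    Hom(P1, Y) vanishing on the maps that factor through f ([hom_zero_dual]).
    So Hom(Y, tau X) = 0 means that Hom(f, Y) is onto, and by minimality of the
    presentation this holds exactly when Ext^1(X, -) vanishes on gen Y.  Hence T is
    tau-rigid if and only if Ext^1(T, gen T) = 0 ([tau_rigidP]), and everything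
    below is about Ext-projective modules.

    If Ext^1(T, gen T) = 0, then gen T is closed under extensions ([gen_closed]),
    hence a torsion class, and approximations by copies of T make it
    functorially finite ([gen_preenvelope]).  Conversely let C be a functorially
    finite torsion class, A -> D a minimal C-preenvelope and D1 its cokernel.
    Then D and D1 are Ext-projective in C, D generates C, and each
    Ext-projective module is a summand of copies of D + D1
    ([ext_projective_generator]); by the Krull-Schmidt property P(C) exists, and
    it generates C ([P_exists]).

    It remains to count summands: the number m of indecomposable Ext-projective
    modules X_i of C is the number n of simple modules over A/ann C
    ([num_simples_annihilator]).  Over A/ann C the class C is faithful, so the
    X_i have projective dimension at most one, and
    chi_i(M) = dim Hom(X_i, M) - dim Ext^1(X_i, M) is additive on short exact
    sequences.  There are modules M_j with chi_i(M_j) = 0 exactly when i and j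
    differ ([dual_module]), whereas the vector (chi_i(M))_i is a combination of
    the n vectors attached to the simple modules; so m <= n.  On the other
    hand, for P projective the function dim Hom(P, -) is a linear combination of
    the m functions chi_i ([projective_euler]), and for the projective covers of
    the simple modules these functions are independent; so n <= m.

    An idempotent e that kills the same simple modules as ann C
    ([ideal_idempotent]) now exhibits P(C) as support tau-tilting.  Finally, if
    T is basic and support tau-tilting, then its indecomposable summands are
    among those of P(gen T), and the count shows that there is none besides
    them ([P_gen]). *)

(** * Extremal choices *)

Lemma nat_min (P : nat -> Prop) : (exists n, P n) ->
  exists2 n, P n & forall m, P m -> (n <= m)%N.
Proof.
case=> n Pn; elim/ltn_ind: n Pn => n IH Pn.
have [[m mn Pm]|nP] := classic (exists2 m, (m < n)%N & P m); first exact: IH Pm.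
exists n => // m Pm; rewrite leqNgt; apply/negP => mn.
by apply: nP; exists m.
Qed.

Lemma nat_max (P : nat -> Prop) b : (exists n, P n) ->
    (forall n, P n -> (n <= b)%N) ->
  exists2 n, P n & forall m, P m -> (m <= n)%N.
Proof.
move=> [n Pn] bP; have [|d [m Pm dE] dmin] :=
  @nat_min (fun d => exists2 m, P m & d = (b - m)%N).
  by exists (b - n)%N, n.
exists m => // k Pk; have := dmin _ (ex_intro2 _ _ k Pk erefl).
by rewrite dE; have := bP _ Pm; have := bP _ Pk; lia.
Qed.

(** The largest subspace contained in P is P. *)
Lemma subspace_of (K : fieldType) (V : vectType K) (P : V -> Prop) :
    P 0 -> (forall k x y, P x -> P y -> P (k *: x + y)) ->
  {U : {vspace V} | forall x, x \in U <-> P x}.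
Proof.
move=> P0 PD; apply: constructive_indefinite_description.
have [||d [U UP dU] dmax] := @nat_max
  (fun d => exists2 U : {vspace V}, (forall x, x \in U -> P x) & \dim U = d) (\dim {:V}).
- by exists (\dim (0%VS : {vspace V})), 0%VS => // x; rewrite memv0 => /eqP ->.
- by move=> _ [U _ <-]; apply: dimvS; apply: subvf.
exists U => x; split=> [/UP //|Px].
have UxP y : y \in (<[x]> + U)%VS -> P y.
  by move=> /memv_addP[_ /vlineP[k ->] [u uU ->]]; apply: PD => //; apply: UP.
have := dmax _ (ex_intro2 _ _ _ UxP erefl); rewrite -dU => le.
have /eqP -> : U == (<[x]> + U)%VS by rewrite eqEdim addvSr le.
by apply: (subvP (addvSl _ _)); apply: memv_line.
Qed.

(** * Homomorphisms, submodules and quotient modules *)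

Section Homs.
Variables (K : fieldType) (A : fdAlgType K).
Implicit Types X Y Z W : fdmod A.

Lemma modhom_comp X Y Z (g : 'Hom(Y, Z)) (f : 'Hom(X, Y)) :
  modhom g -> modhom f -> modhom (g \o f)%VF.
Proof. by move=> gh fh a x; rewrite !comp_lfunE fh gh. Qed.

Lemma modhom_id X : @modhom K A X X \1%VF.
Proof. by move=> a x; rewrite !id_lfunE. Qed.

Lemma modhom0 X Y : @modhom K A X Y 0.
Proof. by move=> a x; rewrite !zero_lfunE linear0. Qed.

Lemma modhomP X Y k (f g : 'Hom(X, Y)) :
  modhom f -> modhom g -> modhom (k *: f + g).
Proof. by move=> fh gh a x; rewrite !lfunE /= !lfunE /= fh gh linearP. Qed.

Lemma modhomD X Y (f g : 'Hom(X, Y)) : modhom f -> modhom g -> modhom (f + g).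
Proof. by move=> fh gh; rewrite -[f]scale1r; apply: modhomP. Qed.

Lemma modhomZ X Y k (f : 'Hom(X, Y)) : modhom f -> modhom (k *: f).
Proof. by move=> fh; rewrite -[_ *: f]addr0; apply/modhomP/modhom0. Qed.

Lemma modhomN X Y (f : 'Hom(X, Y)) : modhom f -> modhom (- f).
Proof. by move=> fh; rewrite -scaleN1r; apply: modhomZ. Qed.

Lemma modhomB X Y (f g : 'Hom(X, Y)) : modhom f -> modhom g -> modhom (f - g).
Proof. by move=> fh gh; apply/modhomD/modhomN. Qed.

Lemma modhom_sum X Y n (f : 'I_n -> 'Hom(X, Y)) :
  (forall i, modhom (f i)) -> modhom (\sum_i f i).
Proof.
move=> fh; elim/big_ind: _ => //; first exact: modhom0.
by move=> *; apply: modhomD.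
Qed.

Lemma actDl X (a b : A) (x : X) : act (a + b) x = act a x + act b x.
Proof. by have := act_linearl x 1 a b; rewrite !scale1r. Qed.

Lemma act0l X (x : X) : act 0 x = 0.
Proof. by apply: (addrI (act 0 x)); rewrite -actDl !addr0. Qed.

Lemma actZl X k (a : A) (x : X) : act (k *: a) x = k *: act a x.
Proof. by have := act_linearl x k a 0; rewrite act0l !addr0. Qed.

Lemma actNl X (a : A) (x : X) : act (- a) x = - act a x.
Proof. by rewrite -scaleN1r actZl scaleN1r. Qed.

Lemma actBl X (a b : A) (x : X) : act (a - b) x = act a x - act b x.
Proof. by rewrite actDl actNl. Qed.

Lemma lker0E (U V : vectType K) (f : 'Hom(U, V)) : injective f <-> lker f = 0%VS.
Proof. by split=> [/lker0P/eqP|/eqP/lker0P]. Qed.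

Lemma lker0I (U V : vectType K) (f : 'Hom(U, V)) :
  (forall x, f x = 0 -> x = 0) -> lker f = 0%VS.
Proof.
move=> f0; apply/lker0E => x y /eqP.
by rewrite -subr_eq0 -linearB => /eqP/f0/eqP; rewrite subr_eq0 => /eqP.
Qed.

Lemma surjP X Y (f : 'Hom(X, Y)) : surj f <-> forall y, exists x, f x = y.
Proof.
split=> [fs y|fs].
  by have : y \in limg f by [rewrite fs memvf]; case/memv_imgP => x _ ->; exists x.
apply/vspaceP => y; rewrite memvf; have [x <-] := fs y.
by rewrite memv_img ?memvf.
Qed.

Lemma surj_comp X Y Z (g : 'Hom(Y, Z)) (f : 'Hom(X, Y)) :
  surj g -> surj f -> surj (g \o f)%VF.
Proof. by move=> gs fs; rewrite /surj limg_comp fs. Qed.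

Lemma inj_compr X Y Z (g : 'Hom(Y, Z)) (f : 'Hom(X, Y)) :
  lker (g \o f)%VF = 0%VS -> lker f = 0%VS.
Proof.
move=> /lker0E gi; apply: lker0I => x fx.
by apply: gi; rewrite comp_lfunE fx !linear0.
Qed.

Lemma inj_comp X Y Z (g : 'Hom(Y, Z)) (f : 'Hom(X, Y)) :
  lker g = 0%VS -> lker f = 0%VS -> lker (g \o f)%VF = 0%VS.
Proof.
move=> /lker0E gi /lker0E fi; apply/lker0E => x y.
by rewrite !comp_lfunE => /gi/fi.
Qed.

Lemma inj_dim (U V : vectType K) (f : 'Hom(U, V)) :
  lker f = 0%VS -> \dim (limg f) = \dim {:U}.
Proof. by move=> f0; rewrite limg_dim_eq // f0 capv0. Qed.

Lemma inj_surj X Y (f : 'Hom(X, Y)) :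
  lker f = 0%VS -> \dim {:X} = \dim {:Y} -> surj f.
Proof.
move=> f0 dXY; apply/eqP; rewrite eqEdim subvf inj_dim //.
by rewrite dXY leqnn.
Qed.

Lemma surj_inj X Y (f : 'Hom(X, Y)) :
  surj f -> (\dim {:X} <= \dim {:Y})%N -> lker f = 0%VS.
Proof.
move=> fs dXY; apply/eqP; rewrite -dimv_eq0 -leqn0.
have := limg_ker_dim f fullv; rewrite capfv fs => dE.
by rewrite -(leq_add2r (\dim {:Y})) add0n dE.
Qed.

Lemma mod_eq0 X : zero_module X <-> forall x : X, x = 0.
Proof.
rewrite /zero_module; split=> [/eqP|X0].
  by rewrite dimv_eq0 => /eqP X0 x; apply/eqP; rewrite -memv0 -X0 memvf.
apply/eqP; rewrite dimv_eq0 -subv0; apply/subvP => x _.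
by rewrite (X0 x) memv0.
Qed.

Definition mklfun (U V : vectType K) (h : U -> V) (hl : linear h) : 'Hom(U, V) :=
  linfun (HB.pack h (GRing.isLinear.Build K U V *:%R h hl) : {linear U -> V}).

Lemma mklfunE (U V : vectType K) (h : U -> V) (hl : linear h) x :
  mklfun hl x = h x.
Proof. by rewrite /mklfun lfunE. Qed.

Lemma mkhom X Y (h : X -> Y) : linear h -> (forall a x, h (act a x) = act a (h x)) ->
  exists2 f : 'Hom(X, Y), modhom f & forall x, f x = h x.
Proof.
move=> hl hh; exists (mklfun hl) => [a x|x]; rewrite !mklfunE //.
Qed.

Lemma factor_surj X Y Z (p : 'Hom(X, Y)) (g : 'Hom(X, Z)) :
    modhom p -> surj p -> modhom g -> (forall x, p x = 0 -> g x = 0) ->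
  exists2 h : 'Hom(Y, Z), modhom h & forall x, h (p x) = g x.
Proof.
move=> ph ps gh pg.
have gE x y : p x = p y -> g x = g y.
  move=> pxy; apply/eqP; rewrite -subr_eq0 -linearB; apply/eqP/pg.
  by rewrite linearB /= pxy subrr.
have pK y : p (p^-1%VF y) = y by rewrite limg_lfunVK // ps memvf.
have hE x : (g \o p^-1)%VF (p x) = g x by rewrite comp_lfunE; apply: gE; rewrite pK.
exists (g \o p^-1)%VF => // a y.
by rewrite !comp_lfunE -gh; apply: gE; rewrite ph !pK.
Qed.

Lemma lift_thru X Y Z (i : 'Hom(X, Y)) (g : 'Hom(Z, Y)) :
    modhom i -> lker i = 0%VS -> modhom g -> (forall z, g z \in limg i) ->
  exists2 h : 'Hom(Z, X), modhom h & forall z, i (h z) = g z.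
Proof.
move=> ih i0 gh gi.
have iK z : i ((i^-1 \o g)%VF z) = g z by rewrite comp_lfunE limg_lfunVK.
exists (i^-1 \o g)%VF => // a z.
by have /lker0E := i0; apply; rewrite ih !iK gh.
Qed.

Lemma submodule_ker X Y (f : 'Hom(X, Y)) : modhom f -> submodule (lker f).
Proof.
by move=> fh a x; rewrite !memv_ker fh => /eqP ->; rewrite linear0 eqxx.
Qed.

Lemma submodule_img X Y (f : 'Hom(X, Y)) (U : {vspace X}) :
  modhom f -> submodule U -> submodule (f @: U)%VS.
Proof.
by move=> fh US a _ /memv_imgP[x xU ->]; rewrite -fh memv_img ?US.
Qed.

Lemma submodule_pre X Y (f : 'Hom(X, Y)) (U : {vspace Y}) :
  modhom f -> submodule U -> submodule (f @^-1: U)%VS.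
Proof. by move=> fh US a x; rewrite -!memv_preim fh => /US. Qed.

Lemma submodule_full X : submodule (fullv : {vspace X}).
Proof. by move=> a x; rewrite !memvf. Qed.

Lemma submodule0 X : submodule (0%VS : {vspace X}).
Proof. by move=> a x; rewrite !memv0 => /eqP ->; rewrite linear0. Qed.

Lemma sub_exists X (U : {vspace X}) : submodule U ->
  exists (Y : fdmod A) (i : 'Hom(Y, X)), [/\ modhom i, lker i = 0%VS & limg i = U].
Proof.
move=> US; pose h (a : A) (u : subvs_of U) : subvs_of U := vsproj U (act a (vsval u)).
have hE a u : vsval (h a u) = act a (vsval u).
  by rewrite /h vsprojK // US // subvsP.
have h1 u : linear (h^~ u).
  by move=> k a b; apply/subvs_inj; rewrite linearP /= !hE act_linearl.
have h2 a : linear (h a).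
  move=> k u v; apply/subvs_inj; rewrite [RHS]linearP /= !hE -linearP.
  by congr act; rewrite linearP.
have h3 u : h 1 u = u by apply/subvs_inj; rewrite hE act1.
have h4 a b u : h (a * b) u = h a (h b u) by apply/subvs_inj; rewrite !hE actM.
pose Y : fdmod A := FdMod h1 h2 h3 h4.
have [f fh fE] := @mkhom Y X (fun u : subvs_of U => vsval u)
  (@linearP _ _ _ _ (@vsval _ _ U)) hE.
exists Y, f; split=> //.
  by apply: lker0I => x; rewrite fE -(linear0 (@vsval _ _ U)) => /subvs_inj.
apply/vspaceP => x; apply/memv_imgP/idP => [[u _ ->]|xU].
  by rewrite fE subvsP.
by exists (vsproj U x); rewrite ?memvf // fE vsprojK.
Qed.

(** The quotient is carried by the image of a linear projection q with kernel U. *)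
Lemma quot_exists X (U : {vspace X}) : submodule U ->
  exists (Z : fdmod A) (p : 'Hom(X, Z)), [/\ modhom p, surj p & lker p = U].
Proof.
move=> US; pose q : 'End(X) := (\1 - projv U)%VF.
have qE x : q x = x - projv U x by rewrite /q !lfunE /= lfunE /= opp_lfunE.
have qU x : q x = 0 <-> x \in U.
  rewrite qE; split=> [/eqP|xU]; last by rewrite projv_id ?subrr.
  by rewrite subr_eq0 => /eqP ->; apply: memv_proj.
have qK x : x - q x \in U by rewrite qE opprB addrC subrK memv_proj.
have qq x y : x - y \in U -> q x = q y.
  by move/qU/eqP; rewrite linearB /= subr_eq0 => /eqP.
have qid x : q (q x) = q x by apply/esym/qq/qK.
pose C := limg q.
have qC x : q x \in C by rewrite memv_img ?memvf.
have qCid x : x \in C -> q x = x by move=> /memv_imgP[y _ ->].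
pose h (a : A) (u : subvs_of C) : subvs_of C := vsproj C (q (act a (vsval u))).
have hE a u : vsval (h a u) = q (act a (vsval u)) by rewrite /h vsprojK.
have h1 u : linear (h^~ u).
  by move=> k a b; apply/subvs_inj; rewrite linearP /= !hE act_linearl linearP.
have h2 a : linear (h a).
  move=> k u v; apply/subvs_inj; rewrite [RHS]linearP /= !hE -linearP; congr (q _).
  by rewrite -linearP; congr act; rewrite linearP.
have h3 u : h 1 u = u by apply/subvs_inj; rewrite hE act1 qCid ?subvsP.
have h4 a b u : h (a * b) u = h a (h b u).
  apply/subvs_inj; rewrite !hE actM; apply: qq.
  by rewrite -linearB; apply/US/qK.
pose Z : fdmod A := FdMod h1 h2 h3 h4.
pose hp (x : X) : subvs_of C := vsproj C (q x).
have hpE x : vsval (hp x) = q x by rewrite /hp vsprojK.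
have [||p ph pE] := @mkhom X Z hp.
- by move=> k x y; apply/subvs_inj; rewrite linearP /= !hpE linearP.
- move=> a x; apply/subvs_inj; rewrite hE !hpE; apply: qq.
  by rewrite -linearB; apply/US/qK.
exists Z, p; split=> //.
  apply/surjP => u; exists (vsval (u : subvs_of C)); rewrite pE.
  by apply/subvs_inj; rewrite hpE qCid ?subvsP.
apply/vspaceP => x; rewrite memv_ker pE; apply/eqP/idP => [p0|/qU q0].
  by apply/qU; rewrite -hpE p0 linear0.
by apply/subvs_inj; rewrite hpE q0 linear0.
Qed.
End Homs.
(** * Isomorphisms, direct sums and direct summands *)

Section Sums.
Variables (K : fieldType) (A : fdAlgType K).
Implicit Types X Y Z W : fdmod A.

Lemma isoP X Y : iso X Y <->
  exists (f : 'Hom(X, Y)) (g : 'Hom(Y, X)),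
    [/\ modhom f, modhom g, cancel f g & cancel g f].
Proof.
split=> [[f fh [g fK gK]]|[f [g [fh gh fK gK]]]]; last by exists f => //; exists g.
have [|a y|g' g'h g'E] := @mkhom _ _ Y X g.
- by move=> k x y; apply: (can_inj fK); rewrite gK [RHS]linearP /= !gK.
- by apply: (can_inj fK); rewrite fh !gK.
by exists f, g'; split=> // x; rewrite g'E.
Qed.

Lemma iso_intro X Y (f : 'Hom(X, Y)) : modhom f -> lker f = 0%VS -> surj f -> iso X Y.
Proof.
move=> fh /lker0E fi fs; exists f => //; exists (f^-1)%VF => x.
  by apply: fi; rewrite limg_lfunVK // memv_img ?memvf.
by rewrite limg_lfunVK // fs memvf.
Qed.

Lemma iso_refl X : iso X X.
Proof.
apply/isoP; exists \1%VF, \1%VF.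
by split=> [||x|x]; rewrite ?id_lfunE //; apply: modhom_id.
Qed.

Lemma iso_sym X Y : iso X Y -> iso Y X.
Proof. by case/isoP => f [g [? ? ? ?]]; apply/isoP; exists g, f. Qed.

Lemma iso_trans Y X Z : iso X Y -> iso Y Z -> iso X Z.
Proof.
case/isoP => f [g [fh gh fK gK]] /isoP[f' [g' [fh' gh' fK' gK']]].
apply/isoP; exists (f' \o f)%VF, (g \o g')%VF.
by split=> [||x|x]; rewrite ?comp_lfunE ?fK' ?gK //; apply: modhom_comp.
Qed.

Lemma iso_bij X Y : iso X Y ->
  exists f : 'Hom(X, Y), [/\ modhom f, lker f = 0%VS & surj f].
Proof.
case/isoP => f [g [fh gh fK gK]]; exists f; split=> //.
  exact/lker0E/(can_inj fK).
by apply/surjP => y; exists (g y).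
Qed.

Lemma iso_zero X Y : iso X Y -> zero_module X -> zero_module Y.
Proof.
case/isoP => f [g [_ _ _ gK]] /mod_eq0 X0; apply/mod_eq0 => y.
by rewrite -(gK y) (X0 (g y)) linear0.
Qed.

Lemma zero_iso X Y : zero_module X -> zero_module Y -> iso X Y.
Proof.
move=> /mod_eq0 X0 /mod_eq0 Y0; apply: (@iso_intro _ _ 0); first exact: modhom0.
  by apply: lker0I.
by apply/surjP => y; exists 0; rewrite (Y0 y) linear0.
Qed.

Section Binary.
Variables X Y : fdmod A.

Fact mfst_linear : linear (fun u : msum X Y => u.1). Proof. by []. Qed.
Fact msnd_linear : linear (fun u : msum X Y => u.2). Proof. by []. Qed.
Fact minl_linear : linear (fun x : X => (x, 0) : msum X Y).
Proof. by move=> k x y; congr (_, _); rewrite /= scaler0 addr0. Qed.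
Fact minr_linear : linear (fun y : Y => (0, y) : msum X Y).
Proof. by move=> k x y; congr (_, _); rewrite /= scaler0 addr0. Qed.

Definition mfst : 'Hom(msum X Y, X) := mklfun mfst_linear.
Definition msnd : 'Hom(msum X Y, Y) := mklfun msnd_linear.
Definition minl : 'Hom(X, msum X Y) := mklfun minl_linear.
Definition minr : 'Hom(Y, msum X Y) := mklfun minr_linear.

Lemma mfstE u : mfst u = u.1. Proof. exact: mklfunE. Qed.
Lemma msndE u : msnd u = u.2. Proof. exact: mklfunE. Qed.
Lemma minlE x : minl x = (x, 0). Proof. exact: mklfunE. Qed.
Lemma minrE y : minr y = (0, y). Proof. exact: mklfunE. Qed.

Lemma mfst_hom : modhom mfst. Proof. by move=> a u; rewrite !mfstE. Qed.
Lemma msnd_hom : modhom msnd. Proof. by move=> a u; rewrite !msndE. Qed.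
Lemma minl_hom : modhom minl.
Proof. by move=> a x; rewrite !minlE; congr (_, _); rewrite linear0. Qed.
Lemma minr_hom : modhom minr.
Proof. by move=> a x; rewrite !minrE; congr (_, _); rewrite linear0. Qed.

Lemma msum_eta (u : msum X Y) : minl (mfst u) + minr (msnd u) = u.
Proof.
by rewrite minlE minrE mfstE msndE; case: u => x y; congr (_, _);
  rewrite /= ?addr0 ?add0r.
Qed.

End Binary.

Lemma msum_hom X Y Z (f : 'Hom(X, Z)) (g : 'Hom(Y, Z)) : modhom f -> modhom g ->
  exists2 h : 'Hom(msum X Y, Z), modhom h & forall x y, h (x, y) = f x + g y.
Proof.
move=> fh gh; exists ((f \o mfst X Y)%VF + (g \o msnd X Y)%VF).
  apply: modhomD; apply: modhom_comp => //; [exact: mfst_hom|exact: msnd_hom].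
by move=> x y; rewrite add_lfunE !comp_lfunE mfstE msndE.
Qed.

Lemma hom_msum X Y Z (f : 'Hom(Z, X)) (g : 'Hom(Z, Y)) : modhom f -> modhom g ->
  exists2 h : 'Hom(Z, msum X Y), modhom h & forall z, h z = (f z, g z).
Proof.
move=> fh gh; exists ((minl X Y \o f)%VF + (minr X Y \o g)%VF).
  apply: modhomD; apply: modhom_comp => //; [exact: minl_hom|exact: minr_hom].
move=> z; rewrite add_lfunE !comp_lfunE minlE minrE.
by congr (_, _); rewrite /= ?addr0 ?add0r.
Qed.

Definition retract Y X : Prop :=
  exists (v : 'Hom(Y, X)) (u : 'Hom(X, Y)),
    [/\ modhom v, modhom u & forall y, u (v y) = y].

Lemma split_iso X Y Z (v : 'Hom(Y, X)) (u : 'Hom(X, Y)) (i : 'Hom(Z, X)) :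
    modhom v -> modhom u -> (forall y, u (v y) = y) ->
    modhom i -> lker i = 0%VS -> limg i = lker u ->
  iso X (msum Y Z).
Proof.
move=> vh uh uv ih i0 iu; have [h hh hE] := msum_hom vh ih.
have ui z : u (i z) = 0.
  by apply/eqP; rewrite -memv_ker -iu memv_img ?memvf.
apply/iso_sym/(iso_intro hh).
  apply: lker0I => -[y z]; rewrite hE => yz.
  have y0 : y = 0.
    by have := congr1 u yz; rewrite linearD /= uv ui addr0 linear0.
  have /lker0E ii := i0; have -> : z = 0.
    by apply: ii; move: yz; rewrite y0 !linear0 add0r.
  by rewrite y0.
apply/surjP => x; have /memv_imgP[z _ zE] : x - v (u x) \in limg i.
  by rewrite iu memv_ker linearB /= uv subrr.
by exists (u x, z); rewrite hE -zE addrC subrK.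
Qed.

Lemma retract_split X Y : retract Y X -> exists Z, iso X (msum Y Z).
Proof.
case=> v [u [vh uh uv]].
have [Z [i [ih i0 iu]]] := sub_exists (submodule_ker uh).
by exists Z; apply: split_iso ih i0 iu.
Qed.

Lemma retract_msuml X Y : retract X (msum X Y).
Proof.
exists (minl X Y), (mfst X Y); split; [exact: minl_hom|exact: mfst_hom|].
by move=> x; rewrite minlE mfstE.
Qed.

Lemma retract_msumr X Y : retract Y (msum X Y).
Proof.
exists (minr X Y), (msnd X Y); split; [exact: minr_hom|exact: msnd_hom|].
by move=> x; rewrite minrE msndE.
Qed.

Lemma retract_trans Y X Z : retract X Y -> retract Y Z -> retract X Z.
Proof.
case=> v [u [vh uh uv]] [v' [u' [vh' uh' uv']]].
exists (v' \o v)%VF, (u \o u')%VF; split; try exact: modhom_comp.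
by move=> x; rewrite !comp_lfunE uv' uv.
Qed.

Lemma iso_retract X Y : iso X Y -> retract X Y.
Proof. by case/isoP => f [g [fh gh fK _]]; exists f, g. Qed.

Lemma summandP Y X : summand Y X <-> retract Y X.
Proof.
split=> [[Z /iso_sym/iso_retract YX]|/retract_split //].
exact: retract_trans (retract_msuml Y Z) YX.
Qed.

Lemma indec_retract X Y :
  indecomposable X -> retract Y X -> ~ zero_module Y -> iso Y X.
Proof.
case=> _ Xind [v [u [vh uh uv]]] Y0.
have [Z [i [ih i0 iu]]] := sub_exists (submodule_ker uh).
have [//|/mod_eq0 Z0] := Xind _ _ (split_iso vh uh uv ih i0 iu).
apply/iso_sym/(iso_intro uh); last by apply/surjP => y; exists (v y).
apply: lker0I => x ux; have : x \in limg i by rewrite iu memv_ker ux.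
by case/memv_imgP => z _ ->; rewrite (Z0 z) linear0.
Qed.

Lemma indec_iso X Y : iso X Y -> indecomposable X -> indecomposable Y.
Proof.
move=> XY [X0 Xi]; split=> [/(iso_zero (iso_sym XY)) //|U V /(iso_trans XY)].
exact: Xi.
Qed.

(** Direct sums are recognised by their injections and projections, which makes
    them insensitive to the order and the names of the summands. *)
Definition biprod n (s : 'I_n -> fdmod A) X : Prop :=
  exists (f : forall i, 'Hom(s i, X)) (p : forall i, 'Hom(X, s i)),
    [/\ forall i, modhom (f i), forall i, modhom (p i),
        forall i y, p i (f i y) = y,
        forall i j y, i != j -> p i (f j y) = 0
      & forall x, x = \sum_i f i (p i x)].

Lemma biprod_msums n (s : 'I_n -> fdmod A) : biprod s (msums s).
Proof.
elim: n s => [|n IH] s.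
  rewrite /msums big_ord0.
  exists (fun i => 0), (fun i => 0); split=> //; try by move=> [].
  by move=> x; rewrite big_ord0 [LHS]thinmx0.
have [f [p [fh ph pf pf0 fp]]] := IH (fun i => s (lift ord0 i)).
rewrite /msums big_ord_recl -/(msums (fun i => s (lift ord0 i))).
set S := msums _ in f p fh ph pf pf0 fp *.
pose P := msum (s ord0) S.
pose f' i : 'Hom(s i, P) :=
  match unliftP ord0 i with
  | UnliftSome j e => eq_rect_r (fun k => 'Hom(s k, P)) (minr (s ord0) S \o f j)%VF e
  | UnliftNone e => eq_rect_r (fun k => 'Hom(s k, P)) (minl (s ord0) S) e
  end.
pose p' i : 'Hom(P, s i) :=
  match unliftP ord0 i with
  | UnliftSome j e => eq_rect_r (fun k => 'Hom(P, s k)) (p j \o msnd (s ord0) S)%VF e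
  | UnliftNone e => eq_rect_r (fun k => 'Hom(P, s k)) (mfst (s ord0) S) e
  end.
have f0 : f' ord0 = minl (s ord0) S.
  rewrite /f'; case: unliftP => [j e|e]; last by rewrite (eq_irrelevance e erefl).
  by exfalso; have := neq_lift ord0 j; rewrite -e eqxx.
have p0 : p' ord0 = mfst (s ord0) S.
  rewrite /p'; case: unliftP => [j e|e]; last by rewrite (eq_irrelevance e erefl).
  by exfalso; have := neq_lift ord0 j; rewrite -e eqxx.
have fS j : f' (lift ord0 j) = (minr (s ord0) S \o f j)%VF.
  rewrite /f'; case: unliftP => [k e|e]; last first.
    by exfalso; have := neq_lift ord0 j; rewrite e eqxx.
  by have kj := lift_inj e; case: _ / kj in e *; rewrite (eq_irrelevance e erefl).
have pS j : p' (lift ord0 j) = (p j \o msnd (s ord0) S)%VF.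
  rewrite /p'; case: unliftP => [k e|e]; last first.
    by exfalso; have := neq_lift ord0 j; rewrite e eqxx.
  by have kj := lift_inj e; case: _ / kj in e *; rewrite (eq_irrelevance e erefl).
exists f', p'; split.
- move=> i; case: (unliftP ord0 i) => [j|] ->; rewrite ?f0 ?fS.
    by apply: modhom_comp => //; apply: minr_hom.
  exact: minl_hom.
- move=> i; case: (unliftP ord0 i) => [j|] ->; rewrite ?p0 ?pS.
    by apply: modhom_comp => //; apply: msnd_hom.
  exact: mfst_hom.
- move=> i; case: (unliftP ord0 i) => [j|] -> y; rewrite ?p0 ?pS ?f0 ?fS.
    by rewrite !comp_lfunE minrE msndE pf.
  by rewrite minlE mfstE.
- move=> i i'; case: (unliftP ord0 i) => [j|] ->; case: (unliftP ord0 i') => [j'|] -> y;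
    rewrite ?p0 ?pS ?f0 ?fS ?comp_lfunE ?minlE ?minrE ?mfstE ?msndE ?linear0 ?eqxx //.
  by rewrite (inj_eq lift_inj) => jj; rewrite pf0.
move=> x; rewrite big_ord_recl f0 p0 -{1}(msum_eta x); congr (_ + _).
rewrite [in LHS](fp (msnd _ _ x)) linear_sum; apply: eq_bigr => j _.
by rewrite fS pS !comp_lfunE.
Qed.

Lemma biprod_iso n (s t : 'I_n -> fdmod A) X Y :
  biprod s X -> biprod t Y -> (forall i, iso (s i) (t i)) -> iso X Y.
Proof.
case=> f [p [fh ph pf pf0 fp]] [g [q [gh qh qg qg0 gq]]] st.
have [h /= hP] := @fin_all_exists _ (fun i => 'Hom(s i, t i)) _
  (fun i => proj1 (isoP _ _) (st i)).
have [k /= hk] := fin_all_exists hP.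
apply/isoP; exists (\sum_i (g i \o (h i \o p i)))%VF, (\sum_i (f i \o (k i \o q i)))%VF.
have [hh kh hK kK] : [/\ forall i, modhom (h i), forall i, modhom (k i),
   forall i, cancel (h i) (k i) & forall i, cancel (k i) (h i)].
  by split=> i; case: (hk i).
split.
- by apply: modhom_sum => i; do 2 apply: modhom_comp => //.
- by apply: modhom_sum => i; do 2 apply: modhom_comp => //.
- move=> x; rewrite [RHS](fp x) sum_lfunE; apply: eq_bigr => i _.
  rewrite sum_lfunE (bigD1 i) //= !comp_lfunE linearD /= qg linear_sum big1 ?addr0 ?hK //.
  by move=> j ij; rewrite !comp_lfunE /= qg0 // eq_sym.
move=> x; rewrite [RHS](gq x) sum_lfunE; apply: eq_bigr => i _.
rewrite sum_lfunE (bigD1 i) //= !comp_lfunE linearD /= pf linear_sum big1 ?addr0 ?kK //.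
by move=> j ij; rewrite !comp_lfunE /= pf0 // eq_sym.
Qed.

Lemma biprod_reindex n m (s : 'I_n -> fdmod A) X (h : 'I_m -> 'I_n) :
  bijective h -> biprod s X -> biprod (fun i => s (h i)) X.
Proof.
move=> hb [f [p [fh ph pf pf0 fp]]].
exists (fun i => f (h i)), (fun i => p (h i)); split=> // [i j y ij|x].
  by apply: pf0; rewrite (inj_eq (bij_inj hb)).
rewrite [LHS]fp (reindex h) //; exact: onW_bij.
Qed.

Lemma biprodP n (s : 'I_n -> fdmod A) X : biprod s X -> iso X (msums s).
Proof. by move=> sX; apply: biprod_iso sX (biprod_msums s) (fun i => iso_refl _). Qed.

Lemma msums_retract n (s : 'I_n -> fdmod A) i : retract (s i) (msums s).
Proof. by have [f [p [fh ph pf _ _]]] := biprod_msums s; exists (f i), (p i). Qed.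

Lemma hom_from_msums n (s : 'I_n -> fdmod A) Y (g : forall i, 'Hom(s i, Y)) :
    (forall i, modhom (g i)) ->
  exists2 h : 'Hom(msums s, Y), modhom h & limg h = (\sum_i limg (g i))%VS.
Proof.
move=> gh; have [f [p [fh ph pf pf0 fp]]] := biprod_msums s.
pose h : 'Hom(msums s, Y) := (\sum_i (g i \o p i))%VF.
have hf i x : h (f i x) = g i x.
  rewrite sum_lfunE (bigD1 i) //= comp_lfunE pf big1 ?addr0 // => j ij.
  by rewrite comp_lfunE pf0 ?linear0.
exists h; first by apply: modhom_sum => i; apply: modhom_comp.
apply/eqP; rewrite eqEsubv; apply/andP; split.
  apply/subvP => _ /memv_imgP[x _ ->]; rewrite sum_lfunE; apply: memv_sumr => i _.
  by rewrite comp_lfunE memv_img ?memvf.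
apply/subv_sumP => i _; apply/subvP => _ /memv_imgP[x _ ->].
by rewrite -hf memv_img ?memvf.
Qed.

End Sums.
(** * Fitting's lemma and the Krull-Schmidt property *)

Section Fitting.
Variables (K : fieldType) (A : fdAlgType K).
Implicit Types X Y Z T : fdmod A.

(** The ring structure of 'End(X), hence its powers, requires X to be nonzero. *)
Fixpoint lpow X (h : 'End(X)) n : 'End(X) :=
  if n is m.+1 then (h \o lpow h m)%VF else \1%VF.

Lemma lpow_hom X (h : 'End(X)) n : @modhom K A X X h -> @modhom K A X X (lpow h n).
Proof.
by move=> hh; elim: n => [|n IH]; [apply: modhom_id|apply: modhom_comp].
Qed.

Lemma lpowD X (h : 'End(X)) n m : lpow h (n + m) = (lpow h n \o lpow h m)%VF.
Proof. by elim: n => [|n IH] /=; rewrite ?comp_lfun1l // IH comp_lfunA. Qed.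

Lemma lpow_fix X Y (h : 'End(X)) (f : Y -> X) n :
  (forall y, h (f y) = f y) -> forall y, lpow h n (f y) = f y.
Proof.
by move=> hf y; elim: n => [|n IH] /=; rewrite ?id_lfunE // comp_lfunE IH hf.
Qed.

(** Choosing a power with smallest image makes that power bijective on its own
    image, so that the image is a complement of the kernel. *)
Lemma fitting X (h : 'End(X)) : @modhom K A X X h ->
  exists n Y (v : 'Hom(Y, X)) (u : 'Hom(X, Y)),
    [/\ [/\ modhom v, modhom u & forall y, u (v y) = y],
        limg v = limg (lpow h n.+1) & lker u = lker (lpow h n.+1)].
Proof.
move=> hh; have [|_ [n ->] nmin] :=
  @nat_min (fun d => exists n, d = \dim (limg (lpow h n.+1))).
  by exists (\dim (limg (lpow h 1))), 0%N.
pose g := lpow h n.+1; have gh : @modhom K A X X g by apply: lpow_hom.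
have gg : limg (g \o g)%VF = limg g.
  apply/eqP; rewrite eqEdim limg_comp limgS ?subvf //= -limg_comp -lpowD addnS.
  by apply: nmin; exists (n.+1 + n)%N.
have [Y [v [vh v0 vg]]] := sub_exists (submodule_img gh (@submodule_full _ _ X)).
have [|g' g'h vg'] := lift_thru vh v0 gh; first by move=> z; rewrite vg memv_img ?memvf.
have kg : lker g' = lker g.
  apply/vspaceP => x; rewrite !memv_ker -vg'.
  apply/eqP/eqP => [->|]; first by rewrite linear0.
  by move/lker0E: v0 => vi; rewrite -(linear0 v) => /vi.
have ws : surj (g' \o v)%VF.
  apply/surjP => y; have : v y \in limg (g \o g)%VF by rewrite gg -vg memv_img ?memvf.
  case/memv_imgP => x _; rewrite comp_lfunE -!vg' => /(proj2 (lker0E v) v0) ->.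
  by exists (g' x); rewrite comp_lfunE.
have wh := modhom_comp g'h vh.
have w0 := surj_inj ws (leqnn _).
have /isoP[w [w' [_ w'h wK w'K]]] := @iso_intro _ _ Y Y _ wh w0 ws.
pose e := ((g' \o v)^-1)%VF.
have eK y : e ((g' \o v)%VF y) = y by rewrite /e lker0_lfunK // w0.
have Ke y : (g' \o v)%VF (e y) = y by rewrite /e limg_lfunVK // ws memvf.
have eh : @modhom K A Y Y e.
  by move=> a y; rewrite -{1}(Ke y) -wh eK.
exists n, Y, v, (e \o g')%VF; split=> //.
  split=> //; first exact: modhom_comp.
  by move=> y; rewrite comp_lfunE -{2}(eK y) comp_lfunE.
rewrite -/g -kg; apply/vspaceP => x; rewrite !memv_ker comp_lfunE.
apply/eqP/eqP => [ex|->]; last by rewrite linear0.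
by rewrite -(Ke (g' x)) ex linear0.
Qed.

Lemma indec_endo X (h : 'End(X)) : indecomposable X -> @modhom K A X X h ->
  lker h = 0%VS \/ exists n, lpow h n = 0.
Proof.
move=> [_ Xi] hh; have [n [Y [v [u [[vh uh uv] iv ku]]]]] := fitting hh.
have [Z [i [ih i0 iu]]] := sub_exists (submodule_ker uh).
have [/mod_eq0 Y0|/mod_eq0 Z0] := Xi _ _ (split_iso vh uh uv ih i0 iu).
  right; exists n.+1; apply/lfunP => x; rewrite zero_lfunE; apply/eqP.
  have : lpow h n.+1 x \in limg v by rewrite iv memv_img ?memvf.
  by case/memv_imgP => y _ ->; rewrite (Y0 y) linear0.
left; apply: lker0I => x hx; have : x \in limg i.
  by rewrite iu ku memv_ker -addn1 lpowD comp_lfunE /= comp_lfun1r hx linear0.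
by case/memv_imgP => z _ ->; rewrite (Z0 z) linear0.
Qed.

(** If a is not injective it is nilpotent by Fitting's lemma, and then
    1 - a is injective. *)
Lemma indec_local X (a b : 'End(X)) : indecomposable X -> @modhom K A X X a ->
  (forall x, a x + b x = x) -> lker a = 0%VS \/ lker b = 0%VS.
Proof.
move=> Xi ah ab; have [|[n an]] := indec_endo Xi ah; [by left|right].
apply: lker0I => x bx; have ax : a x = x by rewrite -{2}(ab x) bx addr0.
have := @lpow_fix X X a (fun=> x) n (fun=> ax) x.
by rewrite an zero_lfunE => <-.
Qed.

Lemma retract_of_inj X Y (v : 'Hom(X, Y)) (u : 'Hom(Y, X)) :
  modhom v -> modhom u -> lker (u \o v)%VF = 0%VS -> retract X Y.
Proof.
move=> vh uh uv0; have uvh := modhom_comp uh vh.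
have uvs := @inj_surj _ _ X X _ uv0 erefl.
pose e := ((u \o v)^-1)%VF.
have eK y : e ((u \o v)%VF y) = y by rewrite /e lker0_lfunK // uv0.
have Ke y : (u \o v)%VF (e y) = y by rewrite /e limg_lfunVK // uvs memvf.
exists v, (e \o u)%VF; split=> //.
  by apply: modhom_comp => // a y; rewrite -{1}(Ke y) -uvh eK.
by move=> x; rewrite comp_lfunE -{2}(eK x) comp_lfunE.
Qed.

(** The identity of X is the sum of two endomorphisms factoring through Y and Z;
    by locality one of them is invertible. *)
Lemma indec_retract_msum X Y Z : indecomposable X ->
  retract X (msum Y Z) -> retract X Y \/ retract X Z.
Proof.
move=> Xi [v [u [vh uh uv]]].
pose vY := (mfst Y Z \o v)%VF; pose uY := (u \o minl Y Z)%VF.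
pose vZ := (msnd Y Z \o v)%VF; pose uZ := (u \o minr Y Z)%VF.
have vYh : modhom vY by apply: modhom_comp => //; apply: mfst_hom.
have vZh : modhom vZ by apply: modhom_comp => //; apply: msnd_hom.
have uYh : modhom uY by apply: modhom_comp => //; apply: minl_hom.
have uZh : modhom uZ by apply: modhom_comp => //; apply: minr_hom.
have [||k|k] := @indec_local X (uY \o vY)%VF (uZ \o vZ)%VF Xi.
- exact: modhom_comp.
- by move=> x; rewrite !comp_lfunE -linearD /= msum_eta uv.
- by left; apply: retract_of_inj k.
- by right; apply: retract_of_inj k.
Qed.

Lemma indec_retract_msums X n (s : 'I_n -> fdmod A) : indecomposable X ->
  retract X (msums s) -> exists i, retract X (s i).
Proof.
move=> Xi; elim: n s => [|n IH] s.
  rewrite /msums big_ord0 => -[v [u [_ _ uv]]]; case: Xi => -[].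
  by apply/mod_eq0 => x; rewrite -(uv x) [v x]thinmx0 linear0.
rewrite /msums big_ord_recl -/(msums (fun i => s (lift ord0 i))).
by case/(indec_retract_msum Xi) => [|/IH[i]]; [exists ord0|exists (lift ord0 i)].
Qed.

Lemma indec_retract_indec X Y :
  indecomposable X -> indecomposable Y -> retract X Y -> iso X Y.
Proof. by move=> [X0 _] Yi XY; apply: indec_retract. Qed.

Lemma dim_msum X Y : \dim {:msum X Y} = (\dim {:X} + \dim {:Y})%N.
Proof. by rewrite !dimvf. Qed.

Lemma iso_dim X Y : iso X Y -> \dim {:X} = \dim {:Y}.
Proof. by case/iso_bij => f [_ f0 fs]; rewrite -(inj_dim f0) fs. Qed.

Lemma decomposition_ind (P : fdmod A -> Prop) :
    (forall X Y, iso X Y -> P X -> P Y) ->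
    (forall X, zero_module X -> P X) ->
    (forall X, indecomposable X -> P X) ->
    (forall X Y, P X -> P Y -> P (msum X Y)) ->
  forall X, P X.
Proof.
move=> Piso P0 Pi PD X; move dX: (\dim {:X}) => d.
elim/ltn_ind: d X dX => d IH X dX.
have [/P0 //|X0] := classic (zero_module X).
have [/Pi //|Xn] := classic (indecomposable X).
have [Y [Z [XYZ [Y0 Z0]]]] : exists Y Z, iso X (msum Y Z) /\
    ~ zero_module Y /\ ~ zero_module Z.
  apply: NNPP => nYZ; apply: Xn; split=> // Y Z XYZ; apply: NNPP => nor.
  by apply: nYZ; exists Y, Z; split=> //; split=> ?; apply: nor; [left|right].
have := iso_dim XYZ; rewrite dim_msum dX /zero_module in Y0 Z0 * => dE.
apply: (Piso _ _ (iso_sym XYZ)); apply: PD; apply: IH erefl; lia.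
Qed.

(** * Classes of modules up to isomorphism *)

Definition nonisos n (s : 'I_n -> fdmod A) := forall i j, iso (s i) (s j) -> i = j.

Lemma nonisos_le n m (s : 'I_n -> fdmod A) (t : 'I_m -> fdmod A) :
  nonisos s -> (forall i, exists j, iso (s i) (t j)) -> (n <= m)%N.
Proof.
move=> sn st; have [h hP] := fin_all_exists st.
have hi : injective h.
  by move=> i j ij; apply: sn; apply: iso_trans (hP i) _; rewrite ij; apply/iso_sym/hP.
by have := leq_card h hi; rewrite !card_ord.
Qed.

Lemma nonisos_representatives (C : fdmod A -> Prop) n (s t : 'I_n -> fdmod A) :
    representatives C s -> (forall i, C (t i)) -> nonisos t ->
  representatives C t.
Proof.
move=> [_ _ sC] tC tn; split=> // X CX.
have [h hP] := fin_all_exists (fun i => sC _ (tC i)).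
have hi : injective h.
  by move=> i j ij; apply: tn; apply: iso_trans (hP i) _; rewrite ij; apply/iso_sym/hP.
have [h' _ hK] := injF_bij hi.
have [j Xj] := sC _ CX; exists (h' j); apply: iso_trans Xj _.
by have := iso_sym (hP (h' j)); rewrite hK.
Qed.

(** A family of pairwise non-isomorphic modules of maximal length is complete. *)
Lemma num_classes_bounded (C : fdmod A -> Prop) b :
    (forall n (s : 'I_n -> fdmod A), (forall i, C (s i)) -> nonisos s -> (n <= b)%N) ->
  exists2 n, (n <= b)%N & num_classes C n.
Proof.
move=> bC; have [||n [s [sC sn]] nmax] := @nat_max
  (fun n => exists s : 'I_n -> fdmod A, (forall i, C (s i)) /\ nonisos s) b.
- by exists 0%N, (fun=> mzero A); split=> -[].
- by move=> n [s [sC sn]]; apply: bC sn.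
exists n; first exact: bC sn.
exists s; split=> // X CX; apply: NNPP => nX.
suff : (n.+1 <= n)%N by rewrite ltnn.
apply: nmax; exists (fun i => oapp s X (unlift ord0 i)); split=> [i|i j].
  by case: unliftP => [j|] _ /=.
case: unliftP => [i'|] ->; case: unliftP => [j'|] -> //=.
- by move/sn => ->.
- by move=> iX; case: nX; exists i'; apply: iso_sym.
- by move=> iX; case: nX; exists j'.
Qed.

Lemma num_classes_le (C D : fdmod A -> Prop) n m :
  (forall X, C X -> D X) -> num_classes C n -> num_classes D m -> (n <= m)%N.
Proof.
move=> CD [s [sC sn _]] [t [_ _ tD]].
by apply: nonisos_le sn _ => i; apply/tD/CD.
Qed.

(** An indecomposable summand of X + Y is a summand of X or of Y, so that the
    lists for X and Y may be concatenated. *)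
Lemma indec_retracts_finite T : exists n (s : 'I_n -> fdmod A),
  forall X, indecomposable X -> retract X T -> exists i, iso X (s i).
Proof.
move: T; apply: decomposition_ind => [X Y XY [n [s sX]]|X X0|X Xi|X Y [n [s sX]] [m [t tY]]].
- exists n, s => Z Zi ZY; apply: sX => //; apply: retract_trans ZY _.
  exact/iso_retract/iso_sym.
- exists 0%N, (fun=> X) => Z [Z0 _] [v [u [_ _ uv]]]; case: Z0; apply/mod_eq0 => z.
  by rewrite -(uv z) (proj1 (mod_eq0 X) X0 (v z)) linear0.
- by exists 1%N, (fun=> X) => Z Zi ZX; exists ord0; apply: indec_retract_indec.
exists (n + m)%N, (fun i => match split i with inl j => s j | inr j => t j end).
move=> Z Zi /(indec_retract_msum Zi)[/(sX _ Zi)[i Zs]|/(tY _ Zi)[i Zt]].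
  by exists (lshift m i); have /= -> := unsplitK (inl i : 'I_n + 'I_m).
by exists (rshift n i); have /= -> := unsplitK (inr i : 'I_n + 'I_m).
Qed.

(** * Approximations by copies of a module *)

Lemma hom_span X Y (P : 'Hom(X, Y) -> Prop) :
    P 0 -> (forall k f g, P f -> P g -> P (k *: f + g)) ->
  exists n (h : 'I_n -> 'Hom(X, Y)), (forall i, P (h i)) /\
    forall g, P g -> exists c : 'I_n -> K, g = \sum_i c i *: h i.
Proof.
move=> P0 PD; have [U UP] := subspace_of P0 PD.
exists (\dim U), (fun i => (vbasis U)`_i); split=> [i|g /UP gU].
  by apply/UP/vbasis_mem; rewrite mem_nth ?size_tuple.
by exists (fun i => coord (vbasis U) i g); rewrite {1}(coord_vbasis gU).
Qed.

Definition power T n : fdmod A := msums (fun _ : 'I_n => T).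

Lemma right_approximation T X : exists n (r : 'Hom(power T n, X)), modhom r /\
  forall g : 'Hom(T, X), modhom g ->
    exists2 h : 'Hom(T, power T n), modhom h & forall t, r (h t) = g t.
Proof.
have [|k f g fh gh|n [h [hh hs]]] := @hom_span T X (@modhom K A T X).
- exact: modhom0.
- exact: modhomP.
have [f [p [fh ph pf pf0 fp]]] := biprod_msums (fun _ : 'I_n => T).
exists n, (\sum_i (h i \o p i))%VF; split.
  by apply: modhom_sum => i; apply: modhom_comp.
move=> g /hs[c ->]; exists (\sum_i c i *: f i).
  by apply: modhom_sum => i; apply: modhomZ.
move=> t; rewrite !sum_lfunE; apply: eq_bigr => i _.
rewrite comp_lfunE linear_sum (bigD1 i) //= !scale_lfunE [p i _]linearZ /= pf !linearD !linearZ /=.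
rewrite big1 ?linear0 ?addr0 // => j ij; rewrite scale_lfunE linearZ /= pf0 ?scaler0 //.
by rewrite eq_sym.
Qed.

Lemma left_approximation T X : exists n (l : 'Hom(X, power T n)), modhom l /\
  forall g : 'Hom(X, T), modhom g ->
    exists2 h : 'Hom(power T n, T), modhom h & forall x, h (l x) = g x.
Proof.
have [|k f g fh gh|n [h [hh hs]]] := @hom_span X T (@modhom K A X T).
- exact: modhom0.
- exact: modhomP.
have [f [p [fh ph pf pf0 fp]]] := biprod_msums (fun _ : 'I_n => T).
exists n, (\sum_i (f i \o h i))%VF; split.
  by apply: modhom_sum => i; apply: modhom_comp.
move=> g /hs[c ->]; exists (\sum_i c i *: p i).
  by apply: modhom_sum => i; apply: modhomZ.
move=> x; rewrite !sum_lfunE; apply: eq_bigr => i _.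
rewrite !scale_lfunE linear_sum (bigD1 i) //= comp_lfunE pf.
rewrite big1 ?addr0 // => j ij; rewrite comp_lfunE pf0 //.
by rewrite eq_sym.
Qed.

End Fitting.
(** * Projective modules and projective covers *)

Section Projectives.
Variables (K : fieldType) (A : fdAlgType K).
Implicit Types X Y Z W T P L E D : fdmod A.

Lemma projective_lift P Y Z (g : 'Hom(Y, Z)) (h : 'Hom(P, Z)) :
    projective P -> modhom g -> surj g -> modhom h ->
  exists2 l : 'Hom(P, Y), modhom l & forall x, g (l x) = h x.
Proof.
move=> Pp gh gs hh; have [l lh le] := Pp _ _ _ _ gh gs hh.
by exists l => // x; rewrite -le comp_lfunE.
Qed.

Lemma projective_intro P :
    (forall Y Z (g : 'Hom(Y, Z)) (h : 'Hom(P, Z)), modhom g -> surj g -> modhom h ->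
       exists2 l : 'Hom(P, Y), modhom l & forall x, g (l x) = h x) ->
  projective P.
Proof.
move=> lP Y Z g h gh gs hh; have [l lh le] := lP _ _ _ _ gh gs hh.
by exists l => //; apply/lfunP => x; rewrite comp_lfunE.
Qed.

Lemma reg_hom X (x : X) :
  exists2 g : 'Hom(mreg A, X), modhom g & forall a, g a = act (a : A) x.
Proof.
apply: (@mkhom K A (mreg A) X (fun a => act (a : A) x)) => [k a b|a b].
  exact: act_linearl.
exact: actM.
Qed.

Lemma projective_reg : projective (mreg A).
Proof.
apply: projective_intro => Y Z g h gh /surjP gs hh.
have [y yE] := gs (h (1 : A)); have [l lh lE] := reg_hom y.
exists l => // a; rewrite lE gh yE -hh; congr (h _); exact: mulr1.
Qed.

Lemma projective_msums n (s : 'I_n -> fdmod A) :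
  (forall i, projective (s i)) -> projective (msums s).
Proof.
move=> sp; apply: projective_intro => Y Z g h gh gs hh.
have [f [p [fh ph pf pf0 fp]]] := biprod_msums s.
have /fin_all_exists2[l lh lE] : forall i, exists2 l : 'Hom(s i, Y),
    modhom l & forall x, g (l x) = h (f i x).
  move=> i; have [l lh lE] := projective_lift (sp i) gh gs (modhom_comp hh (fh i)).
  by exists l => // x; rewrite lE comp_lfunE.
exists (\sum_i (l i \o p i))%VF.
  by apply: modhom_sum => i; apply: modhom_comp.
move=> x; rewrite sum_lfunE linear_sum [in RHS](fp x) linear_sum.
by apply: eq_bigr => i _; rewrite comp_lfunE /= lE.
Qed.

Lemma projective_retract P Y : retract Y P -> projective P -> projective Y.
Proof.
case=> v [u [vh uh uv]] Pp; apply: projective_intro => W Z g h gh gs hh.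
have [l lh lE] := projective_lift Pp gh gs (modhom_comp hh uh).
exists (l \o v)%VF; first exact: modhom_comp.
by move=> x; rewrite comp_lfunE lE comp_lfunE uv.
Qed.

Lemma projective_msum X Y : projective X -> projective Y -> projective (msum X Y).
Proof.
move=> Xp Yp; apply: projective_intro => W Z g h gh gs hh.
have [l lh lE] := projective_lift Xp gh gs (modhom_comp hh (@minl_hom _ _ X Y)).
have [m mh mE] := projective_lift Yp gh gs (modhom_comp hh (@minr_hom _ _ X Y)).
have [k kh kE] := msum_hom lh mh; exists k => // -[x y].
rewrite kE linearD /= lE mE !comp_lfunE -linearD /=; congr (h _).
by rewrite -[RHS]msum_eta mfstE msndE.
Qed.

Lemma projective_zero X : zero_module X -> projective X.
Proof.
move/mod_eq0 => X0; apply: projective_intro => W Z g h gh gs hh.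
by exists 0 => [|x]; [apply: modhom0|rewrite (X0 x) !linear0].
Qed.

Lemma free_cover X : exists n (p : 'Hom(power (mreg A) n, X)), modhom p /\ surj p.
Proof.
pose n := \dim {:X}.
have /fin_all_exists2[g gh gE] : forall i : 'I_n, exists2 g : 'Hom(mreg A, X),
    modhom g & forall a, g a = act (a : A) (vbasis {:X})`_i.
  by move=> i; apply: reg_hom.
have [p ph pi] := hom_from_msums gh; exists n, p; split=> //.
rewrite /surj pi; apply/vspaceP => x; rewrite memvf (coord_vbasis (memvf x)).
apply: rpred_sum => i _; apply: rpredZ.
apply: (subvP (sumv_sup i _ (subvv _))) => //.
by apply/memv_imgP; exists (1 : A); rewrite ?memvf // gE act1.
Qed.

(** A projective module of smallest dimension mapping onto X works: a
    submodule V still mapping onto X yields an endomorphism h of P over X with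
    image in V, and by Fitting's lemma a power of h splits off a
    projective summand of P that maps onto X. *)
Lemma projective_cover X : exists P (p : 'Hom(P, X)),
  [/\ projective P, modhom p, surj p & superfluous (lker p)].
Proof.
have [|d [P [p [Pp ph ps dP]]] dmin] := @nat_min (fun d => exists P (p : 'Hom(P, X)),
    [/\ projective P, modhom p, surj p & \dim {:P} = d]).
  have [n [p [ph ps]]] := free_cover X.
  exists (\dim {:power (mreg A) n}), (power (mreg A) n), p; split=> //.
  by apply: projective_msums => _; apply: projective_reg.
exists P, p; split=> // V VS VU.
have [W [i [ih i0 iV]]] := sub_exists VS.
have pis : surj (p \o i)%VF.
  apply/surjP => x; have /surjP/(_ x)[y yx] := ps.
  have : y \in (V + lker p)%VS by rewrite VU memvf.
  case/memv_addP => v vV [u]; rewrite memv_ker => /eqP pu yE.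
  move: vV; rewrite -iV => /memv_imgP[w _ vE]; exists w.
  by rewrite comp_lfunE -vE -yx yE linearD /= pu addr0.
have [l lh lE] := projective_lift Pp (modhom_comp ph ih) pis ph.
pose h := (i \o l)%VF; have hh : @modhom K A P P h by apply: modhom_comp.
have phE x : p (h x) = p x by rewrite -[RHS]lE !comp_lfunE.
have [n [Y [v [u [[vh uh uv] iv ku]]]]] := fitting hh.
have pn x : p (lpow h n.+1 x) = p x.
  by elim: n.+1 => [|m IH] /=; rewrite ?id_lfunE // comp_lfunE phE IH.
have vs : surj v.
  have pvs : surj (p \o v)%VF.
    apply/surjP => x; have /surjP/(_ x)[y yx] := ps.
    have : lpow h n.+1 y \in limg v by rewrite iv memv_img ?memvf.
    by case/memv_imgP => z _ zE; exists z; rewrite comp_lfunE -zE pn.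
  have v0 : lker v = 0%VS.
    by apply: lker0I => y vy; rewrite -(uv y) vy linear0.
  apply: inj_surj => //; apply/eqP; rewrite eqn_leq; apply/andP; split.
    by rewrite -(inj_dim v0) dimvS ?subvf.
  rewrite dP; apply: dmin; exists Y, (p \o v)%VF; split=> //.
    by apply: projective_retract Pp; exists v, u.
  exact: modhom_comp.
apply/vspaceP => x; rewrite memvf.
have : x \in limg (lpow h n.+1) by rewrite -iv vs memvf.
by case/memv_imgP => y _ ->; rewrite /= !comp_lfunE -iV memv_img ?memvf.
Qed.

Lemma min_presentation_exists X : exists P1 P0 (f : 'Hom(P1, P0)) (p : 'Hom(P0, X)),
  min_proj_presentation f p.
Proof.
have [P0 [p [P0p ph ps pk]]] := projective_cover X.
have [L [i [ih i0 iL]]] := sub_exists (submodule_ker ph).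
have [P1 [q [P1p qh qs qk]]] := projective_cover L.
exists P1, P0, (i \o q)%VF, p; split=> //.
- by split=> //; apply: modhom_comp.
- by rewrite limg_comp qs.
suff -> : lker (i \o q)%VF = lker q by [].
apply/vspaceP => x; rewrite !memv_ker comp_lfunE.
apply/eqP/eqP => [|->]; last exact: linear0.
by rewrite -(linear0 i); move/lker0E: i0; apply.
Qed.

(** * Extensions *)

Lemma ext1_zero_retraction X Y : ext1_zero X Y <->
  forall (E : fdmod A) (i : 'Hom(Y, E)) (p : 'Hom(E, X)), short_exact i p ->
    exists2 r : 'Hom(E, Y), modhom r & forall y, r (i y) = y.
Proof.
split=> [XY E i p ip|XY [E i p ip]].
  have [h /= [hh hi hp]] := XY (Extension ip).
  exists (mfst Y X \o h)%VF.
    by apply: modhom_comp => //; apply: mfst_hom.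
  move=> y; rewrite comp_lfunE -[h _]comp_lfunE hi mfstE lfunE /=.
  by rewrite /split_inj_fun.
have [r rh ri] := XY _ _ _ ip; have [ih ph i0 iE ps] := ip.
have [h hh hE] := hom_msum rh ph.
exists h => /=; split=> //; apply/lfunP => x; rewrite comp_lfunE hE lfunE /=.
  rewrite ri /split_inj_fun; congr (_, _).
  by apply/eqP; rewrite -memv_ker -iE memv_img ?memvf.
by [].
Qed.

Lemma ext1_zero_section X Y : ext1_zero X Y <->
  forall (E : fdmod A) (i : 'Hom(Y, E)) (p : 'Hom(E, X)), short_exact i p ->
    exists2 s : 'Hom(X, E), modhom s & forall x, p (s x) = x.
Proof.
rewrite ext1_zero_retraction; split=> XY E i p ip; have [ih ph i0 iE ps] := ip.
  have pi y : p (i y) = 0 by apply/eqP; rewrite -memv_ker -iE memv_img ?memvf.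
  have [r rh ri] := XY _ _ _ ip.
  have [|x|s sh sE] := @factor_surj _ _ E X E p (\1 - (i \o r))%VF ph ps.
  - apply: modhomB; first exact: modhom_id.
    exact: modhom_comp.
  - move=> px; have : x \in limg i by rewrite iE memv_ker px.
    case/memv_imgP => y _ ->.
    by rewrite add_lfunE opp_lfunE id_lfunE comp_lfunE ri subrr.
  exists s => // x; have /surjP/(_ x)[e <-] := ps.
  rewrite sE add_lfunE opp_lfunE id_lfunE comp_lfunE.
  by rewrite linearB /= pi subr0.
have [s sh sE] := XY _ _ _ ip.
have [||r rh rE] := @lift_thru _ _ Y E E i (\1 - (s \o p))%VF ih i0.
- apply: modhomB; first exact: modhom_id.
  exact: modhom_comp.
- move=> e; rewrite iE memv_ker add_lfunE opp_lfunE id_lfunE comp_lfunE.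
  by rewrite linearB /= sE subrr.
exists r => // y; move/lker0E: (i0); apply.
rewrite rE add_lfunE opp_lfunE id_lfunE comp_lfunE.
have -> : p (i y) = 0 by apply/eqP; rewrite -memv_ker -iE memv_img ?memvf.
by rewrite linear0 subr0.
Qed.

Lemma ext1_zero_projective P Y : projective P -> ext1_zero P Y.
Proof.
move=> Pp; apply/ext1_zero_section => E i p [ih ph i0 iE ps].
have [s sh sE] := projective_lift Pp ph ps (@modhom_id _ _ P).
by exists s => // x; rewrite sE id_lfunE.
Qed.

Lemma ext1_zero_iso X X' Y : iso X X' -> ext1_zero X Y -> ext1_zero X' Y.
Proof.
case/isoP => f [g [fh gh fK gK]] /ext1_zero_section XY.
apply/ext1_zero_section => E i p [ih ph i0 iE ps].
have [|s sh sE] := XY E i (g \o p)%VF.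
  split=> //; first exact: modhom_comp.
    rewrite iE; apply/vspaceP => x; rewrite !memv_ker comp_lfunE.
    by apply/eqP/eqP => [->|]; [apply: linear0|rewrite -(linear0 g) => /(can_inj gK)].
  apply/surjP => x; have /surjP/(_ (f x))[e eE] := ps.
  by exists e; rewrite comp_lfunE eE fK.
exists (s \o g)%VF; first exact: modhom_comp.
by move=> x; rewrite comp_lfunE -[p _]gK -[g _]comp_lfunE sE gK.
Qed.

(** Push the extension out along k; a retraction of the pushout gives the
    extension of k. *)
Lemma ext1_zero_extend X Y L P (i : 'Hom(L, P)) (p : 'Hom(P, X)) (k : 'Hom(L, Y)) :
    ext1_zero X Y -> short_exact i p -> modhom k ->
  exists2 k' : 'Hom(P, Y), modhom k' & forall x, k' (i x) = k x.
Proof.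
move=> /ext1_zero_retraction XY [ih ph i0 iE ps] kh.
have pi x : p (i x) = 0 by apply/eqP; rewrite -memv_ker -iE memv_img ?memvf.
have [d dh dE] := hom_msum kh (modhomN ih).
have [E [q [qh qs qk]]] := quot_exists (submodule_img dh (@submodule_full _ _ L)).
have qd x : q (d x) = 0 by apply/eqP; rewrite -memv_ker qk memv_img ?memvf.
have q0 u : q u = 0 -> exists x, u = (k x, - i x).
  move/eqP; rewrite -memv_ker qk => /memv_imgP[x _ ->].
  by exists x; rewrite dE opp_lfunE.
have [||t th tE] := @factor_surj _ _ _ E X q (p \o msnd Y P)%VF qh qs.
- by apply: modhom_comp => //; apply: msnd_hom.
- move=> u /q0[x ->]; rewrite comp_lfunE msndE /=.
  by rewrite linearN /= pi oppr0.
have [|r rh rE] := XY E (q \o minl Y P)%VF t.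
  split=> //.
  - by apply: modhom_comp => //; apply: minl_hom.
  - apply: lker0I => y; rewrite comp_lfunE minlE => /q0[x [-> /esym/eqP]].
    rewrite oppr_eq0 => /eqP; rewrite -(linear0 i).
    by move/(proj2 (lker0E i) i0) => ->; rewrite linear0.
  - apply/vspaceP => e; have /surjP/(_ e)[[y z] <-] := qs.
    rewrite memv_ker tE comp_lfunE msndE /=.
    apply/memv_imgP/eqP => [[y' _ /eqP]|pz].
      rewrite -subr_eq0 comp_lfunE -linearB minlE => /eqP/q0[x [_]] /= /eqP.
      by rewrite subr0 => /eqP ->; rewrite linearN /= pi oppr0.
    have : z \in limg i by rewrite iE memv_ker pz.
    case/memv_imgP => x _ zE; exists (y + k x); first exact: memvf.
    have ee : ((y + k x, 0) : msum Y P) = (y, z) + d x.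
      by rewrite dE opp_lfunE zE; congr (_, _); rewrite /= subrr.
    by rewrite comp_lfunE minlE ee linearD /= qd addr0.
  apply/surjP => x; have /surjP/(_ x)[z <-] := ps; exists (q (0, z)).
  by rewrite tE comp_lfunE msndE.
exists (r \o (q \o minr Y P))%VF.
  by do 2 apply: modhom_comp => //; apply: minr_hom.
move=> x; have e : ((k x, 0) : msum Y P) = (0, i x) + d x.
  by rewrite dE opp_lfunE; congr (_, _); rewrite /= ?add0r ?subrr.
by rewrite -[RHS]rE !comp_lfunE minrE minlE e [q (_ + _)]linearD /= qd addr0.
Qed.

Lemma gen_power T X : gen T X <->
  exists n (p : 'Hom(power T n, X)), modhom p /\ surj p.
Proof.
split=> [[Y [[n /summandP[v [u [vh uh uv]]]] [p ph ps]]]|[n [p [ph ps]]]].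
  exists n, (p \o u)%VF; split; first exact: modhom_comp.
  apply/surjP => x; have /surjP/(_ x)[y <-] := ps.
  by exists (v y); rewrite comp_lfunE uv.
exists (power T n); split; last by exists p.
by exists n; apply/summandP/iso_retract/iso_refl.
Qed.

Lemma gen_quot T X Z (p : 'Hom(X, Z)) : gen T X -> modhom p -> surj p -> gen T Z.
Proof.
move=> /gen_power[n [q [qh qs]]] ph ps; apply/gen_power.
by exists n, (p \o q)%VF; split; [apply: modhom_comp|apply: surj_comp].
Qed.

Lemma gen_retract T X : retract X T -> gen T X.
Proof.
case=> v [u [vh uh uv]]; apply/gen_power.
have [p ph pE] := @hom_from_msums _ _ 1 (fun=> T) X (fun=> u) (fun=> uh).
exists 1%N, p; split=> //; rewrite /surj pE big_ord1.
by apply/surjP => x; exists (v x).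
Qed.

Lemma gen_self T : gen T T.
Proof. exact/gen_retract/iso_retract/iso_refl. Qed.

(** * Extensions and the Auslander-Reiten translate *)

(** For a projective presentation P1 -f-> P0 -> X -> 0 this says that
    Hom(f, Y) is onto. *)
Definition factors P1 P0 (f : 'Hom(P1, P0)) Y : Prop :=
  forall h : 'Hom(P1, Y), modhom h ->
    exists2 g : 'Hom(P0, Y), modhom g & forall x, g (f x) = h x.

Lemma factors_gen P1 P0 (f : 'Hom(P1, P0)) Y Z :
  projective P1 -> factors f Y -> gen Y Z -> factors f Z.
Proof.
move=> P1p fY /gen_power[n [p [ph ps]]] h hh.
have [l lh lE] := projective_lift P1p ph ps hh.
have [j [q [jh qh _ _ jq]]] := biprod_msums (fun _ : 'I_n => Y).
have /fin_all_exists2[g gh gE] : forall i, exists2 g : 'Hom(P0, Y), modhom g &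
    forall x, g (f x) = q i (l x).
  move=> i; have [|g gh gE] := fY (q i \o l)%VF; first exact: modhom_comp.
  by exists g => // x; rewrite gE comp_lfunE.
exists (p \o \sum_i (j i \o g i))%VF.
  by apply: modhom_comp => //; apply: modhom_sum => i; apply: modhom_comp.
move=> x; rewrite comp_lfunE -lE [in RHS](jq (l x)) sum_lfunE; congr (p _).
by apply: eq_bigr => i _; rewrite comp_lfunE gE.
Qed.

Lemma factors_ext1_zero P1 P0 X (f : 'Hom(P1, P0)) (p : 'Hom(P0, X)) Y :
    projective P0 -> modhom f -> modhom p -> surj p -> limg f = lker p ->
  factors f Y -> ext1_zero X Y.
Proof.
move=> P0p fh ph ps fp fY; apply/ext1_zero_section => E i q [ih qh i0 iE qs].
have qi y : q (i y) = 0 by apply/eqP; rewrite -memv_ker -iE memv_img ?memvf.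
have [l lh lE] := projective_lift P0p qh qs ph.
have pf x : p (f x) = 0 by apply/eqP; rewrite -memv_ker -fp memv_img ?memvf.
have [||h hh hE] := @lift_thru _ _ Y E P1 i (l \o f)%VF ih i0.
- exact: modhom_comp.
- by move=> x; rewrite iE memv_ker comp_lfunE lE pf.
have [g gh gE] := fY _ hh.
have [||s sh sE] := @factor_surj _ _ P0 X E p (l - (i \o g))%VF ph ps.
- by apply: modhomB => //; apply: modhom_comp.
- move=> x /eqP; rewrite -memv_ker -fp => /memv_imgP[y _ ->].
  by rewrite add_lfunE opp_lfunE comp_lfunE gE hE comp_lfunE subrr.
exists s => // x; have /surjP/(_ x)[y <-] := ps.
by rewrite sE add_lfunE opp_lfunE comp_lfunE linearB /= lE qi subr0.
Qed.

(** Among the maps h - g f choose one, h1, with smallest image.  Modulo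
    U = h1 (ker f) it induces a map on ker p = im f, which extends to P0 by the
    vanishing of Ext; lifting this extension to Y and subtracting it gives a
    map with image inside U.  By minimality U is the image of h1, so that
    ker f + ker h1 = P1, and h1 = 0 as ker f is superfluous. *)
Lemma ext1_zero_factors P1 P0 X (f : 'Hom(P1, P0)) (p : 'Hom(P0, X)) Y :
    min_proj_presentation f p ->
    (forall Z (q : 'Hom(Y, Z)), modhom q -> surj q -> ext1_zero X Z) ->
  factors f Y.
Proof.
move=> [[P1p P0p fh ph] ps fp _ fk] XY h hh.
have [|_ [g gh ->] dmin] := @nat_min (fun d => exists2 g : 'Hom(P0, Y), modhom g &
    d = \dim (limg (h - (g \o f)%VF))).
  by exists (\dim (limg (h - (0 \o f)%VF))), 0 => //; apply: modhom0.
set h1 := h - _ in dmin.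
have h1h : modhom h1 by apply: modhomB => //; apply: modhom_comp.
have US : submodule (h1 @: lker f)%VS by apply: submodule_img => //; apply: submodule_ker.
have [Z [q [qh qs qk]]] := quot_exists US.
have [L [i [ih i0 iL]]] := sub_exists (submodule_ker ph).
have [|f' f'h f'E] := @lift_thru _ _ L P0 P1 i f ih i0 fh.
  by move=> x; rewrite iL -fp memv_img ?memvf.
have f's : surj f'.
  apply/surjP => l; have : i l \in limg f by rewrite fp -iL memv_img ?memvf.
  case/memv_imgP => x _; rewrite -f'E => /(proj2 (lker0E i) i0) ->.
  by exists x.
have [||k kh kE] := @factor_surj _ _ P1 L Z f' (q \o h1)%VF f'h f's.
- exact: modhom_comp.
- move=> x f'x; apply/eqP; rewrite comp_lfunE -memv_ker qk memv_img //.
  by rewrite memv_ker -f'E f'x linear0.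
have ip : short_exact i p by [].
have [k' k'h k'E] := ext1_zero_extend (XY Z q qh qs) ip kh.
have [g2 g2h g2E] := projective_lift P0p qh qs k'h.
pose g3 : 'Hom(P0, Y) := g + g2.
have sub : (limg (h - (g3 \o f)%VF) <= h1 @: lker f)%VS.
  apply/subvP => _ /memv_imgP[x _ ->]; rewrite -qk memv_ker.
  rewrite /g3 comp_lfunDl opprD addrA -/h1 add_lfunE opp_lfunE comp_lfunE linearB /=.
  by rewrite g2E -f'E k'E kE comp_lfunE subrr.
have /dmin le : exists2 g' : 'Hom(P0, Y), modhom g' &
    \dim (limg (h - (g3 \o f)%VF)) = \dim (limg (h - (g' \o f)%VF)).
  by exists g3 => //; apply: modhomD.
have /eqP h1E : (h1 @: lker f)%VS == limg h1.
  by rewrite eqEdim limgS ?subvf //= (leq_trans le) ?dimvS.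
have k1 : lker h1 = fullv.
  apply: fk; first exact: submodule_ker.
  apply/vspaceP => x; rewrite memvf.
  have : h1 x \in (h1 @: lker f)%VS by rewrite h1E memv_img ?memvf.
  case/memv_imgP => y yf xy; rewrite -(subrK y x); apply: memv_add => //.
  by rewrite memv_ker linearB /= xy subrr.
exists g => // x; have : x \in lker h1 by rewrite k1 memvf.
rewrite memv_ker add_lfunE opp_lfunE comp_lfunE subr_eq0 => /eqP.
by move->.
Qed.

End Projectives.
Section Tau.
Variables (K : fieldType) (A : fdAlgType K).
Implicit Types X Y Z W T P L E D : fdmod A.

Lemma dual_basis P : projective P ->
  exists n (phi : 'I_n -> 'Hom(P, mreg A)) (x : 'I_n -> P),
    (forall i, modhom (phi i)) /\ forall y, y = \sum_i act (phi i y : A) (x i).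
Proof.
move=> Pp; have [n [p [ph ps]]] := free_cover P.
have [s sh sE] := projective_lift Pp ph ps (@modhom_id _ _ P).
have [f [q [fh qh _ _ fq]]] := biprod_msums (fun _ : 'I_n => mreg A).
exists n, (fun i => q i \o s)%VF, (fun i => p (f i (1 : A))); split.
  by move=> i; apply: modhom_comp.
move=> y; rewrite -{1}[y]id_lfunE -sE {1}(fq (s y)) linear_sum.
apply: eq_bigr => i _; rewrite comp_lfunE /= -ph -fh; congr (p (f i _)).
exact/esym/mulr1.
Qed.

Lemma star_intro P (g : 'Hom(P, mreg A)) : modhom g ->
  exists u : star P, forall x, vsval (u : subvs_of (homA P)) x = g x.
Proof.
by move=> gh; exists (vsproj (homA P) g) => x; rewrite vsprojK //; apply/mem_homA.
Qed.

Lemma star_hom P (u : star P) (a : A) x :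
  vsval (u : subvs_of (homA P)) (act a x) = a * vsval (u : subvs_of (homA P)) x.
Proof. exact: (proj1 (mem_homA _) (subvsP (u : subvs_of (homA P)))). Qed.

Lemma star_eq P (u v : star P) :
  (forall x, vsval (u : subvs_of (homA P)) x = vsval (v : subvs_of (homA P)) x) -> u = v.
Proof. by move=> uv; apply/subvs_inj/lfunP. Qed.

Lemma star_map_hom P1 P0 (f : 'Hom(P1, P0)) : modhom f -> modhom (star_map f).
Proof.
move=> fh a g; apply: star_eq => x; rewrite star_mapE // /act /= !star_actE.
by rewrite star_mapE.
Qed.

(** The image of the tensor of u and y under the canonical map from
    P^* (x) Y to Hom(P, Y). *)
Definition star_tensor P Y (u : star P) (y : Y) : 'Hom(P, Y) :=
  (mklfun (@act_linearl _ _ _ y) \o vsval (u : subvs_of (homA P)))%VF.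

Lemma star_tensorE P Y (u : star P) (y : Y) x :
  star_tensor u y x = act (vsval (u : subvs_of (homA P)) x) y.
Proof. by rewrite comp_lfunE mklfunE. Qed.

Lemma star_tensor_hom P Y (u : star P) (y : Y) : modhom (star_tensor u y).
Proof. by move=> a x; rewrite !star_tensorE star_hom actM. Qed.

Lemma separating_functional (V : vectType K) (U : {vspace V}) v : v \notin U ->
  exists2 l : 'Hom(V, K^o), (forall u, u \in U -> l u = 0) & l v != 0.
Proof.
move=> vU; pose q := (\1 - projv U)%VF.
have qE x : q x = x - projv U x by rewrite add_lfunE opp_lfunE id_lfunE.
have qv : q v != 0.
  by apply: contraNneq vU; rewrite qE => /eqP; rewrite subr_eq0 => /eqP ->; apply: memv_proj.
have [i iv] : exists i, coord (vbasis {:V}) i (q v) != 0.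
  apply: NNPP => ni; case/negP: qv; rewrite (coord_vbasis (memvf (q v))) big1 // => i _.
  by rewrite (_ : coord _ _ _ = 0) ?scale0r //; apply/eqP/negPn/negP => ?; apply: ni; exists i.
exists (linfun (coord (vbasis {:V}) i : V -> K^o) \o q)%VF; last by rewrite comp_lfunE lfunE.
by move=> u uU; rewrite comp_lfunE qE projv_id // subrr linear0.
Qed.

(** With N = Coker f^*, a homomorphism Y -> DN is a balanced bilinear form on
    P1^* x Y that vanishes on the image of f^*.  As P1 is projective, such a
    form is a linear form on Hom(P1, Y) that vanishes on all maps factoring
    through f, evaluated at the maps x |-> u(x) y. *)
Lemma hom_zero_dual P1 P0 (f : 'Hom(P1, P0)) (N : fdmod A^opp) (q : 'Hom(star P1, N)) Y :
    projective P1 -> projective P0 -> modhom f ->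
    modhom q -> surj q -> lker q = limg (star_map f) ->
  hom_zero Y (dual N) <-> factors f Y.
Proof.
move=> P1p P0p fh qh qs qk.
have [n [phi [x [phih xE]]]] := dual_basis P1p.
have [m [psi [z [psih zE]]]] := dual_basis P0p.
have [phi' phiE] := fin_all_exists (fun i => star_intro (phih i)).
have [psi' psiE] := fin_all_exists (fun j => star_intro (psih j)).
split=> [hom0 h hh|fY F Fh].
  apply: NNPP => nfac.
  have [||U UP] := @subspace_of K 'Hom(P1, Y) (fun h' => modhom h' /\
      exists2 g : 'Hom(P0, Y), modhom g & forall x, g (f x) = h' x).
  - split; first exact: modhom0.
    by exists 0 => [|y]; [apply: modhom0|rewrite !zero_lfunE].
  - move=> k h1 h2 [h1h [g1 g1h g1E]] [h2h [g2 g2h g2E]]; split; first exact: modhomP.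
    exists (k *: g1 + g2); first exact: modhomP.
    by move=> y; rewrite !add_lfunE !scale_lfunE g1E g2E.
  have hU : h \notin U by apply/negP => /UP[_ /nfac].
  have [l lU lh] := separating_functional hU.
  have tD k (u v : star P1) (y : Y) :
      star_tensor (k *: u + v) y = k *: star_tensor u y + star_tensor v y.
    apply/lfunP => w; rewrite add_lfunE scale_lfunE !star_tensorE linearP /=.
    by rewrite add_lfunE scale_lfunE act_linearl.
  have tDr k (u : star P1) (y w : Y) :
      star_tensor u (k *: y + w) = k *: star_tensor u y + star_tensor u w.
    by apply/lfunP => v; rewrite add_lfunE scale_lfunE !star_tensorE linearP.
  have Ll (y : Y) : linear (fun u : star P1 => l (star_tensor u y) : K^o).
    by move=> k u v; rewrite tD linearP.
  pose L y : 'Hom(star P1, K^o) := mklfun (Ll y).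
  have Lq y u : q u = 0 -> L y u = 0.
    move/eqP; rewrite -memv_ker qk => /memv_imgP[v _ ->]; rewrite mklfunE.
    apply/lU/UP; split; first exact: star_tensor_hom.
    exists (star_tensor v y); first exact: star_tensor_hom.
    by move=> w; rewrite !star_tensorE star_mapE.
  have LqE y u : (L y \o q^-1)%VF (q u) = L y u.
    rewrite comp_lfunE; apply/eqP; rewrite -subr_eq0 -linearB; apply/eqP/Lq.
    by rewrite linearB /= limg_lfunVK ?subrr // memv_img ?memvf.
  have qI (F G : 'Hom(N, K^o)) : (forall u, F (q u) = G (q u)) -> F = G.
    move=> FG; apply/lfunP => w; have : w \in limg q by rewrite qs memvf.
    by case/memv_imgP => u _ ->.
  have [||F Fh FE] := @mkhom _ _ Y (dual N) (fun y => (L y \o q^-1)%VF : 'Hom(N, K^o)).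
  - move=> k y w; apply: qI => u; rewrite add_lfunE scale_lfunE !LqE !mklfunE.
    by rewrite tDr linearP.
  - move=> a y; apply: qI => u; rewrite LqE dual_actE -qh LqE !mklfunE.
    congr (l _); apply/lfunP => w; rewrite !star_tensorE /act /= star_actE.
    exact/esym/actM.
  have F0 := hom0 F Fh.
  case/negP: lh; apply/eqP.
  have -> : h = \sum_i star_tensor (phi' i) (h (x i)).
    apply/lfunP => y; rewrite sum_lfunE {1}(xE y) linear_sum; apply: eq_bigr => i _.
    by rewrite star_tensorE phiE /= hh.
  rewrite linear_sum big1 // => i _ /=.
  by rewrite -(mklfunE (Ll (h (x i)))) -/(L _) -LqE -FE F0 !zero_lfunE.
apply/lfunP => y; rewrite zero_lfunE; apply/lfunP => w; rewrite zero_lfunE.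
have : w \in limg q by rewrite qs memvf.
case/memv_imgP => u _ ->.
have bal (a : A) y' (v : star P1) : F (act a y') (q v) = F y' (q (act (a : A^opp) v)).
  by rewrite Fh qh; apply: dual_actE.
have [g gh gE] := fY _ (star_tensor_hom u y).
have uE : u = \sum_i act (vsval (u : subvs_of (homA P1)) (x i) : A^opp) (phi' i).
  apply: star_eq => v; rewrite {1}(xE v) !linear_sum /= sum_lfunE.
  by apply: eq_bigr => i _; rewrite star_hom /act /= star_actE phiE.
rewrite uE !linear_sum; apply: etrans (_ : \sum_i \sum_j F (g (z j))
  (q (act (psi j (f (x i)) : A^opp) (phi' i))) = 0).
  apply: eq_bigr => i _ /=; rewrite -bal -star_tensorE -gE {1}(zE (f (x i))).
  by rewrite !linear_sum sum_lfunE; apply: eq_bigr => j _ /=; rewrite gh bal.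
rewrite exchange_big big1 // => j _ /=; rewrite -!linear_sum /=.
rewrite (_ : q _ = 0) ?linear0 //; apply/eqP; rewrite -memv_ker qk.
apply/memv_imgP; exists (psi' j); first exact: memvf.
apply: star_eq => v; rewrite star_mapE // psiE {2}(xE v) !linear_sum /= sum_lfunE.
by apply: eq_bigr => i _; rewrite fh psih /act /= star_actE phiE.
Qed.

(** The two conditions are compared through a minimal presentation of T: both say
    that every map from P1 to a module of gen T factors through f. *)
Lemma tau_rigidP T : tau_rigid T <-> forall Y, gen T Y -> ext1_zero T Y.
Proof.
split=> [[Z [N [P1 [P0 [f [p [fp [q [qh qs qk]]]]]]] ZN] TZ] Y TY|Text].
  have [[P1p P0p fh ph] ps fpE _ _] := fp.
  apply: (factors_ext1_zero P0p fh ph ps fpE); apply: factors_gen TY => //.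
  apply/(hom_zero_dual T P1p P0p fh qh qs qk) => g gh.
  have [u [v [uh vh uK vK]]] := proj1 (isoP _ _) ZN.
  have g0 := TZ (v \o g)%VF (modhom_comp vh gh).
  apply/lfunP => t; rewrite zero_lfunE -[g t]vK -[v _]comp_lfunE g0.
  by rewrite zero_lfunE linear0.
have [P1 [P0 [f [p fp]]]] := min_presentation_exists T.
have [[P1p P0p fh ph] ps fpE _ _] := fp.
have [N [q [qh qs qk]]] := quot_exists (submodule_img (star_map_hom fh) (@submodule_full _ _ _)).
exists (dual N).
  exists N; last exact: iso_refl.
  by exists P1, P0, f, p; split=> //; exists q.
apply/(hom_zero_dual T P1p P0p fh qh qs qk)/(ext1_zero_factors fp) => Z r rh rs.
exact/Text/(gen_quot (gen_self T) rh rs).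
Qed.

End Tau.
(** * Pulling back extensions *)

Section Torsion.
Variables (K : fieldType) (A : fdAlgType K).
Implicit Types X Y Z W T P L E D : fdmod A.
Implicit Type C : fdmod A -> Prop.

Lemma pullback X Y Z E (i : 'Hom(Y, E)) (p : 'Hom(E, Z)) (u : 'Hom(X, Z)) :
    short_exact i p -> modhom u ->
  exists W (j : 'Hom(Y, W)) (r : 'Hom(W, X)) (t : 'Hom(W, E)),
    [/\ short_exact j r, modhom t, forall w, p (t w) = u (r w),
        (forall w, t w = 0 -> r w = 0 -> w = 0) /\
        (forall e x, p e = u x -> exists w, t w = e /\ r w = x)
      & forall T (a : 'Hom(T, E)) (b : 'Hom(T, X)), modhom a -> modhom b ->
          (forall x, p (a x) = u (b x)) -> exists c : 'Hom(T, W),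
          [/\ modhom c, forall x, t (c x) = a x & forall x, r (c x) = b x]].
Proof.
move=> [ih ph i0 iE ps] uh.
have pi y : p (i y) = 0 by apply/eqP; rewrite -memv_ker -iE memv_img ?memvf.
have [d dh dE] := msum_hom ph (modhomN uh).
have [W [w [wh w0 wd]]] := sub_exists (submodule_ker dh).
have dw t : p (w t).1 = u (w t).2.
  have : w t \in lker d by rewrite -wd memv_img ?memvf.
  by rewrite memv_ker; case: (w t) => e x; rewrite dE opp_lfunE subr_eq0 => /eqP.
have [||j jh jE] := @lift_thru _ _ W _ Y w (minl E X \o i)%VF wh w0.
- by apply: modhom_comp => //; apply: minl_hom.
- by move=> y; rewrite wd memv_ker comp_lfunE minlE dE pi linear0 addr0.
exists W, j, (msnd E X \o w)%VF, (mfst E X \o w)%VF; split.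
- split=> //.
  + by apply: modhom_comp => //; apply: msnd_hom.
  + apply: lker0I => y jy; have := jE y; rewrite jy linear0 comp_lfunE minlE.
    by case=> /esym; rewrite -{1}(linear0 i) => /(proj2 (lker0E i) i0).
  + apply/vspaceP => t; rewrite memv_ker comp_lfunE msndE.
    apply/memv_imgP/eqP => [[y _ ->]|t2].
      by rewrite jE comp_lfunE minlE.
    have : (w t).1 \in limg i by rewrite iE memv_ker dw t2 linear0.
    case/memv_imgP => y _ yE; exists y; first exact: memvf.
    apply/(proj2 (lker0E w) w0); rewrite jE comp_lfunE minlE -yE -t2.
    by case: (w t).
  apply/surjP => x; have /surjP/(_ (u x))[e eE] := ps.
  have : (e, x) \in limg w by rewrite wd memv_ker dE opp_lfunE eE subrr.
  by case/memv_imgP => t _ tE; exists t; rewrite comp_lfunE msndE -tE.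
- by apply: modhom_comp => //; apply: mfst_hom.
- by move=> t; rewrite !comp_lfunE mfstE msndE dw.
- split=> [t|e x eE].
    rewrite !comp_lfunE mfstE msndE => t1 t2.
    by apply/(proj2 (lker0E w) w0); rewrite linear0; case: (w t) t1 t2 => a b /= -> ->.
  have : (e, x) \in limg w by rewrite wd memv_ker dE opp_lfunE eE subrr.
  case/memv_imgP => t _ tE; exists t.
  by rewrite !comp_lfunE mfstE msndE -tE.
move=> T a b ah bh ab; have [c ch cE] := hom_msum ah bh.
have [|l lh lE] := lift_thru wh w0 ch.
  by move=> x; rewrite wd memv_ker cE dE opp_lfunE ab subrr.
exists l; split=> // x; first by rewrite comp_lfunE lE cE mfstE.
by rewrite comp_lfunE lE cE msndE.
Qed.

(** The lift along p is obtained from a section of the extension of X by Y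
    pulled back along u. *)
Lemma ext1_zero_lift X Y Z E (i : 'Hom(Y, E)) (p : 'Hom(E, Z)) (u : 'Hom(X, Z)) :
    ext1_zero X Y -> short_exact i p -> modhom u ->
  exists2 l : 'Hom(X, E), modhom l & forall x, p (l x) = u x.
Proof.
move=> /ext1_zero_section XY ip uh.
have [W [j [r [t [jr th tE _ _]]]]] := pullback ip uh.
have [s sh sE] := XY W j r jr.
exists (t \o s)%VF; first exact: modhom_comp.
by move=> x; rewrite comp_lfunE tE sE.
Qed.

Lemma ext1_zero_retract X X' Y : retract X' X -> ext1_zero X Y -> ext1_zero X' Y.
Proof.
case=> v [u [vh uh uv]] XY; apply/ext1_zero_section => E i p ip.
have [l lh lE] := ext1_zero_lift XY ip uh.
exists (l \o v)%VF; first exact: modhom_comp.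
by move=> x; rewrite comp_lfunE lE uv.
Qed.

Lemma ext1_zero_msums n (s : 'I_n -> fdmod A) Y :
  (forall i, ext1_zero (s i) Y) -> ext1_zero (msums s) Y.
Proof.
move=> sY; apply/ext1_zero_section => E i p ip; have [f [q [fh qh _ _ fq]]] := biprod_msums s.
have /fin_all_exists2[l lh lE] := fun j => ext1_zero_lift (sY j) ip (fh j).
exists (\sum_j (l j \o q j))%VF; first by apply: modhom_sum => j; apply: modhom_comp.
move=> x; rewrite sum_lfunE linear_sum [RHS](fq x); apply: eq_bigr => j _.
by rewrite comp_lfunE /= lE.
Qed.

Lemma ext1_zero_msum X X' Y : ext1_zero X Y -> ext1_zero X' Y -> ext1_zero (msum X X') Y.
Proof.
move=> XY X'Y; apply/ext1_zero_section => E i p ip.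
have [l lh lE] := ext1_zero_lift XY ip (@minl_hom _ _ X X').
have [m mh mE] := ext1_zero_lift X'Y ip (@minr_hom _ _ X X').
have [k kh kE] := msum_hom lh mh; exists k => // -[x y].
by rewrite kE linearD /= lE mE -[RHS]msum_eta mfstE msndE.
Qed.

(** * Torsion classes *)

Definition torsion_closed C : Prop :=
  [/\ forall X Z (p : 'Hom(X, Z)), modhom p -> surj p -> C X -> C Z,
      forall X Y E (i : 'Hom(Y, E)) (p : 'Hom(E, X)), short_exact i p -> C Y -> C X -> C E
    & C (mzero A)].

Section Closed.
Variable C : fdmod A -> Prop.
Hypothesis Ctc : torsion_closed C.

Lemma tc_quot X Z (p : 'Hom(X, Z)) : modhom p -> surj p -> C X -> C Z.
Proof. by case: Ctc => + _ _; apply. Qed.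

Lemma tc_iso X Y : iso X Y -> C X -> C Y.
Proof. by case/iso_bij => f [fh _ fs]; apply: tc_quot fs. Qed.

Lemma tc_zero X : zero_module X -> C X.
Proof.
move=> X0; apply: (@tc_iso (mzero A)); last by case: Ctc.
by apply: zero_iso => //; rewrite /zero_module dimvf.
Qed.

Lemma split_exact X Y : short_exact (minl Y X) (msnd Y X).
Proof.
split; [exact: minl_hom|exact: msnd_hom| | |].
- by apply: lker0I => y; rewrite minlE => -[].
- apply/vspaceP => -[y x]; rewrite memv_ker msndE /=.
  apply/memv_imgP/eqP => [[y' _]|->]; first by rewrite minlE => -[].
  by exists y; rewrite ?memvf ?minlE.
by apply/surjP => x; exists (0, x); rewrite msndE.
Qed.

Lemma tc_msum X Y : C X -> C Y -> C (msum X Y).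
Proof. by case: Ctc => _ ext _ CX CY; apply: ext (split_exact Y X) CX CY. Qed.

Lemma tc_retract X Y : retract Y X -> C X -> C Y.
Proof.
by case=> v [u [vh uh uv]]; apply: tc_quot uh _; apply/surjP => y; exists (v y).
Qed.

Lemma tc_msums n (s : 'I_n -> fdmod A) : (forall i, C (s i)) -> C (msums s).
Proof.
move=> sC; rewrite /msums; elim/big_ind: _ => //; first by case: Ctc.
exact: tc_msum.
Qed.

Lemma tc_gen T X : C T -> gen T X -> C X.
Proof.
move=> CT /gen_power[n [p [ph ps]]]; apply: tc_quot ps _ => //.
exact: tc_msums.
Qed.

(** The image of i is the largest submodule of V that lies in C: the preimage in X
    of the image of a map from C to Z is an extension of modules in C. *)
Lemma torsion_submodule X (V : {vspace X}) : submodule V ->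
  exists Y (i : 'Hom(Y, X)) Z (q : 'Hom(X, Z)),
    [/\ short_exact i q, (limg i <= V)%VS, C Y
      & forall T (g : 'Hom(T, Z)), C T -> modhom g -> (limg g <= q @: V)%VS -> g = 0].
Proof.
move=> VS.
have [||_ [Y [i [ih i0 iV CY ->]]] dmax] := @nat_max (fun d => exists Y (i : 'Hom(Y, X)),
    [/\ modhom i, lker i = 0%VS, (limg i <= V)%VS, C Y & d = \dim {:Y}]) (\dim {:X}).
- have [Y [i [ih i0 i0V]]] := sub_exists (@submodule0 _ _ X).
  exists (\dim {:Y}), Y, i; rewrite i0V sub0v; split=> //.
  by apply: tc_zero; rewrite /zero_module -(inj_dim i0) i0V dimv0.
- by move=> _ [Y [i [_ i0 _ _ ->]]]; rewrite -(inj_dim i0) dimvS ?subvf.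
have [Z [q [qh qs qk]]] := quot_exists (submodule_img ih (@submodule_full _ _ Y)).
exists Y, i, Z, q; split=> // T g CT gh gV.
have qi y : q (i y) = 0 by apply/eqP; rewrite -memv_ker qk memv_img ?memvf.
pose U := (q @^-1: limg g)%VS.
have US : submodule U by apply: submodule_pre => //; apply/submodule_img/submodule_full.
have [W [w [wh w0 wU]]] := sub_exists US.
have [I [k [kh k0 kI]]] := sub_exists (submodule_img gh (@submodule_full _ _ T)).
have CI : C I.
  have [|r rh rE] := @lift_thru _ _ I Z T k g kh k0 gh.
    by move=> t; rewrite kI memv_img ?memvf.
  apply: (tc_quot rh) => //; apply/surjP => y.
  have : k y \in limg g by rewrite -kI memv_img ?memvf.
  case/memv_imgP => t _; rewrite -rE => /(proj2 (lker0E k) k0) ->.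
  by exists t.
have [|j jh jE] := @lift_thru _ _ W X Y w i wh w0 ih.
  by move=> y; rewrite wU -memv_preim qi mem0v.
have [||r rh rE] := @lift_thru _ _ I Z W k (q \o w)%VF kh k0.
- exact: modhom_comp.
- move=> t; rewrite kI comp_lfunE.
  have : w t \in U by rewrite -wU memv_img ?memvf.
  by rewrite -memv_preim.
have jr : short_exact j r.
  split=> //.
  - by apply: lker0I => y jy; apply/(proj2 (lker0E i) i0); rewrite -jE jy !linear0.
  - apply/vspaceP => t; rewrite memv_ker; apply/memv_imgP/eqP => [[y _ ->]|rt].
      by apply/(proj2 (lker0E k) k0); rewrite rE comp_lfunE jE qi linear0.
    have : w t \in limg i by rewrite -qk memv_ker -comp_lfunE -rE rt linear0.
    case/memv_imgP => y _ wt; exists y; first exact: memvf.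
    by apply/(proj2 (lker0E w) w0); rewrite jE.
  apply/surjP => y; have /surjP/(_ (k y))[x xE] := qs.
  have : x \in limg w by rewrite wU -memv_preim xE -kI memv_img ?memvf.
  case/memv_imgP => t _ tE; exists t; apply/(proj2 (lker0E k) k0).
  by rewrite rE comp_lfunE -tE.
have CW : C W by case: Ctc => _ ext _; apply: ext jr CY CI.
have wV : (limg w <= V)%VS.
  rewrite wU; apply/subvP => x; rewrite -memv_preim => /(subvP gV).
  case/memv_imgP => v vV xv; rewrite -(subrK v x); apply: memvD => //.
  by apply: (subvP iV); rewrite -qk memv_ker linearB /= xv subrr.
have le : (\dim {:W} <= \dim {:Y})%N by apply: dmax; exists W, w.
have [_ _ j0 jk rs] := jr.
have js : surj j.
  by apply: inj_surj => //; apply/eqP; rewrite eqn_leq le -(inj_dim j0) dimvS ?subvf.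
apply/lfunP => t; rewrite zero_lfunE.
have : g t \in limg k by rewrite kI memv_img ?memvf.
case/memv_imgP => y _ ->; have /surjP/(_ y)[s <-] := rs.
have : s \in lker r by rewrite -jk js memvf.
by rewrite memv_ker => /eqP ->; rewrite linear0.
Qed.

(** The largest submodule of X in C contains the images of all maps D -> X. *)
Lemma tc_generated D X : C D ->
  (forall x : X, exists2 g : 'Hom(D, X), modhom g & x \in limg g) -> C X.
Proof.
move=> CD DX.
have [Y [i [Z [q [[ih qh i0 iq qs] _ CY q0]]]]] := torsion_submodule (@submodule_full _ _ X).
apply: (tc_quot ih) => //; rewrite /surj iq; apply/vspaceP => x; rewrite memvf.
have [g gh /memv_imgP[d _ ->]] := DX x.
rewrite memv_ker -comp_lfunE (_ : (q \o g)%VF = 0) ?zero_lfunE ?eqxx //.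
by apply: (q0 D) => //; [apply: modhom_comp|rewrite limg_comp limgS ?subvf].
Qed.

Lemma tc_precover X : exists D (f : 'Hom(D, X)), precover C f.
Proof.
have [Y [i [Z [q [[ih qh i0 iq qs] _ CY q0]]]]] := torsion_submodule (@submodule_full _ _ X).
exists Y, i; split=> // D g CD gh.
have [|h hh hE] := @lift_thru _ _ Y X D i g ih i0 gh.
  move=> d; rewrite iq memv_ker -comp_lfunE (_ : (q \o g)%VF = 0) ?zero_lfunE ?eqxx //.
  by apply: (q0 D) => //; [apply: modhom_comp|rewrite limg_comp limgS ?subvf].
by exists h => //; apply/lfunP => d; rewrite comp_lfunE.
Qed.

Lemma torsion_closed_class : torsion_class C.
Proof.
exists (fun Y => forall X, C X -> hom_zero X Y); split.
- split; first exact: tc_iso.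
  move=> X Y; split=> [CXY|[]]; last exact: tc_msum.
  split; [exact: tc_retract (retract_msuml X Y) CXY|exact: tc_retract (retract_msumr X Y) CXY].
- split=> [X Y /isoP[f [g [fh gh fK gK]]] X0 T CT k kh|X Y].
    apply/lfunP => t; rewrite zero_lfunE -[k t]gK -[g _]comp_lfunE.
    by rewrite (X0 T CT _ (modhom_comp gh kh)) zero_lfunE linear0.
  split=> [XY0|[X0 Y0] T CT k kh].
    split=> T CT k kh; apply/lfunP => t; rewrite zero_lfunE.
      have := XY0 T CT _ (modhom_comp (@minl_hom _ _ X Y) kh) => /lfunP/(_ t).
      by rewrite comp_lfunE minlE zero_lfunE => -[].
    have := XY0 T CT _ (modhom_comp (@minr_hom _ _ X Y) kh) => /lfunP/(_ t).
    by rewrite comp_lfunE minrE zero_lfunE => -[].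
  apply/lfunP => t; rewrite zero_lfunE -[LHS]msum_eta.
  rewrite -[mfst _ _ _]comp_lfunE -[msnd _ _ _]comp_lfunE.
  rewrite (X0 T CT _ (modhom_comp (@mfst_hom _ _ X Y) kh)).
  rewrite (Y0 T CT _ (modhom_comp (@msnd_hom _ _ X Y) kh)).
  by rewrite !zero_lfunE !linear0 addr0.
- by move=> X Y CX; apply.
move=> X.
have [Y [i [Z [q [iq _ CY q0]]]]] := torsion_submodule (@submodule_full _ _ X).
exists Y, Z, i, q; split=> // T CT g gh; apply: q0 => //.
by have [_ _ _ _ ->] := iq; apply: subvf.
Qed.

End Closed.

(** The modules of a torsion class are those without nonzero maps to the
    torsion-free modules, a condition inherited by quotients and extensions. *)
Lemma torsion_class_closed C : torsion_class C -> torsion_closed C.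
Proof.
case=> F [[Ciso CD] [Fiso FD] CF CX].
have CE X : (forall Y, F Y -> hom_zero X Y) -> C X.
  move=> X0; have [T [Y [i [p [CT FY [ih ph i0 ip ps]]]]]] := CX X.
  apply: Ciso CT; apply: (iso_intro ih) => //.
  rewrite /surj ip; apply/vspaceP => x.
  by rewrite memv_ker (X0 Y FY p ph) zero_lfunE eqxx memvf.
split.
- move=> X Z p ph ps CX'; apply: CE => Y FY g gh.
  have gp := CF _ _ CX' FY _ (modhom_comp gh ph).
  apply/lfunP => z; have /surjP/(_ z)[x <-] := ps.
  by rewrite -comp_lfunE gp !zero_lfunE.
- move=> X Y E i p [ih ph i0 ip ps] CY CX'; apply: CE => Z FZ g gh.
  have gi := CF _ _ CY FZ _ (modhom_comp gh ih).
  have [|h hh hE] := factor_surj ph ps gh.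
    move=> e /eqP; rewrite -memv_ker -ip => /memv_imgP[y _ ->].
    by rewrite -comp_lfunE gi zero_lfunE.
  apply/lfunP => e; rewrite -hE (CF _ _ CX' FZ _ hh).
  by rewrite !zero_lfunE.
apply: CE => Y _ g gh; apply/lfunP => x; rewrite [x]thinmx0.
by rewrite !linear0.
Qed.

(** * The torsion class generated by a tau-rigid module *)

Lemma right_approximation_image T X n (r : 'Hom(power T n, X)) m (h : 'Hom(power T m, X)) :
    (forall g : 'Hom(T, X), modhom g ->
      exists2 k : 'Hom(T, power T n), modhom k & forall t, r (k t) = g t) ->
  modhom h -> (limg h <= limg r)%VS.
Proof.
move=> rP hh; have [f [p [fh ph _ _ fp]]] := biprod_msums (fun _ : 'I_m => T).
apply/subvP => _ /memv_imgP[x _ ->]; rewrite (fp x) linear_sum; apply: rpred_sum => i _.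
have [k kh kE] := rP _ (modhom_comp hh (fh i)).
by have /= := kE (p i x); rewrite comp_lfunE /= => <-; rewrite memv_img ?memvf.
Qed.

(** Cover an extension E of X by Y, both in gen T: the cover of X by copies of T
    lifts to E, because Ext^1(T, Y) = 0. *)
Lemma gen_closed T : (forall Y, gen T Y -> ext1_zero T Y) -> torsion_closed (gen T).
Proof.
move=> Text; split.
- by move=> X Z p ph ps TX; apply: gen_quot ps.
- move=> X Y E i p ip /gen_power[m [b [bh bs]]].
  have TY : gen T Y by apply/gen_power; exists m, b.
  move=> /gen_power[n [a [ah as_]]]; have [ih ph i0 iE ps] := ip.
  have TnY : ext1_zero (power T n) Y by apply: ext1_zero_msums => _; apply: Text.
  have [l lh lE] := ext1_zero_lift TnY ip ah.
  have [k [r [rh rP]]] := right_approximation T E.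
  apply/gen_power; exists k, r; split=> //; apply/vspaceP => e; rewrite memvf.
  have /surjP/(_ (p e))[t te] := as_.
  have : e - l t \in limg i by rewrite iE memv_ker linearB /= lE te subrr.
  case/memv_imgP => y _ yE; rewrite -(subrK (l t) e) yE.
  have /surjP/(_ y)[u <-] := bs; rewrite -comp_lfunE; apply: memvD.
    apply: (subvP (right_approximation_image rP _) _ (memv_img _ (memvf _))).
    exact: modhom_comp.
  exact: (subvP (right_approximation_image rP _) _ (memv_img _ (memvf _))).
apply/gen_power; exists 0%N, 0; split; first exact: modhom0.
by apply/surjP => x; exists 0; rewrite linear0 [x]thinmx0.
Qed.

(** A left approximation of a projective module P by copies of T is a
    preenvelope, since maps from P lift to copies of T; dividing by the image of
    the kernel of P -> X gives a preenvelope of X. *)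
Lemma gen_preenvelope T X : exists D (f : 'Hom(X, D)), preenvelope (gen T) f.
Proof.
have [k [p [ph ps]]] := free_cover X; set P := power _ k in p ph ps.
have Pp : projective P by apply: projective_msums => _; apply: projective_reg.
have [n [l [lh lP]]] := left_approximation T P.
have [D [q [qh qs qk]]] := quot_exists (submodule_img lh (submodule_ker ph)).
have [||f fh fE] := @factor_surj _ _ P X D p (q \o l)%VF ph ps.
- exact: modhom_comp.
- move=> x px; apply/eqP; rewrite comp_lfunE -memv_ker qk memv_img //.
  by rewrite memv_ker px.
exists D, f; split=> //; first by apply/gen_power; exists n, q.
move=> E g /gen_power[m [r [rh rs]]] gh.
have [b bh bE] := projective_lift Pp rh rs (modhom_comp gh ph).
have [j [s [jh sh _ _ js]]] := biprod_msums (fun _ : 'I_m => T).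
have /fin_all_exists2[c ch cE] : forall i, exists2 c : 'Hom(power T n, T), modhom c &
    forall x, c (l x) = s i (b x).
  move=> i; have [c ch cE] := lP _ (modhom_comp (sh i) bh).
  by exists c => // x; rewrite cE comp_lfunE.
pose d := (r \o \sum_i (j i \o c i))%VF.
have dh : modhom d.
  by apply: modhom_comp => //; apply: modhom_sum => i; apply: modhom_comp.
have dE x : d (l x) = g (p x).
  rewrite comp_lfunE -[RHS]comp_lfunE -[RHS]bE [in RHS](js (b x)) sum_lfunE; congr (r _).
  by apply: eq_bigr => i _; rewrite comp_lfunE cE.
have [|h hh hE] := factor_surj qh qs dh.
  move=> x /eqP; rewrite -memv_ker qk => /memv_imgP[y].
  by rewrite memv_ker => /eqP py ->; rewrite dE py linear0.
exists h => //; apply/lfunP => x; have /surjP/(_ x)[y <-] := ps.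
by rewrite comp_lfunE fE comp_lfunE hE dE.
Qed.

End Torsion.
(** * Ext-projective modules of a functorially finite torsion class *)

Section ExtProjectives.
Variables (K : fieldType) (A : fdAlgType K).
Implicit Types X Y Z W T P L E D : fdmod A.
Variable C : fdmod A -> Prop.
Hypothesis Ctc : torsion_closed C.

Lemma ext_projective_retract X Y : retract Y X -> ext_projective C X -> ext_projective C Y.
Proof.
move=> YX [CX Xext]; split; first exact: tc_retract YX CX.
by move=> Z CZ; apply: ext1_zero_retract YX (Xext _ CZ).
Qed.

Lemma ext_projective_iso X Y : iso X Y -> ext_projective C X -> ext_projective C Y.
Proof. by move=> /iso_sym/iso_retract/ext_projective_retract. Qed.

Lemma ext_projective_msum X Y :
  ext_projective C X -> ext_projective C Y -> ext_projective C (msum X Y).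
Proof.
move=> [CX Xext] [CY Yext]; split; first exact: tc_msum.
by move=> Z CZ; apply: ext1_zero_msum; [apply: Xext|apply: Yext].
Qed.

Lemma ext_projective_msums n (s : 'I_n -> fdmod A) :
  (forall i, ext_projective C (s i)) -> ext_projective C (msums s).
Proof.
move=> sC; split; first by apply: tc_msums => // i; case: (sC i).
by move=> Z CZ; apply: ext1_zero_msums => i; case: (sC i) => _; apply.
Qed.

Hypothesis Cpre : forall X, exists D (f : 'Hom(X, D)), preenvelope C f.

Lemma preenvelope_lift X D E (f : 'Hom(X, D)) (g : 'Hom(X, E)) :
    preenvelope C f -> C E -> modhom g ->
  exists2 h : 'Hom(D, E), modhom h & forall x, h (f x) = g x.
Proof.
case=> _ _ fP CE gh; have [h hh ->] := fP _ _ CE gh.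
by exists h => // x; rewrite comp_lfunE.
Qed.

(** A preenvelope with target of smallest dimension is left minimal: by
    Fitting's lemma a power of an endomorphism h of D with h f = f splits off a
    summand of D containing the image of f, still a preenvelope. *)
Lemma minimal_preenvelope X : exists D (f : 'Hom(X, D)), preenvelope C f /\
  forall h : 'End(D), @modhom K A D D h -> (forall x, h (f x) = f x) -> lker h = 0%VS.
Proof.
have [|_ [D [f [fP ->]]] dmin] := @nat_min (fun d => exists D (f : 'Hom(X, D)),
    preenvelope C f /\ d = \dim {:D}).
  by have [D [f fP]] := Cpre X; exists (\dim {:D}), D, f.
exists D, f; split=> // h hh hf.
have [CD fh _] := fP.
have [n [Y [v [u [[vh uh uv] iv ku]]]]] := fitting hh.
have hn x : lpow h n.+1 (f x) = f x by apply: lpow_fix.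
have vuf x : v (u (f x)) = f x.
  have : f x \in limg v by rewrite iv -hn memv_img ?memvf.
  by case/memv_imgP => y _ ->; rewrite uv.
have us : surj u by apply/surjP => y; exists (v y).
have ufP : preenvelope C (u \o f)%VF.
  split; [exact: tc_quot us CD|exact: modhom_comp|].
  move=> E g CE gh; have [k kh kE] := preenvelope_lift fP CE gh.
  exists (k \o v)%VF; first exact: modhom_comp.
  by apply/lfunP => x; rewrite !comp_lfunE vuf kE.
have le : (\dim {:D} <= \dim {:Y})%N by apply: dmin; exists Y, (u \o f)%VF.
have u0 := surj_inj us le.
apply: lker0I => x hx; apply/(proj2 (lker0E u) u0); rewrite linear0; apply/eqP.
by rewrite -memv_ker ku memv_ker -addn1 lpowD comp_lfunE /= comp_lfun1r hx linear0.
Qed.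

(** An extension E of D by a module of C
    lies in C, so f lifts to E and the lift factors through f, which splits the
    extension by minimality.  For an extension of D1, pull it back to an
    extension of D, to which f lifts by 0; the section of D obtained in this
    way is compatible with D -> D1. *)
Lemma approximation_sequence P : projective P ->
  exists D D1 (f : 'Hom(P, D)) (g : 'Hom(D, D1)),
    [/\ preenvelope C f, [/\ modhom g, surj g & lker g = limg f],
        ext_projective C D & ext_projective C D1].
Proof.
move=> Pp; have [D [f [fP fmin]]] := minimal_preenvelope P.
have [CD fh _] := fP; have [_ Cext _] := Ctc.
have [D1 [g [gh gs gk]]] := quot_exists (submodule_img fh (@submodule_full _ _ P)).
have gf x : g (f x) = 0 by apply/eqP; rewrite -memv_ker gk memv_img ?memvf.
have CD1 : C D1 by apply: tc_quot gs CD.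
(* f lifts to an extension of D in C, and factoring the lift through f splits it *)
have split_over E (p : 'Hom(E, D)) (l : 'Hom(P, E)) : C E -> modhom p -> modhom l ->
    (forall x, p (l x) = f x) ->
  exists s : 'Hom(D, E), [/\ modhom s, forall x, p (s x) = x & forall x, s (f x) = l x].
  move=> CE ph lh lE; have [k kh kE] := preenvelope_lift fP CE lh.
  pose h := (p \o k)%VF; have hh : @modhom K A D D h by apply: modhom_comp.
  have hf x : h (f x) = f x by rewrite comp_lfunE kE lE.
  have h0 := fmin h hh hf.
  have hs : @surj _ _ D D h by apply: inj_surj.
  have hK x : h (h^-1%VF x) = x by rewrite limg_lfunVK // hs memvf.
  have Kh x : h^-1%VF (h x) = x by rewrite lker0_lfunK // h0.
  exists (k \o h^-1)%VF; split.
  - apply: modhom_comp => // a x; rewrite -{1}(hK x).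
    by rewrite -hh Kh.
  - by move=> x; rewrite comp_lfunE -[p _]comp_lfunE hK.
  - by move=> x; rewrite comp_lfunE -{1}hf Kh kE.
exists D, D1, f, g; split=> //; split=> // Y CY; apply/ext1_zero_section => E i p ip.
  have [ih ph i0 iE ps] := ip.
  have CE : C E by apply: Cext ip CY CD.
  have [l lh lE] := projective_lift Pp ph ps fh.
  by have [s [sh sE _]] := split_over E p l CE ph lh lE; exists s.
have [ih ph i0 iE ps] := ip.
have [W [j [r [t [jr th tE _ Wlift]]]]] := pullback ip gh.
have CW : C W by apply: Cext jr CY CD.
have [|l [lh tl rl]] := Wlift P 0 f (@modhom0 _ _ _ _) fh.
  by move=> x; rewrite gf zero_lfunE linear0.
have [_ rh _ _ _] := jr.
have [s [sh sE sf]] := split_over W r l CW rh lh rl.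
have [||k kh kE] := @factor_surj _ _ D D1 E g (t \o s)%VF gh gs.
- exact: modhom_comp.
- move=> x /eqP; rewrite -memv_ker gk => /memv_imgP[y _ ->].
  by rewrite comp_lfunE sf tl zero_lfunE.
exists k => // x; have /surjP/(_ x)[y <-] := gs.
by rewrite kE comp_lfunE tE sE.
Qed.

Lemma preenvelope_reg_gen D (f : 'Hom(mreg A, D)) X : preenvelope C f -> C X -> gen D X.
Proof.
move=> fP CX; have [n [p [ph ps]]] := free_cover X; have [CD fh _] := fP.
have [j [s [jh sh _ _ js]]] := biprod_msums (fun _ : 'I_n => mreg A).
have [j' [s' [jh' sh' sj' sj0' js']]] := biprod_msums (fun _ : 'I_n => D).
have /fin_all_exists2[g gh gE] := fun i => preenvelope_lift fP CX (modhom_comp ph (jh i)).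
apply/gen_power; exists n, (\sum_i (g i \o s' i))%VF; split.
  by apply: modhom_sum => i; apply: modhom_comp.
apply/surjP => x; have /surjP/(_ x)[y <-] := ps.
exists (\sum_i j' i (f (s i y))); rewrite linear_sum {2}(js y) linear_sum.
apply: eq_bigr => i _ /=; rewrite sum_lfunE (bigD1 i) //= comp_lfunE sj' gE comp_lfunE.
rewrite big1 ?addr0 // => k ki; rewrite comp_lfunE sj0' ?linear0 //.
Qed.

(** Let T = D + D1 for the minimal preenvelope A -> D with cokernel D1.
    The kernel of a right approximation of a module of C by copies of T lies in C:
    a map from A to the kernel extends to a map from D to the copies of T,
    whose composite with the approximation factors through D1, hence lifts;
    correcting by this lift gives a map from D to the kernel. *)
Lemma ext_projective_generator : exists T,
  [/\ ext_projective C T, forall X, C X <-> gen T X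
    & forall X, ext_projective C X -> exists n, retract X (power T n)].
Proof.
have [D [D1 [f [g [fP [gh gs gk] Dep D1ep]]]]] := approximation_sequence (@projective_reg _ A).
have [CD fh _] := fP.
have gf x : g (f x) = 0 by apply/eqP; rewrite -memv_ker gk memv_img ?memvf.
pose T := msum D D1; have Tep : ext_projective C T by apply: ext_projective_msum.
have CT : C T by case: Tep.
have CgenT X : C X <-> gen T X.
  split=> [CX|]; last exact: tc_gen.
  have /gen_power[n [p [ph ps]]] := preenvelope_reg_gen fP CX.
  have [j [s [jh sh sj sj0 js]]] := biprod_msums (fun _ : 'I_n => D).
  have [j' [s' [jh' sh' sj' sj0' js']]] := biprod_msums (fun _ : 'I_n => T).
  apply/gen_power; exists n, (\sum_i (p \o (j i \o (mfst D D1 \o s' i))))%VF; split.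
    apply: modhom_sum => i; do 3 apply: modhom_comp => //; exact: mfst_hom.
  apply/surjP => x; have /surjP/(_ x)[y <-] := ps.
  exists (\sum_i j' i (minl D D1 (s i y))); rewrite linear_sum {2}(js y) linear_sum.
  apply: eq_bigr => i _ /=; rewrite sum_lfunE (bigD1 i) //= !comp_lfunE sj' mfstE minlE.
  by rewrite big1 ?addr0 // => k ki; rewrite !comp_lfunE sj0' ?linear0.
exists T; split=> // X [CX Xext].
have [n [r [rh rP]]] := right_approximation T X.
have CTn : C (power T n) by apply: tc_msums.
have rs : surj r.
  have /gen_power[m [p [ph ps]]] := proj1 (CgenT X) CX.
  apply/eqP; rewrite eqEsubv subvf -ps; exact: right_approximation_image.
have [L [i [ih i0 ir]]] := sub_exists (submodule_ker rh).
have ri l : r (i l) = 0 by apply/eqP; rewrite -memv_ker -ir memv_img ?memvf.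
have CL : C L.
  apply: (tc_generated Ctc CD) => l.
  have [b bh bE] := reg_hom l.
  have [k kh kE] := preenvelope_lift fP CTn (modhom_comp ih bh).
  have [||m mh mE] := @factor_surj _ _ D D1 X g (r \o k)%VF gh gs.
  - exact: modhom_comp.
  - move=> x /eqP; rewrite -memv_ker gk => /memv_imgP[y _ ->].
    by rewrite comp_lfunE kE comp_lfunE ri.
  have [h hh hE] := rP _ (modhom_comp mh (@msnd_hom _ _ D D1)).
  pose c := (h \o (minr D D1 \o g))%VF.
  have ch : modhom c.
    by apply: modhom_comp => //; apply: modhom_comp => //; apply: minr_hom.
  have [||k' kh' kE'] := @lift_thru _ _ L (power T n) D i (k - c) ih i0.
  - exact: modhomB.
  - move=> x; rewrite ir memv_ker add_lfunE opp_lfunE linearB /= !comp_lfunE hE.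
    by rewrite comp_lfunE minrE msndE mE comp_lfunE subrr.
  exists k' => //; apply/memv_imgP; exists (f (1 : A)); first exact: memvf.
  apply/(proj2 (lker0E i) i0); rewrite kE' add_lfunE opp_lfunE kE !comp_lfunE gf.
  by rewrite !linear0 addr0 bE act1.
have [|s sh sE] := proj1 (ext1_zero_section X L) (Xext L CL) _ i r.
  by split.
by exists n, s, r.
Qed.

(** The Ext-projective modules are the summands of copies of one module, so by
    Krull-Schmidt there are finitely many indecomposable ones. *)
Lemma P_exists : exists n (s : 'I_n -> fdmod A),
  [/\ representatives (fun Y => indecomposable Y /\ ext_projective C Y) s,
      ext_projective C (msums s) & forall X, C X <-> gen (msums s) X].
Proof.
have [T [Tep CT Tgen]] := ext_projective_generator.
have [m [t tP]] := indec_retracts_finite T.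
have [|n _ [s sP]] := @num_classes_bounded _ _
  (fun Y => indecomposable Y /\ ext_projective C Y) m.
  move=> k u uC un; apply: (nonisos_le un) => i; have [ui uep] := uC i.
  have [l /(indec_retract_msums ui)[_ uT]] := Tgen _ uep.
  exact: tP ui uT.
exists n, s; have [sC sn sall] := sP.
have Sep : ext_projective C (msums s) by apply: ext_projective_msums => i; case: (sC i).
split=> // X; split; last by apply: tc_gen => //; case: Sep.
have Stc : torsion_closed (gen (msums s)).
  by apply: gen_closed => Y SY; case: Sep => CS; apply; apply: (tc_gen Ctc CS SY).
have ST Y : ext_projective C Y -> gen (msums s) Y.
  move: Y; apply: decomposition_ind.
  - move=> Y Z YZ IH Zep; apply: (tc_iso Stc YZ); apply: IH.
    exact: ext_projective_iso (iso_sym YZ) Zep.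
  - by move=> Y Y0 _; apply: tc_zero.
  - move=> Y Yi Yep; have [i Ys] := sall Y (conj Yi Yep).
    exact: gen_retract (retract_trans (iso_retract Ys) (msums_retract s i)).
  - move=> Y Z IHY IHZ YZep; apply: (tc_msum Stc); [apply: IHY|apply: IHZ].
      exact: ext_projective_retract (retract_msuml Y Z) YZep.
    exact: ext_projective_retract (retract_msumr Y Z) YZep.
by move=> /CT TX; apply: (tc_gen Stc) TX; apply: ST.
Qed.

End ExtProjectives.
(** * Dimensions of spaces of homomorphisms *)

Section HomDimension.
Variables (K : fieldType) (A : fdAlgType K).
Implicit Types X Y Z W T P L E D M : fdmod A.

Definition homset X Y : {vspace 'Hom(X, Y)} :=
  sval (subspace_of (@modhom0 K A X Y) (@modhomP K A X Y)).

Lemma mem_homset X Y (f : 'Hom(X, Y)) : f \in homset X Y <-> modhom f.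
Proof. exact: (svalP (subspace_of (@modhom0 K A X Y) (@modhomP K A X Y))). Qed.

Definition hdim X Y : nat := \dim (homset X Y).

Lemma hdim0P X Y : hdim X Y = 0%N <-> hom_zero X Y.
Proof.
rewrite /hdim; split=> [/eqP|XY].
  by rewrite dimv_eq0 => /eqP XY f /mem_homset; rewrite XY memv0 => /eqP.
apply/eqP; rewrite dimv_eq0 -subv0; apply/subvP => f /mem_homset/XY ->.
exact: mem0v.
Qed.

Section Precomposition.
Variables (X Y M : fdmod A) (f : 'Hom(X, Y)).

Fact precomp_linear : linear (fun g : 'Hom(Y, M) => (g \o f)%VF).
Proof. by move=> k g h; rewrite comp_lfunDl comp_lfunZl. Qed.
Definition precomp : 'Hom('Hom(Y, M), 'Hom(X, M)) := mklfun precomp_linear.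
Lemma precompE g : precomp g = (g \o f)%VF. Proof. exact: mklfunE. Qed.

Fact postcomp_linear : linear (fun g : 'Hom(M, X) => (f \o g)%VF).
Proof. by move=> k g h; rewrite comp_lfunDr comp_lfunZr. Qed.
Definition postcomp : 'Hom('Hom(M, X), 'Hom(M, Y)) := mklfun postcomp_linear.
Lemma postcompE g : postcomp g = (f \o g)%VF. Proof. exact: mklfunE. Qed.

End Precomposition.

(** The number r is the rank of Hom(f, M). *)
Lemma hdim_presentation P1 P0 X (f : 'Hom(P1, P0)) (p : 'Hom(P0, X)) M :
    modhom f -> modhom p -> surj p -> limg f = lker p ->
  exists r, [/\ hdim P0 M = (hdim X M + r)%N, (r <= hdim P1 M)%N
              & r = hdim P1 M <-> factors f M].
Proof.
move=> fh ph ps fp; exists (\dim (precomp M f @: homset P0 M)%VS).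
have pf x : p (f x) = 0 by apply/eqP; rewrite -memv_ker -fp memv_img ?memvf.
have sub : (precomp M f @: homset P0 M <= homset P1 M)%VS.
  apply/subvP => _ /memv_imgP[g /mem_homset gh ->]; rewrite precompE.
  by apply/mem_homset/modhom_comp.
split; last 2 first.
- exact: dimvS.
- rewrite /hdim; split=> [/eqP dE h /mem_homset|fM].
    have /eqP <- : (precomp M f @: homset P0 M)%VS == homset P1 M.
      by rewrite eqEdim sub (eqP dE) leqnn.
    case/memv_imgP => g /mem_homset gh ->; exists g => // x.
    by rewrite precompE comp_lfunE.
  congr (\dim _); apply/eqP; rewrite eqEsubv sub; apply/subvP => h /mem_homset/fM[g gh gE].
  apply/memv_imgP; exists g; first exact/mem_homset.
  by apply/lfunP => x; rewrite precompE comp_lfunE gE.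
rewrite /hdim -(limg_ker_dim (precomp M f)); congr (_ + _)%N.
rewrite (_ : (_ :&: _)%VS = (precomp M p @: homset X M)%VS).
  apply: limg_dim_eq; apply/eqP; rewrite -subv0; apply/subvP => g.
  rewrite memv_cap memv_ker precompE => /andP[_ /eqP gp].
  rewrite memv0; apply/eqP/lfunP => x; have /surjP/(_ x)[y <-] := ps.
  by rewrite -comp_lfunE gp !zero_lfunE.
apply/vspaceP => g; rewrite memv_cap memv_ker precompE; apply/andP/memv_imgP.
  case=> /mem_homset gh /eqP gf.
  have [|h hh hE] := factor_surj ph ps gh.
    move=> x /eqP; rewrite -memv_ker -fp => /memv_imgP[y _ ->].
    by rewrite -comp_lfunE gf zero_lfunE.
  exists h; first exact/mem_homset.
  by apply/lfunP => x; rewrite precompE comp_lfunE hE.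
case=> h /mem_homset hh ->; rewrite precompE; split.
  exact/mem_homset/modhom_comp.
by apply/eqP/lfunP => x; rewrite !comp_lfunE pf linear0 zero_lfunE.
Qed.

Lemma hdim_ses_projective X Y E P (i : 'Hom(Y, E)) (p : 'Hom(E, X)) :
  projective P -> short_exact i p -> hdim P E = (hdim P Y + hdim P X)%N.
Proof.
move=> Pp [ih ph i0 iE ps]; rewrite /hdim -(limg_ker_dim (postcomp P p)).
have pi y : p (i y) = 0 by apply/eqP; rewrite -memv_ker -iE memv_img ?memvf.
congr (_ + _)%N; last first.
  congr (\dim _); apply/vspaceP => g; apply/memv_imgP/idP => [[h /mem_homset hh ->]|/mem_homset gh].
    by rewrite postcompE; apply/mem_homset/modhom_comp.
  have [l lh lE] := projective_lift Pp ph ps gh.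
  exists l; first exact/mem_homset.
  by apply/lfunP => x; rewrite postcompE comp_lfunE lE.
rewrite (_ : (_ :&: _)%VS = (postcomp P i @: homset P Y)%VS).
  apply: limg_dim_eq; apply/eqP; rewrite -subv0; apply/subvP => g.
  rewrite memv_cap memv_ker postcompE => /andP[_ /eqP gp].
  rewrite memv0; apply/eqP/lfunP => x; apply/(proj2 (lker0E i) i0).
  by rewrite -comp_lfunE gp !zero_lfunE linear0.
apply/vspaceP => g; rewrite memv_cap memv_ker postcompE; apply/andP/memv_imgP.
  case=> /mem_homset gh /eqP gf.
  have [|h hh hE] := lift_thru ih i0 gh.
    by move=> x; rewrite iE memv_ker -comp_lfunE gf zero_lfunE.
  exists h; first exact/mem_homset.
  by apply/lfunP => x; rewrite postcompE comp_lfunE hE.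
case=> h /mem_homset hh ->; rewrite postcompE; split.
  exact/mem_homset/modhom_comp.
by apply/eqP/lfunP => x; rewrite !comp_lfunE pi zero_lfunE.
Qed.

Lemma hdim_ses_split X Y E (i : 'Hom(Y, E)) (p : 'Hom(E, X)) M :
  ext1_zero X Y -> short_exact i p -> hdim E M = (hdim X M + hdim Y M)%N.
Proof.
move=> XY ip; have [ih ph i0 iE ps] := ip.
have [r [-> _ [_ ->]]] // := hdim_presentation M ih ph ps iE.
move=> h hh; have [t th tE] := proj1 (ext1_zero_retraction X Y) XY _ _ _ ip.
by exists (h \o t)%VF => [|x]; [apply: modhom_comp|rewrite comp_lfunE tE].
Qed.

Lemma projective_extension X Y E (i : 'Hom(Y, E)) (p : 'Hom(E, X)) :
  projective X -> projective Y -> short_exact i p -> projective E.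
Proof.
move=> Xp Yp ip; have [ih ph i0 iE ps] := ip.
have [s sh sE] := projective_lift Xp ph ps (@modhom_id _ _ X).
have sE' x : p (s x) = x by rewrite sE id_lfunE.
apply: (projective_retract (iso_retract (split_iso sh ph sE' ih i0 iE))).
exact: projective_msum.
Qed.

Lemma hdim_zero X M : zero_module M -> hdim X M = 0%N.
Proof.
move=> /mod_eq0 M0; apply/hdim0P => f _; apply/lfunP => x.
by rewrite zero_lfunE (M0 (f x)).
Qed.

(** * Projective resolutions of length one *)

Definition resolution X P1 P0 : Prop :=
  [/\ projective P1, projective P0 &
      exists (f : 'Hom(P1, P0)) (p : 'Hom(P0, X)), short_exact f p].

Definition euler P1 P0 M : rat := (hdim P0 M)%:R - (hdim P1 M)%:R.

(** In terms of X the number [euler P1 P0 M] is dim Hom(X, M) - dim Ext^1(X, M);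
    so it equals the first term when Ext^1(X, M) = 0, and is nonzero when
    Hom(X, M) = 0 but Ext^1(X, M) is not. *)
Lemma euler_ext1_zero X P1 P0 M : resolution X P1 P0 ->
  ext1_zero X M -> euler P1 P0 M = (hdim X M)%:R.
Proof.
case=> _ _ [f [p fp]] XM; have [fh ph f0 fE ps] := fp.
have [r [rE _ [_ rP]]] := hdim_presentation M fh ph ps fE.
rewrite /euler rE rP ?natrD ?addrK // => h hh.
exact: ext1_zero_extend XM fp hh.
Qed.

Lemma euler_ext1_nonzero X P1 P0 M : resolution X P1 P0 ->
  ~ ext1_zero X M -> hom_zero X M -> euler P1 P0 M != 0.
Proof.
case=> _ P0p [f [p [fh ph f0 fE ps]]] XM /hdim0P XM0.
have [r [rE rle rP]] := hdim_presentation M fh ph ps fE.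
rewrite /euler rE XM0 add0n subr_eq0 Num.Theory.eqr_nat; apply/eqP => /rP fM.
exact/XM/(factors_ext1_zero P0p fh ph ps fE).
Qed.

(** Schanuel's lemma: the pullback of P0 and R0 over X is an extension of P0 by R1
    as well as of R0 by P1. *)
Lemma euler_unique X P1 P0 R1 R0 M :
  resolution X P1 P0 -> resolution X R1 R0 -> euler P1 P0 M = euler R1 R0 M.
Proof.
case=> _ P0p [f [p fp]] [_ R0p [g [q gq]]].
have [fh ph f0 fE ps] := fp; have [gh qh g0 gE qs] := gq.
have [W [j [r [t [jr th tE [tr0 trs] Wlift]]]]] := pullback fp qh.
have pf x : p (f x) = 0 by apply/eqP; rewrite -memv_ker -fE memv_img ?memvf.
have qg x : q (g x) = 0 by apply/eqP; rewrite -memv_ker -gE memv_img ?memvf.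
have [|c [ch tc rc]] := Wlift R1 0 g (@modhom0 _ _ _ _) gh.
  by move=> x; rewrite zero_lfunE linear0 qg.
have ct : short_exact c t.
  split=> //.
  - apply: lker0I => x cx; apply/(proj2 (lker0E g) g0).
    by rewrite -rc cx !linear0.
  - apply/vspaceP => w; rewrite memv_ker; apply/memv_imgP/eqP => [[x _ ->]|tw].
      by rewrite tc zero_lfunE.
    have : r w \in limg g by rewrite gE memv_ker -tE tw linear0.
    case/memv_imgP => x _ rw; exists x; first exact: memvf.
    apply/eqP; rewrite -subr_eq0; apply/eqP/tr0; rewrite linearB /=.
      by rewrite tc tw zero_lfunE subrr.
    by rewrite rc rw subrr.
  apply/surjP => e; have /surjP/(_ (p e))[x xe] := qs.
  by have [w [wt _]] := trs e x (esym xe); exists w.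
have := hdim_ses_split M (ext1_zero_projective R0p) jr.
rewrite (hdim_ses_split M (ext1_zero_projective P0p) ct) => dE.
have := congr1 (fun k => k%:R : rat) dE; rewrite !natrD /euler => e.
by apply/eqP; rewrite subr_eq addrAC -subr_eq opprK e addrC.
Qed.

Lemma resolution_iso X Y P1 P0 : iso X Y -> resolution X P1 P0 -> resolution Y P1 P0.
Proof.
case/iso_bij => h [hh h0 hs] [P1p P0p [f [p [fh ph f0 fE ps]]]].
split=> //; exists f, (h \o p)%VF; split=> //; first exact: modhom_comp.
  rewrite fE; apply/vspaceP => x; rewrite !memv_ker comp_lfunE.
  by apply/eqP/eqP => [->|]; [apply: linear0|rewrite -(linear0 h) => /(proj2 (lker0E h) h0)].
exact: surj_comp.
Qed.

Lemma resolution_msum X Y P1 P0 R1 R0 :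
  resolution X P1 P0 -> resolution Y R1 R0 ->
  resolution (msum X Y) (msum P1 R1) (msum P0 R0).
Proof.
case=> P1p P0p [f [p [fh ph f0 fE ps]]] [R1p R0p [g [q [gh qh g0 gE qs]]]].
have [h hh hE] := hom_msum (modhom_comp fh (@mfst_hom _ _ P1 R1))
  (modhom_comp gh (@msnd_hom _ _ P1 R1)).
have [r rh rE] := hom_msum (modhom_comp ph (@mfst_hom _ _ P0 R0))
  (modhom_comp qh (@msnd_hom _ _ P0 R0)).
split; [exact: projective_msum|exact: projective_msum|exists h, r; split=> //].
- apply: lker0I => -[x y]; rewrite hE !comp_lfunE mfstE msndE /= => -[fx gy].
  congr (_, _); [apply/(proj2 (lker0E f) f0)|apply/(proj2 (lker0E g) g0)];
  by rewrite linear0.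
- apply/vspaceP => -[x y]; rewrite memv_ker rE !comp_lfunE mfstE msndE /=.
  apply/memv_imgP/eqP => [[[a b] _]|[px qy]].
    rewrite hE !comp_lfunE mfstE msndE /= => -[-> ->]; congr (_, _); apply/eqP.
      by rewrite -memv_ker -fE memv_img ?memvf.
    by rewrite -memv_ker -gE memv_img ?memvf.
  have : x \in limg f by rewrite fE memv_ker px.
  have : y \in limg g by rewrite gE memv_ker qy.
  case/memv_imgP => b _ -> /memv_imgP[a _ ->]; exists (a, b); first exact: memvf.
  by rewrite hE !comp_lfunE mfstE msndE.
apply/surjP => -[x y]; have /surjP/(_ x)[a <-] := ps; have /surjP/(_ y)[b <-] := qs.
by exists (a, b); rewrite rE !comp_lfunE mfstE msndE.
Qed.

Lemma euler_msum X Y P1 P0 R1 R0 M : resolution X P1 P0 -> resolution Y R1 R0 ->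
  euler (msum P1 R1) (msum P0 R0) M = euler P1 P0 M + euler R1 R0 M.
Proof.
move=> [_ _ _] [R1p R0p _]; rewrite /euler.
rewrite (hdim_ses_split M (ext1_zero_projective R1p) (split_exact R1 P1)).
rewrite (hdim_ses_split M (ext1_zero_projective R0p) (split_exact R0 P0)).
by rewrite !natrD; ring.
Qed.

Lemma resolution_zero X : zero_module X -> resolution X X X.
Proof.
move=> X0; split; try exact: projective_zero.
have x0 := proj1 (mod_eq0 X) X0.
exists \1%VF, \1%VF; split; try exact: modhom_id.
- by apply: lker0I => x _; apply: x0.
- by apply/vspaceP => x; rewrite (x0 x) !mem0v.
- by apply/surjP => x; exists x; rewrite id_lfunE.
Qed.

End HomDimension.
(** * Simple modules and composition factors *)

Section Simples.
Variables (K : fieldType) (A : fdAlgType K).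
Implicit Types X Y Z W T P L E D M S : fdmod A.

Lemma simple_surj S X (g : 'Hom(X, S)) : simple S -> modhom g -> g <> 0 -> surj g.
Proof.
move=> [S0 Ssub] gh g0; have [|//] := Ssub _ (submodule_img gh (@submodule_full _ _ X)).
move=> gz; case: g0; apply/lfunP => x; rewrite zero_lfunE; apply/eqP.
by rewrite -memv0 -gz memv_img ?memvf.
Qed.

Lemma simple_inj S X (g : 'Hom(S, X)) : simple S -> modhom g -> g <> 0 -> lker g = 0%VS.
Proof.
move=> [S0 Ssub] gh g0; have [//|gz] := Ssub _ (submodule_ker gh).
case: g0; apply/lfunP => x; rewrite zero_lfunE; apply/eqP.
by rewrite -memv_ker gz memvf.
Qed.

Lemma simple_iso S S' (g : 'Hom(S, S')) :
  simple S -> simple S' -> modhom g -> g <> 0 -> iso S S'.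
Proof.
by move=> Ss Ss' gh g0; apply: (iso_intro gh); [apply: simple_inj|apply: simple_surj].
Qed.

(** A simple quotient of the projective cover of S is S itself, because the
    kernel of a map onto it cannot be sent onto S. *)
Lemma simple_projective_cover S : simple S -> exists P,
  [/\ projective P, ~ hom_zero P S
    & forall S', simple S' -> ~ hom_zero P S' -> iso S S'].
Proof.
move=> Ss; have [P [p [Pp ph ps psup]]] := projective_cover S.
have p0 : p <> 0.
  move=> p0; case: (Ss) => S0 _; apply/S0/mod_eq0 => x; have /surjP/(_ x)[y <-] := ps.
  by rewrite p0 zero_lfunE.
exists P; split=> // [/(_ p ph) //|S' Ss' PS'].
have [g [gh g0]] : exists g : 'Hom(P, S'), modhom g /\ g <> 0.
  apply: NNPP => ng; apply: PS' => g gh; apply: NNPP => g0.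
  by apply: ng; exists g.
have gs := simple_surj Ss' gh g0.
have [_ Ssub] := Ss.
have gk x : g x = 0 -> p x = 0.
  have [pz gx|pf] := Ssub _ (submodule_img ph (submodule_ker gh)).
    by apply/eqP; rewrite -memv0 -pz memv_img ?memv_ker ?gx.
  have gz : lker g = fullv.
    apply: psup; first exact: submodule_ker.
    apply/vspaceP => y; rewrite memvf.
    have : p y \in (p @: lker g)%VS by rewrite pf memvf.
    case/memv_imgP => z zg yz; rewrite -(subrK z y) addrC; apply: memv_add => //.
    by rewrite memv_ker linearB /= yz subrr.
  case: g0; apply/lfunP => y; rewrite zero_lfunE; apply/eqP.
  by rewrite -memv_ker gz memvf.
have [h hh hE] := factor_surj gh gs ph gk.
apply: iso_sym; apply: (simple_iso Ss' Ss hh) => h0; case: p0; apply/lfunP => x.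
by rewrite -hE h0 !zero_lfunE.
Qed.

Lemma simple_submodule X : ~ zero_module X ->
  exists S (i : 'Hom(S, X)), [/\ simple S, modhom i & lker i = 0%VS].
Proof.
move=> X0; have [|_ [U [US U0 ->]] dmin] := @nat_min (fun d => exists U : {vspace X},
    [/\ submodule U, U <> 0%VS & d = \dim U]).
  exists (\dim {:X}), fullv; split=> //; first exact: submodule_full.
  by move=> X00; apply: X0; rewrite /zero_module X00 dimv0.
have [S [i [ih i0 iU]]] := sub_exists US.
exists S, i; split=> //; split=> [S0|V VS].
  by apply: U0; rewrite -iU; apply/eqP; rewrite -dimv_eq0 inj_dim // S0.
have [|V0] := classic (V = 0%VS); [by left|right].
have le : (\dim U <= \dim (i @: V)%VS)%N.
  apply: dmin; exists (i @: V)%VS; split=> //; first exact: submodule_img.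
  move=> iV; apply: V0; apply/eqP; rewrite -subv0 -(limg_ker0 _ _ (introT eqP i0)).
  by rewrite iV sub0v.
apply/eqP; rewrite eqEdim subvf /= -(inj_dim i0) iU (leq_trans le) //.
by rewrite limg_dim_eq // i0 capv0.
Qed.

Lemma hdim_iso_projective P X Y : projective P -> iso X Y -> hdim P X = hdim P Y.
Proof.
move=> Pp /iso_bij[h [hh h0 hs]].
have ip : short_exact (0 : 'Hom(mzero A, X)) h.
  split=> //; first exact: modhom0.
    by apply: lker0I => x _; apply: thinmx0.
  rewrite h0; apply/eqP; rewrite -subv0; apply/subvP => _ /memv_imgP[x _ ->].
  by rewrite zero_lfunE mem0v.
rewrite (hdim_ses_projective Pp ip) hdim_zero //.
by rewrite /zero_module dimvf.
Qed.

(** Peel off a simple submodule and use induction on the dimension; the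
    coefficients are the multiplicities of the composition factors of M. *)
Lemma composition_multiplicities n (s : 'I_n -> fdmod A) : representatives (@simple K A) s ->
  forall M, exists c : 'I_n -> rat, forall P, projective P ->
    (hdim P M)%:R = \sum_k c k * (hdim P (s k))%:R.
Proof.
move=> [_ _ sall] M; move dM: (\dim {:M}) => d; elim/ltn_ind: d M dM => d IH M dM.
have [M0|M0] := classic (zero_module M).
  exists (fun=> 0) => P _; rewrite hdim_zero // big1 // => k _.
  by rewrite mul0r.
have [S [i [Ss ih i0]]] := simple_submodule M0.
have [N [p [ph ps pk]]] := quot_exists (submodule_img ih (@submodule_full _ _ S)).
have dE := limg_ker_dim p fullv; rewrite capfv pk inj_dim // ps dM in dE.
have [|c cE] := IH (\dim {:N}) _ N erefl.
  by case: Ss => S0 _; move: S0 dE; rewrite /zero_module; lia.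
have [j Sj] := sall _ Ss.
exists (fun k => c k + (k == j)%:R) => P Pp.
have ip : short_exact i p by [].
rewrite (hdim_ses_projective Pp ip) natrD cE // addrC.
rewrite (hdim_iso_projective Pp Sj) -[X in _ + X = _]mul1r.
under [RHS]eq_bigr => k _ do rewrite mulrDl.
rewrite big_split /=; congr (_ + _); rewrite (bigD1 j) //= eqxx.
by rewrite big1 ?addr0 // => k /negPf ->; rewrite mul0r.
Qed.

End Simples.
(** * Counting indecomposable Ext-projective modules *)

Lemma diagonal_factor n m (B : 'M[rat]_(n, m)) (E : 'M[rat]_(m, n)) :
    (forall i, (B *m E) i i != 0) -> (forall i j, i != j -> (B *m E) i j = 0) ->
  (n <= m)%N.
Proof.
move=> d0 dij; have -> : n = \rank (B *m E); last first.
  exact: leq_trans (mxrankM_maxl B E) (rank_leq_col B).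
apply/esym/mxrank_unit; rewrite unitmxE.
have -> : B *m E = diag_mx (\row_i (B *m E) i i).
  apply/matrixP => i j; rewrite [RHS]mxE [X in X *+ _]mxE; case: eqVneq => [->|ij] //=.
  by rewrite dij.
rewrite det_diag unitfE prodf_seq_neq0; apply/allP => i _ /=.
by rewrite mxE.
Qed.

Section LocalSums.
Variables (K : fieldType) (A : fdAlgType K).
Implicit Types X Y Z W T P L E D M S : fdmod A.

(** If c = a + b is invertible, then c^-1 a + c^-1 b = 1. *)
Lemma indec_local_sum X (a b : 'End(X)) : indecomposable X ->
    @modhom K A X X a -> @modhom K A X X b -> lker (a + b) = 0%VS ->
  lker a = 0%VS \/ lker b = 0%VS.
Proof.
move=> Xi ah bh c0; have ch := modhomD ah bh.
have cs := @inj_surj _ _ X X _ c0 erefl.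
pose e := ((a + b)^-1)%VF.
have eK y : e ((a + b) y) = y by rewrite /e lker0_lfunK // c0.
have Ke y : (a + b) (e y) = y by rewrite /e limg_lfunVK // cs memvf.
have eh : @modhom K A X X e by move=> r y; rewrite -{1}(Ke y) -ch eK.
have [|x||] := @indec_local _ _ X (e \o a)%VF (e \o b)%VF Xi.
- exact: modhom_comp.
- by rewrite !comp_lfunE -linearD /= -add_lfunE eK.
- by move=> ea; left; apply: (@inj_compr _ _ X X X) ea.
- by move=> eb; right; apply: (@inj_compr _ _ X X X) eb.
Qed.

Lemma indec_sum X n (e : 'I_n -> 'End(X)) : indecomposable X ->
    (forall i, @modhom K A X X (e i)) -> lker (\sum_i e i) = 0%VS ->
  exists i, lker (e i) = 0%VS.
Proof.
move=> Xi eh e0; apply: NNPP => ne.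
suff [_] : @modhom K A X X (\sum_i e i) /\ lker (\sum_i e i) <> 0%VS by [].
elim/big_ind: _ => [|a b [ah a0] [bh b0]|i _].
- split; first exact: modhom0.
  move=> z0; case: Xi => X0 _; apply/X0/mod_eq0 => x; apply/(proj2 (lker0E _) z0).
  by rewrite !zero_lfunE.
- split; first exact: modhomD.
  by case/(indec_local_sum Xi ah bh).
by split=> // ei; apply: ne; exists i.
Qed.

(** This is the exact sequence Hom(X, Z) -> Hom(X, Y) -> Ext^1(X, M) -> Ext^1(X, Z). *)
Lemma ext1_zero_kernel X M Z Y (w : 'Hom(M, Z)) (r : 'Hom(Z, Y)) :
    short_exact w r -> ext1_zero X Z ->
    (forall g : 'Hom(X, Y), modhom g ->
       exists2 k : 'Hom(X, Z), modhom k & forall x, r (k x) = g x) ->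
  ext1_zero X M.
Proof.
move=> [wh rh w0 wE rs] XZ lift.
have [P [p [Pp ph ps _]]] := projective_cover X.
have [L [i [ih i0 iE]]] := sub_exists (submodule_ker ph).
have ip : short_exact i p by [].
have pi x : p (i x) = 0 by apply/eqP; rewrite -memv_ker -iE memv_img ?memvf.
apply: (factors_ext1_zero Pp ih ph ps iE) => h hh.
have [g gh gE] := ext1_zero_extend XZ ip (modhom_comp wh hh).
have [||m mh mE] := @factor_surj _ _ P X Y p (r \o g)%VF ph ps.
- exact: modhom_comp.
- move=> x /eqP; rewrite -memv_ker -iE => /memv_imgP[y _ ->].
  by rewrite comp_lfunE gE comp_lfunE; apply/eqP; rewrite -memv_ker -wE memv_img ?memvf.
have [k kh kE] := lift _ mh.
have [||g' gh' gE'] := @lift_thru _ _ M Z P w (g - (k \o p)%VF) wh w0.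
- by apply: modhomB => //; apply: modhom_comp.
- move=> x; rewrite wE memv_ker add_lfunE opp_lfunE linearB /= comp_lfunE kE mE.
  by rewrite comp_lfunE subrr.
exists g' => // x; apply/(proj2 (lker0E w) w0).
by rewrite gE' add_lfunE opp_lfunE gE !comp_lfunE pi linear0 subr0.
Qed.

End LocalSums.

Section Counting.
Variables (K : fieldType) (A : fdAlgType K).
Implicit Types X Y Z W T P L E D M S : fdmod A.
Variable C : fdmod A -> Prop.
Hypothesis Ctc : torsion_closed C.
Hypothesis Cpre : forall X, exists D (f : 'Hom(X, D)), preenvelope C f.
Variables (D0 : fdmod A) (j0 : 'Hom(mreg A, D0)).
Hypotheses (CD0 : C D0) (j0h : modhom j0) (j00 : lker j0 = 0%VS).
Variables (m : nat) (s : 'I_m -> fdmod A).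
Hypothesis sP : representatives (fun Y => indecomposable Y /\ ext_projective C Y) s.

Let si i : indecomposable (s i). Proof. by case: sP => + _ _ => /(_ i)[]. Qed.
Let sep i : ext_projective C (s i). Proof. by case: sP => + _ _ => /(_ i)[]. Qed.
Let sC i : C (s i). Proof. by case: (sep i). Qed.
Let sext i Y : C Y -> ext1_zero (s i) Y. Proof. by case: (sep i) => _; apply. Qed.

(** As A embeds in a module of C, the maps from a projective module to the
    modules of C separate elements. *)
Lemma projective_separated P (x : P) : projective P ->
  (forall Y (g : 'Hom(P, Y)), C Y -> modhom g -> g x = 0) -> x = 0.
Proof.
move=> Pp gx; have [n [phi [z [phih zE]]]] := dual_basis Pp.
rewrite (zE x) big1 // => i _.
have -> : phi i x = 0.
  apply/(proj2 (lker0E j0) j00); rewrite linear0 -comp_lfunE.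
  by apply: gx => //; apply: modhom_comp.
exact: act0l.
Qed.

(** Let P1 -f-> P0 -> X be a minimal presentation.  The maps from P1 to modules of
    C factor through f and separate the elements of P1, so f is injective. *)
Lemma resolution_exists X : ext_projective C X -> exists P1 P0, resolution X P1 P0.
Proof.
move=> [CX Xext]; have [P1 [P0 [f [p fp]]]] := min_presentation_exists X.
have [[P1p P0p fh ph] ps fE _ _] := fp.
exists P1, P0; split=> //; exists f, p; split=> //.
apply: lker0I => x fx; apply: (projective_separated P1p) => Y g CY gh.
have [|k kh kE] := ext1_zero_factors fp _ gh.
  by move=> Z q qh qs; apply: Xext; apply: tc_quot qs CY.
by rewrite -kE fx linear0.
Qed.

Variables (Q1 Q0 : 'I_m -> fdmod A).
Hypothesis QP : forall i, resolution (s i) (Q1 i) (Q0 i).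

Let chi i M := euler (Q1 i) (Q0 i) M.

Lemma ext_projective_euler X : ext_projective C X -> exists c : 'I_m -> rat,
  exists P1 P0, resolution X P1 P0 /\ forall M, euler P1 P0 M = \sum_i c i * chi i M.
Proof.
move: X; apply: decomposition_ind.
- move=> X Y XY IH Yep; have [|c [P1 [P0 [PX cE]]]] := IH.
    exact: ext_projective_iso (iso_sym XY) Yep.
  by exists c, P1, P0; split=> //; apply: resolution_iso PX.
- move=> X X0 _; exists (fun=> 0), X, X; split; first exact: resolution_zero.
  by move=> M; rewrite big1 => [|i _]; rewrite ?mul0r // /euler subrr.
- move=> X Xi Xep; have [_ _ /(_ X (conj Xi Xep))[j Xj]] := sP.
  exists (fun i => (i == j)%:R), (Q1 j), (Q0 j); split.
    exact: resolution_iso (iso_sym Xj) (QP j).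
  move=> M; rewrite (bigD1 j) //= eqxx mul1r big1 ?addr0 // => i /negPf ->.
  by rewrite mul0r.
move=> X Y IHX IHY XYep.
have [c [P1 [P0 [PX cE]]]] := IHX (ext_projective_retract Ctc (retract_msuml X Y) XYep).
have [d [R1 [R0 [RY dE]]]] := IHY (ext_projective_retract Ctc (retract_msumr X Y) XYep).
exists (fun i => c i + d i), (msum P1 R1), (msum P0 R0); split.
  exact: resolution_msum.
move=> M; rewrite (euler_msum M PX RY) cE dE -big_split /=.
by apply: eq_bigr => i _; rewrite mulrDl.
Qed.

(** Let 0 -> P -> D -> D1 -> 0 be the sequence of a minimal preenvelope and
    0 -> P1 -> P0 -> D -> 0 a resolution.  The kernel W of P0 -> D1 is an extension
    of P by P1, so chi_D1 = chi_D - dim Hom(P, -) by Schanuel's lemma. *)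
Lemma projective_euler P : projective P -> exists c : 'I_m -> rat,
  forall M, (hdim P M)%:R = \sum_i c i * chi i M.
Proof.
move=> Pp.
have [D [D1 [f [g [fP [gh gs gk] Dep D1ep]]]]] := approximation_sequence Ctc Cpre Pp.
have [CD fh _] := fP.
have f0 : lker f = 0%VS.
  apply: lker0I => x fx; apply: (projective_separated Pp) => Y h CY hh.
  by have [k kh kE] := preenvelope_lift fP CY hh; rewrite -kE fx linear0.
have [c [P1 [P0 [PD cE]]]] := ext_projective_euler Dep.
have [d [R1 [R0 [RD1 dE]]]] := ext_projective_euler D1ep.
have [P1p P0p [a [p ap]]] := PD; have [ah ph a0 aE ps] := ap.
have [W [j [r [t [jr th tE [tr0 trs] _]]]]] := pullback ap fh.
have Wres : resolution D1 W P0.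
  split=> //; first exact: projective_extension jr.
  exists t, (g \o p)%VF; split=> //.
  - exact: modhom_comp.
  - apply: lker0I => w tw; apply: tr0 => //.
    by apply/(proj2 (lker0E f) f0); rewrite -tE tw !linear0.
  - apply/vspaceP => x; rewrite memv_ker comp_lfunE -memv_ker gk.
    apply/memv_imgP/memv_imgP => [[w _ ->]|[y _ py]].
      by exists (r w); rewrite ?memvf.
    by have [w [wt _]] := trs x y py; exists w; rewrite ?memvf.
  exact: surj_comp.
exists (fun i => c i - d i) => M.
under eq_bigr => i _ do rewrite mulrBl.
rewrite sumrB -cE -dE -(euler_unique M Wres RD1) /euler.
rewrite (hdim_ses_split M (ext1_zero_projective Pp) jr) natrD.
by ring.
Qed.

(** The diagonal matrix of the dim Hom(P k, t l), for the projective covers P k of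
    the t k, factors through a space of dimension m. *)
Lemma simples_le n (t : 'I_n -> fdmod A) :
  (forall k, simple (t k)) -> nonisos t -> (n <= m)%N.
Proof.
move=> ts tn.
have [P PP] := fin_all_exists (fun k => simple_projective_cover (ts k)).
have /fin_all_exists[c cE] : forall k, exists c : 'I_m -> rat,
    forall M, (hdim (P k) M)%:R = \sum_i c i * chi i M.
  by move=> k; apply: projective_euler; case: (PP k).
pose B : 'M[rat]_(n, m) := \matrix_(k, i) c k i.
pose E : 'M[rat]_(m, n) := \matrix_(i, k) chi i (t k).
have BE k l : (B *m E) k l = (hdim (P k) (t l))%:R.
  by rewrite mxE cE; apply: eq_bigr => i _; rewrite !mxE.
apply: (@diagonal_factor _ _ B E) => [k|k l kl]; rewrite BE.
  rewrite Num.Theory.pnatr_eq0; apply/eqP => /hdim0P.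
  by case: (PP k).
have [_ _ Pt] := PP k.
have [|h0] := classic (hom_zero (P k) (t l)); first by move/hdim0P => ->.
by case/eqP: kl; apply/tn/Pt.
Qed.

(** Let r : U -> s j approximate the maps from the direct sum T of the s i to
    s j that are not split epimorphisms; U consists of copies of T.  All maps
    s i -> s j lift along r when i differs from j, but the identity of s j does not.
    If r is not onto, its cokernel M lies in C, and chi i M = dim Hom(s i, M)
    vanishes for i different from j.  If r is onto, let M be the kernel of r modulo its
    largest submodule in C; then Hom(s i, M) = 0, and Ext^1(s i, M) is the
    obstruction to lifting maps s i -> s j along r. *)
Lemma dual_module j : exists M, chi j M != 0 /\ forall i, i != j -> chi i M = 0.
Proof.
have [f [p [fh ph pf pf0 fp]]] := biprod_msums s.
set T := msums s in f p fh ph pf pf0 fp.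
have CT : C T by apply: tc_msums.
pose nonsplit (h : 'Hom(T, s j)) := modhom h /\
  forall t : 'Hom(s j, T), modhom t -> lker (h \o t)%VF <> 0%VS.
have [|k h1 h2 [h1h h1n] [h2h h2n]|N [h [hn hs]]] := @hom_span _ _ T (s j) nonsplit.
- split=> [|t th]; first exact: modhom0.
  rewrite comp_lfun0l => z0; have [s0 _] := si j; apply/s0/mod_eq0 => x.
  by apply/(proj2 (lker0E _) z0); rewrite !zero_lfunE.
- split=> [|t th]; first exact: modhomP.
  rewrite comp_lfunDl => /(indec_local_sum (si j)).
  case; [|exact: modhom_comp| |exact: h2n].
    by apply: modhom_comp => //; apply: modhomZ.
  rewrite -comp_lfunZl => /lker0E kt; apply: (h1n t th); apply: lker0I => x h1x.
  by apply: kt; rewrite !scale_lfunE h1x !linear0 ?scaler0.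
have hh i : modhom (h i) by case: (hn i).
pose U := power T N; have [a [b [ah bh ba ba0 ab]]] := biprod_msums (fun _ : 'I_N => T).
rewrite -/(power T N) -/U in a b ah bh ba ba0 ab.
pose r : 'Hom(U, s j) := (\sum_k (h k \o b k))%VF.
have rh : modhom r by apply: modhom_sum => k; apply: modhom_comp.
have CU : C U by apply: tc_msums.
have r_lift i (g : 'Hom(s i, s j)) : i != j -> modhom g ->
    exists2 k : 'Hom(s i, U), modhom k & forall x, r (k x) = g x.
  move=> ij gh; have /hs[c cE] : nonsplit (g \o p i)%VF.
    split=> [|t th gt]; first exact: modhom_comp.
    have ji : iso (s j) (s i).
      apply: indec_retract_indec => //.
      apply: (@retract_of_inj _ _ _ _ (p i \o t)%VF g) => //; first exact: modhom_comp.
      by rewrite comp_lfunA.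
    by case: sP => _ /(_ _ _ ji) ji' _; case/eqP: ij.
  exists (\sum_k c k *: (a k \o f i)%VF).
    by apply: modhom_sum => k; apply/modhomZ/modhom_comp.
  move=> x; have := congr1 (fun h' : 'Hom(T, s j) => h' (f i x)) cE.
  rewrite comp_lfunE pf => ->; rewrite !sum_lfunE; apply: eq_bigr => k _.
  rewrite comp_lfunE linear_sum (bigD1 k) //= !scale_lfunE comp_lfunE linearZ /= ba.
  rewrite big1 ?addr0 ?linearZ // => l lk.
  by rewrite scale_lfunE comp_lfunE linearZ /= ba0 ?scaler0 // eq_sym.
have r_nosec (l : 'Hom(s j, U)) : modhom l -> ~ forall x, r (l x) = x.
  move=> lh rl; have [|||k] := @indec_sum _ _ (s j) N (fun k => h k \o (b k \o l))%VF.
  - exact: si.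
  - by move=> k; do 2 apply: modhom_comp => //.
  - apply: lker0I => x; rewrite sum_lfunE => sx; rewrite -(rl x) sum_lfunE; apply: etrans sx.
    by apply: eq_bigr => k _; rewrite !comp_lfunE.
  by have [_] := hn k; apply; apply: modhom_comp.
(* first case: M is the cokernel of r *)
have [rs|rns] := classic (surj r); last first.
  have [M [q [qh qs qk]]] := quot_exists (submodule_img rh (@submodule_full _ _ U)).
  have CM : C M by apply: tc_quot qs (sC j).
  have chiM i : chi i M = (hdim (s i) M)%:R.
    by apply: euler_ext1_zero => //; apply: sext.
  exists M; split=> [|i ij]; rewrite chiM.
    rewrite Num.Theory.pnatr_eq0; apply/eqP => /hdim0P/(_ q qh) q0; apply: rns.
    by rewrite /surj -qk; apply/vspaceP => x; rewrite memvf memv_ker q0 zero_lfunE eqxx.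
  apply/eqP; rewrite Num.Theory.pnatr_eq0; apply/eqP/hdim0P => g gh.
  have [I [v [vh v0 vE]]] := sub_exists (submodule_img rh (@submodule_full _ _ U)).
  have CI : C I.
    have [|r' r'h r'E] := lift_thru vh v0 rh; first by move=> x; rewrite vE memv_img ?memvf.
    apply: (tc_quot Ctc r'h) => //; apply/surjP => x.
    have : v x \in limg r by rewrite -vE memv_img ?memvf.
    by case/memv_imgP => y _; rewrite -r'E => /(proj2 (lker0E v) v0) ->; exists y.
  have vq : short_exact v q by split=> //; rewrite vE qk.
  have [l lh lE] := ext1_zero_lift (@sext i _ CI) vq gh.
  have [k kh kE] := r_lift i l ij lh.
  apply/lfunP => x; rewrite zero_lfunE -lE -kE; apply/eqP.
  by rewrite -memv_ker qk memv_img ?memvf.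
(* second case: Z is U modulo the largest submodule in C of the kernel of r *)
have [Y [i0 [Z [q [iq iker CY q0]]]]] := torsion_submodule Ctc (submodule_ker rh).
have [ih qh ii iE qs] := iq.
have CZ : C Z by apply: tc_quot qs CU.
have [|r' r'h r'E] := factor_surj qh qs rh.
  by move=> x /eqP; rewrite -memv_ker -iE => /(subvP iker); rewrite memv_ker => /eqP.
have r's : surj r'.
  by apply/surjP => x; have /surjP/(_ x)[y <-] := rs; exists (q y); rewrite r'E.
have [M [w [wh w0 wE]]] := sub_exists (submodule_ker r'h).
have wr : short_exact w r' by [].
have CM0 X : C X -> hom_zero X M.
  move=> CX g gh; have wg : (w \o g)%VF = 0.
    apply: (q0 X) => //; first exact: modhom_comp.
    apply/subvP => _ /memv_imgP[x _ ->]; have /surjP/(_ ((w \o g)%VF x))[u uE] := qs.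
    rewrite -uE memv_img // memv_ker -r'E uE comp_lfunE -memv_ker -wE.
    by rewrite memv_img ?memvf.
  apply/lfunP => x; apply/(proj2 (lker0E w) w0).
  by rewrite -comp_lfunE wg !zero_lfunE linear0.
exists M; split=> [|i ij].
  apply: (euler_ext1_nonzero (QP j)); last exact: CM0.
  move=> sM.
  have [l lh lE] := proj1 (ext1_zero_section _ _) sM _ _ _ wr.
  have [l' lh' lE'] := ext1_zero_lift (@sext j _ CY) iq lh.
  by apply: (r_nosec l' lh') => x; rewrite -r'E lE' lE.
rewrite /chi (euler_ext1_zero (QP i)); last first.
  apply: ext1_zero_kernel wr (@sext i _ CZ) _ => g gh.
  have [k kh kE] := r_lift i g ij gh.
  exists (q \o k)%VF; first exact: modhom_comp.
  by move=> x; rewrite comp_lfunE r'E kE.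
by rewrite (proj2 (hdim0P _ _)) //; apply: CM0.
Qed.

(** The diagonal matrix of the chi i (M j) factors through a space of dimension
    n, since chi i (M j) is determined by the composition factors of M j. *)
Lemma ext_projectives_le n (t : 'I_n -> fdmod A) :
  representatives (@simple K A) t -> (m <= n)%N.
Proof.
move=> tP; have [M MP] := fin_all_exists dual_module.
have [c cE] := fin_all_exists (fun j => composition_multiplicities tP (M j)).
pose B : 'M[rat]_(m, n) := \matrix_(j, k) c j k.
pose E : 'M[rat]_(n, m) := \matrix_(k, i) chi i (t k).
have BE j i : (B *m E) j i = chi i (M j).
  have [Q1p Q0p _] := QP i.
  rewrite mxE /chi /euler !cE // -sumrB; apply: eq_bigr => k _.
  by rewrite !mxE /chi /euler mulrBr.
apply: (@diagonal_factor _ _ B E) => [j|j i ji]; rewrite BE.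
  by have [] := MP j.
by have [_] := MP j; apply; rewrite eq_sym.
Qed.

End Counting.

Lemma num_simples_faithful (K : fieldType) (A : fdAlgType K) (C : fdmod A -> Prop)
    (D : fdmod A) (j : 'Hom(mreg A, D)) m (s : 'I_m -> fdmod A) :
    torsion_closed C ->
    (forall X : fdmod A, exists (E : fdmod A) (f : 'Hom(X, E)), preenvelope C f) ->
    C D -> modhom j -> lker j = 0%VS ->
    representatives (fun Y => indecomposable Y /\ ext_projective C Y) s ->
  num_simples A m.
Proof.
move=> Ctc Cpre CD jh j0 sP.
have sres i : exists P1 P0, resolution (s i) P1 P0.
  apply: (resolution_exists Ctc CD jh j0).
  by case: sP => + _ _ => /(_ i)[].
have [Q1 Q1P] := fin_all_exists sres; have [Q0 QP] := fin_all_exists Q1P.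
have [|n nm ns] := @num_classes_bounded _ A (@simple K A) m.
  by move=> n t ts tn; apply: (simples_le Ctc Cpre CD jh j0 sP QP ts tn).
suff -> : m = n by [].
apply/eqP; rewrite eqn_leq nm andbT; have [t tP] := ns.
exact: (ext_projectives_le Ctc sP QP tP).
Qed.
(** * Modules over quotient algebras *)

Lemma eq_representatives (K : fieldType) (B : fdAlgType K)
    (C C' : fdmod B -> Prop) n (s : 'I_n -> fdmod B) :
  (forall X : fdmod B, C X <-> C' X) -> representatives C s -> representatives C' s.
Proof.
by move=> CC' [sC sn sall]; split=> // [i|X /CC'/sall //]; apply/CC'.
Qed.

Section Quotients.
Variables (K : fieldType) (A : fdAlgType K).
Implicit Types X Y Z T P L E D S : fdmod A.
Implicit Type C : fdmod A -> Prop.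

Definition killed (I : ideal A) X : Prop :=
  forall a (x : X), a \in (I : {vspace A}) -> act a x = 0.

Lemma killed_surj I X Z (p : 'Hom(X, Z)) : modhom p -> surj p -> killed I X -> killed I Z.
Proof. by move=> ph /surjP ps kX a z aI; have [x <-] := ps z; rewrite -ph kX ?linear0. Qed.

Lemma killed_iso I X Y : iso X Y -> killed I X -> killed I Y.
Proof. by case/iso_bij => f [fh _ fs]; apply: killed_surj fs. Qed.

Lemma killed_retract I X Y : retract Y X -> killed I X -> killed I Y.
Proof.
by case=> v [u [_ uh uv]]; apply: killed_surj uh _; apply/surjP => y; exists (v y).
Qed.

Lemma killed_principal e X : killed (principal_ideal e) X <-> forall x : X, act e x = 0.
Proof.
split=> [kX x|eX a x]; first by apply: kX; have := mem_AeA e 1 1; rewrite mul1r mulr1.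
rewrite /= => /(@coord_span _ _ _ (in_tuple _)) ->.
have lX : linear (fun b : A => act b x) by apply: act_linearl.
rewrite -(mklfunE lX) linear_sum big1 // => i _ /=; rewrite linearZ /= mklfunE.
have := mem_nth 0 (ltn_ord i); rewrite /=.
by case/allpairsP => -[c d] /= [_ _ ->]; rewrite !actM eX linear0 scaler0.
Qed.

Variable I : ideal A.
Implicit Types M N : fdmod (quot_alg I).

Lemma infl_killed N : killed I (inflation N).
Proof.
move=> a x aI; rewrite /act /= /infl_act (_ : quot_pi I a = 0) ?act0l //.
by apply/eqP; rewrite quot_map_eq0.
Qed.

(** The action of a class modulo I is that of any representative. *)
Lemma descend X : killed I X -> exists N, iso X (inflation N).
Proof.
move=> kX; have qE a x : act (quot_repr (quot_map I a)) x = act a x :> X.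
  by apply/eqP; rewrite -subr_eq0 -actBl kX ?quot_mapK.
pose h (u : quot_alg I) (x : X) := act (quot_repr u) x.
have h1 x : linear (h^~ x).
  by move=> k u v; rewrite /h linearP; apply: act_linearl.
have h2 u : linear (h u) by apply: act_linearr.
have h3 x : h 1 x = x by rewrite /h qE act1.
have h4 u v x : h (u * v) x = h u (h v x) by rewrite /h qE actM.
pose N : fdmod (quot_alg I) := FdMod h1 h2 h3 h4.
have [||f fh fE] := @mkhom _ _ X (inflation N) (fun x => x : N).
- by [].
- by move=> a x; rewrite /= [RHS]qE.
exists N; apply: (iso_intro fh).
  by apply: lker0I => x; rewrite fE.
by apply/surjP => x; exists x; rewrite fE.
Qed.

Lemma infl_hom M N (f : 'Hom(M, N)) :
  @modhom _ A (inflation M) (inflation N) f <-> modhom f.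
Proof.
split=> fh u x; last exact: fh.
rewrite -[u]quot_reprK; exact: (fh (quot_repr u) x).
Qed.

Lemma infl_submodule N (U : {vspace N}) : @submodule _ A (inflation N) U <-> submodule U.
Proof.
split=> US u x xU; last exact: US.
rewrite -[u]quot_reprK; exact: (US (quot_repr u) x xU).
Qed.

Lemma infl_iso M N : iso (inflation M) (inflation N) <-> iso M N.
Proof. by split=> -[f /infl_hom fh fb]; exists f => //; apply/infl_hom. Qed.

Lemma infl_retract M N : retract (inflation M) (inflation N) <-> retract M N.
Proof.
split=> -[v [u [vh uh uv]]]; exists v, u; split=> //; exact/infl_hom.
Qed.

Lemma infl_short_exact M N1 N (i : 'Hom(M, N1)) (p : 'Hom(N1, N)) :
  @short_exact _ A (inflation M) (inflation N1) (inflation N) i p <-> short_exact i p.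
Proof. by split=> -[ih ph i0 iE ps]; split=> //; apply/infl_hom. Qed.

Lemma infl_simple N : simple (inflation N) <-> simple N.
Proof.
split=> -[N0 Nsub]; split=> // U US; apply: Nsub; exact/infl_submodule.
Qed.

Lemma infl_biprod n (t : 'I_n -> fdmod (quot_alg I)) N :
  biprod t N -> biprod (fun i => inflation (t i)) (inflation N).
Proof.
case=> f [p [fh ph pf pf0 fp]]; exists f, p; split=> // i; exact/infl_hom.
Qed.

Lemma infl_msum M N : iso (inflation (msum M N)) (msum (inflation M) (inflation N)).
Proof.
have [||f fh fE] := @mkhom _ _ (inflation (msum M N)) (msum (inflation M) (inflation N))
  (fun x => x : M * N) => //.
apply: (iso_intro fh).
  by apply: lker0I => x; rewrite fE.
by apply/surjP => x; exists x; rewrite fE.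
Qed.

Lemma iso_msum X X' Y Y' : iso X X' -> iso Y Y' -> iso (msum X Y) (msum X' Y').
Proof.
move=> /isoP[f [f' [fh fh' fK fK']]] /isoP[g [g' [gh gh' gK gK']]].
have [h hh hE] := hom_msum (modhom_comp fh (@mfst_hom _ _ X Y))
  (modhom_comp gh (@msnd_hom _ _ X Y)).
have [k kh kE] := hom_msum (modhom_comp fh' (@mfst_hom _ _ X' Y'))
  (modhom_comp gh' (@msnd_hom _ _ X' Y')).
apply/isoP; exists h, k; split=> // -[x y].
  by rewrite kE hE !comp_lfunE !mfstE !msndE /= fK gK.
by rewrite hE kE !comp_lfunE !mfstE !msndE /= fK' gK'.
Qed.

Lemma infl_indec N : indecomposable (inflation N) <-> indecomposable N.
Proof.
split=> -[N0 Ni]; split=> //.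
  move=> M1 M2 NM; apply: (Ni (inflation M1) (inflation M2)).
  by apply: iso_trans (infl_msum M1 M2); apply/infl_iso.
move=> Y Z NYZ; have kYZ := killed_iso NYZ (@infl_killed N).
have [M1 YM] := descend (killed_retract (retract_msuml Y Z) kYZ).
have [M2 ZM] := descend (killed_retract (retract_msumr Y Z) kYZ).
have [|z1|z2] := Ni M1 M2; first last.
- by right; apply: iso_zero (iso_sym ZM) z2.
- by left; apply: iso_zero (iso_sym YM) z1.
apply/infl_iso/(iso_trans NYZ)/(iso_trans (iso_msum YM ZM)).
exact/iso_sym/infl_msum.
Qed.

Lemma infl_gen M N : gen M N -> gen (inflation M) (inflation N).
Proof.
move=> /gen_power[n [p [ph ps]]]; apply/gen_power.
have /biprodP/iso_sym/iso_bij[f [fh _ fs]] := infl_biprod (biprod_msums (fun _ : 'I_n => M)).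
pose q : 'Hom(inflation (power M n), inflation N) := p.
have qh : modhom q by apply/infl_hom.
by exists n, (q \o f)%VF; split; [apply: modhom_comp|apply: (surj_comp (g := q))].
Qed.

Lemma infl_ext1_zero M N : ext1_zero (inflation M) (inflation N) -> ext1_zero M N.
Proof.
move=> /ext1_zero_section MN; apply/ext1_zero_section => E' i p ip.
have [s sh sE] := MN (inflation E') i p (proj2 (infl_short_exact _ _) ip).
by exists s => //; apply/infl_hom.
Qed.

(** An extension over A of modules of C lies in C, hence is an extension over A/I. *)
Lemma ext1_zero_infl C M N : torsion_closed C -> (forall X, C X -> killed I X) ->
  C (inflation M) -> C (inflation N) -> ext1_zero M N -> ext1_zero (inflation M) (inflation N).
Proof.
move=> Ctc Ck CM CN MN; apply/ext1_zero_section => E i p ip.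
have [ih ph i0 iE ps] := ip; have [_ Cext _] := Ctc.
have [E' /isoP[f [g [fh gh fK gK]]]] := descend (Ck _ (Cext _ _ _ _ _ ip CN CM)).
have [|s sh sE] := proj1 (ext1_zero_section _ _) MN E' (f \o i)%VF (p \o g)%VF.
  apply/infl_short_exact; split.
  - exact: modhom_comp.
  - exact: modhom_comp.
  - by apply: lker0I => x; rewrite comp_lfunE -(linear0 f) => /(can_inj fK);
      rewrite -(linear0 i) => /(proj2 (lker0E i) i0).
  - apply/vspaceP => x; rewrite memv_ker comp_lfunE -memv_ker -iE.
    apply/memv_imgP/memv_imgP => -[y _ yE]; exists y; rewrite ?memvf //.
      by rewrite yE comp_lfunE fK.
    by rewrite comp_lfunE -yE gK.
  apply/surjP => x; have /surjP/(_ x)[y <-] := ps.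
  by exists (f y); rewrite comp_lfunE fK.
exists (g \o s)%VF.
  by apply: modhom_comp => //; apply/infl_hom.
by move=> x; rewrite comp_lfunE -[p _]comp_lfunE sE.
Qed.

Lemma infl_representatives C n (t : 'I_n -> fdmod (quot_alg I)) :
    (forall X, C X -> killed I X) -> (forall X Y, iso X Y -> C X -> C Y) ->
    representatives (fun N => C (inflation N)) t ->
  representatives C (fun i => inflation (t i)).
Proof.
move=> Ck Ciso [tC tn tall]; split=> // [i j /infl_iso/tn //|X CX].
have [N XN] := descend (Ck _ CX); have [i Ni] := tall N (Ciso _ _ XN CX).
by exists i; apply: iso_trans XN _; apply/infl_iso.
Qed.

Lemma descend_representatives C n (s : 'I_n -> fdmod A) (t : 'I_n -> fdmod (quot_alg I)) :
    (forall i, iso (s i) (inflation (t i))) -> (forall X Y, iso X Y -> C X -> C Y) ->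
    representatives C s ->
  representatives (fun N => C (inflation N)) t.
Proof.
move=> st Ciso [sC sn sall]; split=> [i|i j tij|N CN].
- exact: Ciso (st i) (sC i).
- apply: sn; apply: iso_trans (st i) _; apply: iso_trans (iso_sym (st j)).
  exact/infl_iso.
have [i Ni] := sall _ CN; exists i; apply/infl_iso.
exact: iso_trans Ni (st i).
Qed.

Lemma killed_num_classes C n :
    (forall X, C X -> killed I X) -> (forall X Y, iso X Y -> C X -> C Y) ->
  num_classes C n <-> num_classes (fun N => C (inflation N)) n.
Proof.
move=> Ck Ciso; split=> [[s sP]|[t tP]]; last first.
  by exists (fun i => inflation (t i)); apply: infl_representatives.
have [sC _ _] := sP; have [t tP] := fin_all_exists (fun i => descend (Ck _ (sC i))).
by exists t; apply: descend_representatives tP Ciso sP.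
Qed.

Lemma simple_isoP X Y : iso X Y -> simple X -> simple Y.
Proof.
case/iso_bij => f [fh f0 fs] [X0 Xsub]; split=> [Y0|V VS].
  by apply: X0; rewrite /zero_module -(inj_dim f0) fs.
have VE : (f @: (f @^-1: V))%VS = V by rewrite lpreimK // fs subvf.
have [V0|V1] := Xsub _ (submodule_pre fh VS); [left|right].
  by rewrite -VE V0 limg0.
by rewrite -VE V1.
Qed.

Lemma num_simples_quot n :
  num_simples (quot_alg I) n <-> num_classes (fun S => simple S /\ killed I S) n.
Proof.
have e (N : fdmod (quot_alg I)) : simple N <-> simple (inflation N) /\ killed I (inflation N).
  by rewrite infl_simple; split=> [Ns|[]//]; split=> //; apply: infl_killed.
rewrite killed_num_classes; [|by move=> X []|].
  by split=> -[s sP]; exists s; apply: eq_representatives sP => N; rewrite e.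
move=> X Y XY [Xs Xk]; split; [exact: simple_isoP XY Xs|exact: killed_iso XY Xk].
Qed.

End Quotients.

Section Annihilator.
Variables (K : fieldType) (A : fdAlgType K).
Implicit Types X Y Z T P L E D S : fdmod A.

Lemma ext1_zero_isor X Y Y' : iso Y Y' -> ext1_zero X Y -> ext1_zero X Y'.
Proof.
move=> /iso_bij[h [hh h0 hs]] /ext1_zero_section XY.
apply/ext1_zero_section => E i p [ih ph i0 iE ps].
apply: (XY E (i \o h)%VF p); split=> //; first exact: modhom_comp.
  exact: (inj_comp i0 h0).
by rewrite limg_comp hs.
Qed.

(** The annihilator I of C is the kernel of a C-preenvelope of A, so that A/I
    embeds into its target, a module of C. *)
Lemma num_simples_annihilator (C : fdmod A -> Prop) m (s : 'I_m -> fdmod A) :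
    torsion_closed C -> (forall X, exists D (f : 'Hom(X, D)), preenvelope C f) ->
    representatives (fun Y => indecomposable Y /\ ext_projective C Y) s ->
  exists I : ideal A,
    (forall a, a \in (I : {vspace A}) <-> forall X (x : X), C X -> act a x = 0) /\
    num_classes (fun S => simple S /\ killed I S) m.
Proof.
move=> Ctc Cpre sP; have [D [f fP]] := Cpre (mreg A); have [CD fh _] := fP.
have annP a : a \in lker f <-> forall X (x : X), C X -> act (a : A) x = 0.
  rewrite memv_ker; split=> [/eqP fa X x CX|aC].
    have [g gh gE] := reg_hom x; have [h hh hE] := preenvelope_lift fP CX gh.
    by rewrite -gE -hE fa linear0.
  apply/eqP; rewrite -[a](mulr1 (a : A)).
  by rewrite [f _](fh a (1 : A)); apply: aC.
have Iideal (a x b : A) : x \in lker f -> a * x * b \in lker f.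
  by move=> /annP xC; apply/annP => X y CX; rewrite !actM xC ?linear0.
pose I := Ideal Iideal; exists I; split=> //.
have Ck X : C X -> killed I X by move=> CX a x /annP; apply.
have Ciso X Y : iso X Y -> C X -> C Y by apply: tc_iso.
apply/num_simples_quot; pose CB (N : fdmod (quot_alg I)) := C (inflation N).
have [_ Cext Czero] := Ctc.
have CBtc : torsion_closed CB.
  split=> [X Z p ph ps CX|X Y E i p ip CY CX|].
  - by apply: (tc_quot Ctc (p := p : 'Hom(inflation X, inflation Z))) => //; apply/infl_hom.
  - move/infl_short_exact in ip.
    exact: (Cext (inflation X) (inflation Y) (inflation E) i p ip CY CX).
  - by apply: (tc_zero Ctc); apply/mod_eq0 => x; apply: thinmx0.
have CBpre (X : fdmod (quot_alg I)) :
    exists (E : fdmod (quot_alg I)) (g : 'Hom(X, E)), preenvelope CB g.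
  have [E [g gP]] := Cpre (inflation X); have [CE gh _] := gP.
  have [E' EE'] := descend (Ck _ CE); have /isoP[h [h' [hh hh' hK hK']]] := EE'.
  exists E', (h \o g)%VF; split.
  - exact: Ciso EE' CE.
  - by apply/infl_hom; apply: modhom_comp.
  move=> Y k CY /infl_hom kh; have [l lh lE] := preenvelope_lift gP CY kh.
  exists (l \o h')%VF; first by apply/infl_hom; apply: modhom_comp.
  by apply/lfunP => x; rewrite !comp_lfunE hK lE.
have [D' DD'] := descend (Ck _ CD); have /isoP[h [h' [hh hh' hK hK']]] := DD'.
pose repr := mklfun (@linearP _ _ _ _ (@quot_repr _ _ I)).
pose j : 'Hom(mreg (quot_alg I), D') := (h \o (f \o repr))%VF.
have jE u : j u = h (f (quot_repr u)) by rewrite !comp_lfunE mklfunE.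
have [sC _ _] := sP.
have [t tP] := fin_all_exists (fun i => descend (Ck _ (proj1 (proj2 (sC i))))).
have Qiso X Y : iso X Y -> indecomposable X /\ ext_projective C X ->
    indecomposable Y /\ ext_projective C Y.
  move=> XY [Xi Xep]; split; [exact: indec_iso XY Xi|exact: ext_projective_iso XY Xep].
apply: (@num_simples_faithful _ _ CB D' j m t) => //.
- exact: Ciso DD' CD.
- move=> u v; have uE z : act u (h z : D') = h (act (quot_repr u) z).
    by rewrite hh -{1}[u]quot_reprK.
  rewrite !jE uE -fh; congr (h _); apply/eqP.
  rewrite -subr_eq0 -linearB -memv_ker; exact: quot_mapK.
- apply: lker0I => u; rewrite jE -(linear0 h) => /(can_inj hK)/eqP.
  by rewrite -memv_ker -(quot_map_eq0 I) quot_reprK => /eqP.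
have tP' := descend_representatives tP Qiso sP.
apply: eq_representatives tP' => N; rewrite infl_indec.
split=> -[Ni [CN Next]]; split=> //; split=> // Y CY.
  exact/infl_ext1_zero/Next.
have [N' YN] := descend (Ck _ CY); have CN' := Ciso _ _ YN CY.
apply: (ext1_zero_isor (iso_sym YN)).
exact: (ext1_zero_infl Ctc Ck CN CN' (Next _ CN')).
Qed.

(** Take an idempotent e of J with Ae of maximal dimension.  If a simple module S
    is killed by e but not by J, some y in J with ye = 0 has a nonzero fixed
    vector in S, hence is not nilpotent.  Fitting's lemma for right
    multiplication by y yields a nonzero idempotent in Ay, and with it a nonzero
    idempotent of J orthogonal to e, contradicting maximality. *)
Lemma ideal_idempotent (J : ideal A) : exists e : A,
  [/\ e \in (J : {vspace A}), e * e = e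
    & forall S, simple S -> (forall x : S, act e x = 0) -> killed J S].
Proof.
have [||_ [e [eJ ee ->]] emax] := @nat_max (fun d => exists e : A,
    [/\ e \in (J : {vspace A}), e * e = e & d = \dim (limg (rmul e))]) (\dim {:A}).
- by exists (\dim (limg (rmul (0 : A)))), 0; rewrite mem0v mulr0.
- by move=> _ [e [_ _ ->]]; apply/dimvS/subvf.
exists e; split=> // S [S0 Ssub] eS; apply: NNPP => nJ.
have [s [a [aJ as0]]] : exists (s : S) (a : A), a \in (J : {vspace A}) /\ act a s <> 0.
  apply: NNPP => na; apply: nJ => a x aJ; apply: NNPP => ax.
  by apply: na; exists x, a.
(* J s is a nonzero submodule of S, so it contains s *)
pose r : 'Hom(A, S) := mklfun (@act_linearl _ _ _ s).
have rE b : r b = act b s by apply: mklfunE.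
have Js : submodule (r @: J)%VS.
  move=> b _ /memv_imgP[c cJ ->]; rewrite rE -actM -rE memv_img //.
  by rewrite -[b * c]mulr1 idealP.
have [x xJ xs] : exists2 x, x \in (J : {vspace A}) & act x s = s.
  have : s \in (r @: J)%VS.
    have [J0|->] := Ssub _ Js; last exact: memvf.
    by case: as0; apply/eqP; rewrite -memv0 -J0 -rE memv_img.
  by case/memv_imgP => x xJ; rewrite rE => sx; exists x.
have [y [yJ ye ys]] : exists y, [/\ y \in (J : {vspace A}), y * e = 0 & act y s = s].
  exists ((1 - e) * x * (1 - e)); split; first exact: idealP.
    by rewrite -!mulrA [(1 - e) * e]mulrBl mul1r ee subrr !mulr0.
  by rewrite !actM !actBl !act1 eS subr0 xs eS subr0.
have s0 : s <> 0 by move=> s0; apply: as0; rewrite s0 linear0.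
have yh : @modhom K A (mreg A) (mreg A) (rmul y).
  by move=> b c; rewrite !rmulE; apply/esym/mulrA.
have [n [Y [v [u [[vh uh uv] iv ku]]]]] := fitting yh.
(* v u is right multiplication by the idempotent g *)
pose g : A := v (u (1 : A)).
have vuE (b : A) : v (u b) = b * g.
  by rewrite -{1}[b]mulr1 [u _](uh b (1 : A)) vh.
have gg : g * g = g by rewrite -vuE /g uv.
have lpow_mul k (b : A) : lpow (rmul y : 'End(mreg A)) k b = b * y ^+ k.
  elim: k => [|k IH] /=; first by rewrite id_lfunE expr0 mulr1.
  by rewrite comp_lfunE IH rmulE exprSr mulrA.
have yn : act (y ^+ n.+1) s = s.
  by elim: n.+1 => [|k IH]; rewrite ?expr0 ?act1 // exprS actM IH.
have [b gb] : exists b, g = b * y ^+ n.+1.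
  have : g \in limg v by rewrite memv_img ?memvf.
  by rewrite iv => /memv_imgP[b _ ->]; exists b; rewrite lpow_mul.
have gJ : g \in (J : {vspace A}).
  by rewrite gb exprSr mulrA -[_ * y]mulr1 idealP.
have ge : g * e = 0 by rewrite gb exprSr -!mulrA ye !mulr0.
have g0 : g <> 0.
  move=> g0; apply: s0; rewrite -yn.
  have : y ^+ n.+1 \in limg v.
    by rewrite iv; apply/memv_imgP; exists (1 : A); rewrite ?memvf // lpow_mul mul1r.
  case/memv_imgP => z _ ->; rewrite -(uv z) vuE g0 mulr0; exact: act0l.
have [h [hJ he eh hh h0]] : exists h,
    [/\ h \in (J : {vspace A}), h * e = 0, e * h = 0, h * h = h & h <> 0].
  have eg : e * (g - e * g) = 0 by rewrite mulrBr mulrA ee subrr.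
  have ge' : (g - e * g) * e = 0 by rewrite mulrBl ge -mulrA ge mulr0 subrr.
  exists (g - e * g); split=> //.
  - by rewrite rpredB // -[e * g]mulr1 idealP.
  - by rewrite mulrBr [_ * (e * g)]mulrA ge' mul0r subr0 mulrBl -mulrA gg.
  - by move/eqP; rewrite subr_eq0 => /eqP gE; apply: g0; rewrite -gg {2}gE mulrA ge mul0r.
have /emax le : exists e', [/\ e' \in (J : {vspace A}), e' * e' = e'
    & \dim (limg (rmul (e + h)%R)) = \dim (limg (rmul e'))].
  exists (e + h); split=> //; first by rewrite rpredD.
  by rewrite mulrDl !mulrDr ee eh he hh addr0 add0r.
have sub : (limg (rmul e) <= limg (rmul (e + h)%R))%VS.
  apply/subvP => _ /memv_imgP[c _ ->]; apply/memv_imgP; exists (c * e); first exact: memvf.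
  by rewrite !rmulE -mulrA mulrDr ee eh addr0.
have /eqP eq : limg (rmul e) == limg (rmul (e + h)%R) by rewrite eqEdim sub le.
have : h \in limg (rmul e).
  rewrite eq; apply/memv_imgP; exists h; first exact: memvf.
  by rewrite rmulE mulrDr he hh add0r.
case/memv_imgP => c _; rewrite rmulE => hE; apply: h0.
by rewrite -he {2}hE -mulrA ee -hE.
Qed.

End Annihilator.
(** * Support tau-tilting modules and functorially finite torsion classes *)

Lemma indec_summands_msums (K : fieldType) (A : fdAlgType K) n (s : 'I_n -> fdmod A) :
    (forall i, indecomposable (s i)) -> nonisos s ->
  representatives (fun Y => indecomposable Y /\ summand Y (msums s)) s.
Proof.
move=> si sn; split=> // [i|X [Xi /summandP XS]].
  by split=> //; apply/summandP/msums_retract.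
have [i Xs] := indec_retract_msums Xi XS.
by exists i; apply: indec_retract_indec.
Qed.

Section Correspondence.
Variables (K : fieldType) (A : fdAlgType K).
Implicit Types X Y Z T P D S : fdmod A.
Implicit Type C : fdmod A -> Prop.

Lemma representatives_iso C n m (s : 'I_n -> fdmod A) (t : 'I_m -> fdmod A) :
  representatives C s -> representatives C t -> iso (msums s) (msums t).
Proof.
move=> [sC sn sall] [tC tn tall].
have nm : n = m.
  apply/eqP; rewrite eqn_leq (nonisos_le sn (fun i => tall _ (sC i))).
  exact: nonisos_le tn (fun i => sall _ (tC i)).
case: _ / nm in t tC tn tall *.
have [h hP] := fin_all_exists (fun i => tall _ (sC i)).
have hi : injective h.
  by move=> i j ij; apply: sn; apply: iso_trans (hP i) _; rewrite ij; apply/iso_sym/hP.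
exact: biprod_iso (biprod_msums s) (biprod_reindex (injF_bij hi) (biprod_msums t)) hP.
Qed.

Lemma is_P_iso C X Y : iso X Y -> is_P C X -> is_P C Y.
Proof.
by move=> XY [n [s [sP Xs]]]; exists n, s; split=> //; apply: iso_trans (iso_sym XY) Xs.
Qed.

Lemma is_P_unique C X Y : is_P C X -> is_P C Y -> iso X Y.
Proof.
move=> [n [s [sP Xs]]] [m [t [tP Yt]]].
apply: (iso_trans Xs); apply: iso_trans (iso_sym Yt).
exact: representatives_iso sP tP.
Qed.

Lemma gen_iso T T' X : iso T T' -> gen T X -> gen T' X.
Proof.
move=> TT /gen_power[n [p [ph ps]]]; apply/gen_power.
have /iso_sym/iso_bij[f [fh _ fs]] := biprod_iso
  (biprod_msums (fun _ : 'I_n => T)) (biprod_msums (fun _ : 'I_n => T')) (fun _ => TT).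
by exists n, (p \o f)%VF; split; [apply: modhom_comp|apply: surj_comp].
Qed.

Lemma functorially_finite_preenvelope C : functorially_finite C ->
  forall X, exists D (f : 'Hom(X, D)), preenvelope C f.
Proof. by move=> Cff X; case: (Cff X). Qed.

Lemma tau_rigid_torsion T : tau_rigid T ->
  [/\ torsion_closed (gen T), torsion_class (gen T), functorially_finite (gen T)
    & ext_projective (gen T) T].
Proof.
move/tau_rigidP => Text; have Ttc := gen_closed Text; split=> //.
- exact: torsion_closed_class.
- move=> X; split; first exact: gen_preenvelope.
  exact: tc_precover.
split=> //; exact: gen_self.
Qed.

(** Choose e in the annihilator of C so that all simple modules killed by e are
    killed by the annihilator: then A/<e> and A/ann C have equally many simple
    modules. *)
Lemma P_support_tau_tilting C n (s : 'I_n -> fdmod A) :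
    torsion_closed C -> (forall X, exists D (f : 'Hom(X, D)), preenvelope C f) ->
    representatives (fun Y => indecomposable Y /\ ext_projective C Y) s ->
  support_tau_tilting (msums s).
Proof.
move=> Ctc Cpre sP; have [sC sn sall] := sP.
have [CS Sext] : ext_projective C (msums s).
  by apply: (ext_projective_msums Ctc) => i; case: (sC i).
have Srigid Y : gen (msums s) Y -> ext1_zero (msums s) Y.
  by move=> SY; apply/Sext/(tc_gen Ctc CS SY).
split; first exact/tau_rigidP.
have [I [IC Isimples]] := num_simples_annihilator Ctc Cpre sP.
have [e [eI ee eS]] := ideal_idempotent I.
have Ce X : C X -> killed (principal_ideal e) X.
  by move=> CX; apply/killed_principal => x; apply: (proj1 (IC e) eI).
exists e => //.
have [t st] := fin_all_exists (fun i => descend (Ce _ (proj1 (proj2 (sC i))))).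
exists (msums t); last first.
  exact: biprod_iso (biprod_msums s) (infl_biprod (biprod_msums t)) st.
have ST := biprod_iso (biprod_msums s) (infl_biprod (biprod_msums t)) st.
split.
  apply/tau_rigidP => Y TY; apply: infl_ext1_zero; apply: (ext1_zero_iso ST).
  exact/Srigid/(gen_iso (iso_sym ST))/infl_gen.
exists n; split.
  exists t; apply: indec_summands_msums => [i|i j /infl_iso ij].
    by apply/infl_indec; apply: indec_iso (st i) _; case: (sC i).
  by apply: sn; apply: iso_trans (st i) (iso_trans ij (iso_sym (st j))).
apply/num_simples_quot; have [u uP] := Isimples; exists u.
apply: eq_representatives uP => S; split=> -[Ss Sk]; split=> //.
  by apply/killed_principal => x; apply: Sk.
by apply: eS => //; apply/killed_principal.
Qed.

Lemma killed_gen (I : ideal A) T X : killed I T -> gen T X -> killed I X.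
Proof.
move=> kT /gen_power[n [p [ph ps]]]; apply: (killed_surj ph ps) => a x aI.
have [f [q [fh _ _ _ fq]]] := biprod_msums (fun _ : 'I_n => T).
rewrite (fq x) linear_sum big1 // => i _ /=.
by rewrite -fh kT ?linear0.
Qed.

(** The k indecomposable summands of T are among the m indecomposable
    Ext-projective modules of gen T.  Since e annihilates gen T, the m simple
    modules of A/ann (gen T) are simple over A/<e>, which has only k of them. *)
Lemma P_gen T : basic T -> support_tau_tilting T -> is_P (gen T) T.
Proof.
move=> [k [s [si sn Ts]]] [Trigid [e ee [N [Nrigid [n [Nn simples]]] TN]]].
have [Ttc _ Tff Tep] := tau_rigid_torsion Trigid.
have Tpre := functorially_finite_preenvelope Tff.
have [m [t [tP _ _]]] := P_exists Ttc Tpre.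
have sQ i : indecomposable (s i) /\ ext_projective (gen T) (s i).
  split=> //; apply: (ext_projective_retract Ttc) Tep.
  exact: retract_trans (msums_retract s i) (iso_retract (iso_sym Ts)).
have km : (k <= m)%N.
  by have [_ _ tall] := tP; apply: (nonisos_le sn) => i; apply: tall.
have nk : (n <= k)%N.
  have [u [uN un _]] := Nn.
  apply: (@nonisos_le _ _ _ _ (fun i => inflation (u i)) s) => [i j /infl_iso/un //|i].
  have [ui /summandP uNi] := uN i.
  have ui' : indecomposable (inflation (u i)) by apply/infl_indec.
  have uT : retract (inflation (u i)) (msums s).
    apply: retract_trans (iso_retract (iso_trans (iso_sym TN) Ts)).
    exact/infl_retract.
  have [j uj] := indec_retract_msums ui' uT.
  by exists j; apply: indec_retract_indec.
have mn : (m <= n)%N.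
  have [I [IC Isimples]] := num_simples_annihilator Ttc Tpre tP.
  apply: num_classes_le Isimples (proj1 (num_simples_quot _ _) simples) => S [Ss Sk].
  split=> //; apply/killed_principal => x; apply: Sk; apply/IC => X y TX.
  apply: (proj1 (killed_principal e X)); apply: killed_gen TX.
  exact: killed_iso (iso_sym TN) (@infl_killed _ _ _ N).
have km' : k = m by apply/eqP; rewrite eqn_leq km (leq_trans mn nk).
case: _ / km' in t tP km mn nk *.
by exists k, s; split=> //; apply: nonisos_representatives tP sQ sn.
Qed.

End Correspondence.

Theorem mainTheorem1 (K : closedFieldType) (A : fdAlgType K) :
  exists (F : basic_stt_classes A -> ff_torsion_classes A)
         (G : ff_torsion_classes A -> basic_stt_classes A),
    [/\ cancel F G, cancel G F,
        forall (c : basic_stt_classes A) (T : fdmod A),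
          sval c T -> sval (F c) = gen T
      & forall (C : ff_torsion_classes A) (P : fdmod A),
          sval (G C) P <-> is_P (sval C) P].
Proof.
have sval_eq (T : Type) (Q : T -> Prop) (u v : {x | Q x}) : sval u = sval v -> u = v.
  by case: u v => x ux [y vy] /= xy; case: _ / xy in vy *; congr exist; apply: proof_irrelevance.
have pred_eq (C C' : fdmod A -> Prop) : (forall X, C X <-> C' X) -> C = C'.
  by move=> CC; apply: functional_extensionality => X; apply/propositional_extensionality/CC.
(* for an isomorphism class C this is gen T for any member T of C *)
pose Fc (C : fdmod A -> Prop) X := exists2 T, C T & gen T X.
have FcE (C : fdmod A -> Prop) T : is_iso_class C T -> Fc C = gen T.
  move=> CT; apply: pred_eq => X; split=> [[T' /CT TT']|TX].
    exact/gen_iso/iso_sym.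
  by exists T => //; apply/CT/iso_refl.
have FcP (c : basic_stt_classes A) :
    torsion_class (Fc (sval c)) /\ functorially_finite (Fc (sval c)).
  case: c => C [T [Tb Tstt CT]] /=; rewrite (FcE _ _ CT); case: Tstt => Trigid _.
  by have [] := tau_rigid_torsion Trigid.
have GcP (C : ff_torsion_classes A) :
    exists T, [/\ basic T, support_tau_tilting T & is_iso_class (is_P (sval C)) T].
  case: C => C [Ct Cff] /=; have Ctc := torsion_class_closed Ct.
  have Cpre := functorially_finite_preenvelope Cff.
  have [n [s [sP _ _]]] := P_exists Ctc Cpre; have [sC sn _] := sP.
  exists (msums s); split.
  - exists n, s; split=> [i|//|]; last exact: iso_refl.
    by case: (sC i).
  - exact: P_support_tau_tilting Ctc Cpre sP.
  have PS : is_P C (msums s) by exists n, s; split=> //; apply: iso_refl.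
  move=> X; split=> [|SX]; first exact: is_P_unique.
  exact: is_P_iso SX PS.
pose F c : ff_torsion_classes A := exist _ _ (FcP c).
pose G C : basic_stt_classes A := exist _ _ (GcP C).
exists F, G; split.
- move=> c; apply: sval_eq; apply: pred_eq => X /=.
  case: c => C [T [Tb Tstt CT]] /=; rewrite (FcE _ _ CT).
  have PT := P_gen Tb Tstt; split=> [PX|/CT TX]; last exact: is_P_iso PT.
  exact/CT/(is_P_unique PT).
- move=> [C [Ct Cff]]; apply: sval_eq => /=; have Ctc := torsion_class_closed Ct.
  have [n [s [sP _ CS]]] := P_exists Ctc (functorially_finite_preenvelope Cff).
  have PS : is_P C (msums s) by exists n, s; split=> //; apply: iso_refl.
  rewrite (FcE _ (msums s)); first by apply: pred_eq => X; rewrite CS.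
  move=> X; split=> [|SX]; first exact: is_P_unique.
  exact: is_P_iso SX PS.
- move=> [C [T' [_ _ CT']]] T /= CT; apply: FcE => X; split=> [/CT'|TX].
    by apply: iso_trans; apply/iso_sym/CT'.
  by apply/CT'; apply: iso_trans TX; apply/CT'.
by [].
Qed.
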